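(* Let $n\ge 1$ and let $\gamma_0,\gamma_1,\dots,\gamma_{n-1}\in C(\partial\Omega;\mathbb{R})$. Then $$\frac{\partial^n S_n[\gamma_0,\gamma_1,\dots,\gamma_{n-1}](z)}{\partial\overline z^{\,n}}=0,\qquad z\in\Omega,$$ and, for every $t\in\partial\Omega$ and every $k=0,1,\dots,n-1$, $$\left\{\mathrm{Re}\,\frac{\partial^k S_n[\gamma_0,\gamma_1,\dots,\gamma_{n-1}]}{\partial\overline z^{\,k}}\right\}^+(t)=\gamma_k(t),$$ where for $k=0$ the derivative of order $k$ means $S_n[\gamma_0,\dots,\gamma_{n-1}]$ itself.
   Context: Fix $0<r<1$, $\alpha\ge 1/2$, $\theta=\pi/\alpha$. The sector ring is $\Omega=\{z\in\mathbb{C}: r<|z|<1,\ 0<\arg z<\pi/\alpha\}$, with corner points $r$, $1$, $\varpi=e^{i\theta}$, $\omega=re^{i\theta}$. Its boundary $\partial\Omega=[r,1]\cup\Gamma_1\cup[\varpi,\omega]\cup\Gamma_2$ is oriented counter-clockwise: $[r,1]$ is the segment from $r$ to $1$; $\Gamma_1$ is $\tau\mapsto e^{i\tau}$ with $\tau$ running from $0$ to $\pi/\alpha$; $[\varpi,\omega]$ is the segment from $\varpi$ to $\omega$; $\Gamma_2$ is $\tau\mapsto re^{i\tau}$ with $\tau$ running from $\pi/\alpha$ to $0$. Powers are $z^\beta=|z|^\beta e^{i\beta\arg z}$ with $\arg z\in[0,\pi/\alpha]$ on $\overline\Omega$ ($\arg=0$ on $[r,1]$, $\arg=\pi/\alpha$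 on $[\varpi,\omega]$). For a function $u$ on $\Omega$, $\{u\}^+(t)=\lim_{z\in\Omega,\,z\to t}u(z)$ for $t\in\partial\Omega$. The kernels are $$H_1(z,\zeta)=\frac{\zeta+z}{\zeta-z}-\frac{\overline{\zeta}+z}{\overline{\zeta}-z}+2\sum_{n=1}^\infty r^{2\alpha n}\left[\frac{\zeta}{r^{2\alpha n}\zeta-z}-\frac{z}{r^{2\alpha n}z-\zeta}-\frac{\overline{\zeta}}{r^{2\alpha n}\overline{\zeta}-z}+\frac{z}{r^{2\alpha n}z-\overline{\zeta}}\right],$$ $$H_2(z,\zeta)=\frac{1}{\zeta-z}-\frac{z}{1-z\zeta}+\sum_{n=1}^\infty r^{2\alpha n}\left[\frac{1}{r^{2\alpha n}\zeta-z}-\frac{z}{\zeta(r^{2\alpha n}z-\zeta)}-\frac{1}{\zeta(r^{2\alpha n}-z\zeta)}+\frac{z}{r^{2\alpha n}z\zeta-1}\right].$$ The poly-Schwarz operator is, for $z\in\Omega$, $$\begin{aligned}S_n[\gamma_0,\dots,\gamma_{n-1}](z)=\sum_{k=0}^{n-1}\frac{(-1)^k}{k!}\bigg\{&\frac{\alpha}{2\pi i}\int_{\Gamma_1\cup\Gamma_2}\gamma_k(\zeta)\left(\zeta-z+\overline{\zeta-z}\right)^kH_1(z^\alpha,\zeta^\alpha)\frac{d\zeta}{\zeta}\\&+\frac{\alpha}{\pi i}\int_{[\varpi,\omega]\cup[r,1]}\gamma_k(\zeta)\left(\zeta-z+\overline{\zeta-z}\right)^kH_2(z^\alpha,\zeta^\alpha)\zeta^{\alpha-1}\,d\zeta\bigg\}.\end{aligned}$$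 *)

(* Defs.v *)
From Stdlib Require Import Reals Lra Factorial.
From Coquelicot Require Import Coquelicot.
Open Scope R_scope.

Definition polar (s phi : R) : C := (s * cos phi, s * sin phi).

(* The argument normalised to [0, 2 PI), i.e. cut along the positive real axis;
   it is meaningful for z <> 0 only. *)
Definition Carg (z : C) : R :=
  if Rle_dec 0 (Im z) then acos (Re z / Cmod z)
  else 2 * PI - acos (Re z / Cmod z).

Lemma Carg_polar (s phi : R) :
  0 < s -> 0 <= phi < 2 * PI -> Carg (polar s phi) = phi.
Proof.
intros Hs Hphi.
assert (Hm : Cmod (polar s phi) = s).
{ unfold Cmod, polar; simpl.
  replace (_ + _) with (s * s * ((sin phi)² + (cos phi)²)) by (unfold Rsqr; ring).
  rewrite sin2_cos2, Rmult_1_r; apply sqrt_square; lra. }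
unfold Carg; rewrite Hm; simpl.
replace (s * cos phi / s) with (cos phi) by (field; lra).
destruct (Rle_dec 0 (s * sin phi)) as [H|H].
- apply acos_cos; split; [lra|].
  destruct (Rle_dec phi PI) as [|Hp]; [assumption|exfalso].
  assert (sin phi < 0) by (apply sin_lt_0; lra).
  nra.
- assert (PI < phi).
  { destruct (Rle_dec phi PI) as [Hp|]; [exfalso|lra].
    apply H, Rmult_le_pos; [lra|apply sin_ge_0; lra]. }
  replace (cos phi) with (cos (2 * PI - phi)).
  + rewrite acos_cos; lra.
  + rewrite cos_minus, cos_2PI, sin_2PI; ring.
Qed.

(* [polar_pow s phi b] is the power of exponent b of the point of modulus s
   and chosen argument phi. On the boundary the argument has to be passed
   explicitly: for alpha = 1/2 the segments [r,1] and [varpi,omega] coincide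
   as sets but carry the arguments 0 and 2 PI. *)
Definition polar_pow (s phi b : R) : C := polar (Rpower s b) (b * phi).

Definition Cpower (z : C) (b : R) : C := polar_pow (Cmod z) (Carg z) b.

Definition Omega (r alpha : R) (z : C) : Prop :=
  r < Cmod z < 1 /\ 0 < Carg z < PI / alpha.

Definition bdry_Omega (r alpha : R) (t : C) : Prop :=
  (exists s, r <= s <= 1 /\ t = polar s 0) \/
  (exists tau, 0 <= tau <= PI / alpha /\ t = polar 1 tau) \/
  (exists s, r <= s <= 1 /\ t = polar s (PI / alpha)) \/
  (exists tau, 0 <= tau <= PI / alpha /\ t = polar r tau).

Definition CSeries (a : nat -> C) : C :=
  (Series (fun n => Re (a n)), Series (fun n => Im (a n))).

Definition CRInt (f : R -> C) (a b : R) : C :=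
  RInt (V := C_R_CompleteNormedModule) f a b.

(* Integrals of F(zeta) dzeta, where F receives the modulus and the argument
   of zeta: over Gamma_1 and Gamma_2, and over [varpi,omega] and [r,1]. *)
Definition int_arcs (r alpha : R) (F : R -> R -> C) : C :=
  (CRInt (fun tau => F 1%R tau * (Ci * polar 1 tau)) 0 (PI / alpha)
   + CRInt (fun tau => F r tau * (Ci * polar r tau)) (PI / alpha) 0)%C.

Definition int_segments (r alpha : R) (F : R -> R -> C) : C :=
  (CRInt (fun s => F s (PI / alpha)%R * polar 1 (PI / alpha)) 1 r
   + CRInt (fun s => F s 0%R * polar 1 0) r 1)%C.

Definition H1 (r alpha : R) (z zeta : C) : C :=
  ((zeta + z) / (zeta - z) - (Cconj zeta + z) / (Cconj zeta - z)
   + 2 * CSeries (fun m =>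
       let q := RtoC (Rpower r (2 * alpha * INR (S m))) in
       q * (zeta / (q * zeta - z) - z / (q * z - zeta)
            - Cconj zeta / (q * Cconj zeta - z) + z / (q * z - Cconj zeta))))%C.

Definition H2 (r alpha : R) (z zeta : C) : C :=
  (1 / (zeta - z) - z / (1 - z * zeta)
   + CSeries (fun m =>
       let q := RtoC (Rpower r (2 * alpha * INR (S m))) in
       q * (1 / (q * zeta - z) - z / (zeta * (q * z - zeta))
            - 1 / (zeta * (q - z * zeta)) + z / (q * z * zeta - 1))))%C.

Definition poly_Schwarz (r alpha : R) (n : nat) (gamma : nat -> C -> R) (z : C)
  : C :=
  sum_n_m (G := C_AbelianGroup) (fun k =>
    RtoC ((-1) ^ k / INR (fact k)) *
    (RtoC alpha / (2 * PI * Ci) *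
       int_arcs r alpha (fun s phi =>
         let zeta := polar s phi in
         RtoC (gamma k zeta) * (zeta - z + Cconj (zeta - z)) ^ k *
         H1 r alpha (Cpower z alpha) (polar_pow s phi alpha) / zeta)
     + RtoC alpha / (PI * Ci) *
       int_segments r alpha (fun s phi =>
         let zeta := polar s phi in
         RtoC (gamma k zeta) * (zeta - z + Cconj (zeta - z)) ^ k *
         H2 r alpha (Cpower z alpha) (polar_pow s phi alpha) *
         polar_pow s phi (alpha - 1))))%C 0 (pred n).

Definition partial_x (f : C -> C) (z : C) : C :=
  (Derive (fun x => Re (f (x, Im z))) (Re z),
   Derive (fun x => Im (f (x, Im z))) (Re z)).

Definition partial_y (f : C -> C) (z : C) : C :=
  (Derive (fun y => Re (f (Re z, y))) (Im z),
   Derive (fun y => Im (f (Re z, y))) (Im z)).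

Definition dbar (f : C -> C) (z : C) : C :=
  ((partial_x f z + Ci * partial_y f z) / 2)%C.

Definition dbar_n (k : nat) (f : C -> C) : C -> C := Nat.iter k dbar f.

Definition R_differentiable (f : C -> C) (z : C) : Prop :=
  ex_filterdiff (U := C_R_NormedModule) (V := C_R_NormedModule) f (locally z).

(* Main.v *)
Require Import Defs.
From Stdlib Require Import Reals Lra Lia Factorial FunctionalExtensionality.
From Coquelicot Require Import Coquelicot.
Open Scope R_scope.

(* The power w = z^alpha maps the sector ring onto the upper half D of the ring
   rho < |w| < 1, rho = r^alpha. With q = rho^2 and the Villat kernel
   K(u) = sum_n (q^n u + 1) / (q^n u - 1), both H1 and 2 zeta H2 are, up to an
   additive constant with no effect on real parts, differences
   K(c w) - K(c' w). The rules K(1/u) = -K(u), K(q u) = K(u) - 2 and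
   K(conj u) = conj K(u) show that the resulting Poisson kernel P vanishes at
   every boundary point of D other than its pole, and that the contour integral
   of the w-derivative of the kernel is zero, so that P has constant mass; near
   the midpoint of the side [rho, 1] the mass is seen to be 1. As P is moreover
   bounded below, the usual approximation-of-unity argument gives the boundary
   values of Re S_1, corners included.

   For n > 1, let T_m be the Schwarz integral with data
   gamma (2 Re zeta - 2 Re z)^m. It satisfies the recursion
   T_(m+1)[gamma] = T_m[2 Re zeta gamma] - 2 Re z T_m[gamma], whence
   dbar T_m = - m T_(m-1), and Re T_m tends to 0 on the boundary for m > 0. *)

(** The obstacle is the corners. There poles of different terms of the kernel merge, and the mass
    splits between two sides in proportions that depend on the direction of approach, so no side has
    a limiting mass of its own. Two features get around this. The lower bound P >= - N is uniform up
    to the corners and gives |P| <= P + 2 N, so the mass controls the integral of |P|; and only the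
    total mass over the four sides has to be known. Decay away from the pole follows from the
    vanishing of P on the boundary by a Lipschitz bound.

    Every differentiation under a sum or an integral rests on the exact second-order remainder of 1
    / u, kept uniform by a separation from all poles.

    For alpha = 1/2 the domain is a slit ring and a point of the slit has two images under the power
    map. Hence data are functions of modulus and argument, and w is only compared with some boundary
    point of D, not with an image of t.

    The recursion for T_m moves the dependence of the data on z out of the integrals, which leaves
    only holomorphic integrals to differentiate. *)

Lemma re_minus (a b : C) : Re (a - b) = Re a - Re b.
Proof. reflexivity. Qed.

Lemma im_minus (a b : C) : Im (a - b) = Im a - Im b.
Proof. reflexivity. Qed.

Lemma im_le_Cmod (z : C) : Rabs (Im z) <= Cmod z.
Proof.
eapply Rle_trans; [apply Rmax_r|apply (Rmax_Cmod z)].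
Qed.

Lemma Cmod_le_abs_Re_Im (z : C) : Cmod z <= Rabs (Re z) + Rabs (Im z).
Proof.
replace z with (RtoC (Re z) + RtoC (Im z) * Ci)%C at 1.
- eapply Rle_trans; [apply Cmod_triangle|].
  rewrite Cmod_mult, Cmod_Ci, !Cmod_R; lra.
- apply injective_projections; simpl; unfold Re, Im; ring.
Qed.

Lemma Cmod_sub_le (x y : C) : Cmod x - Cmod y <= Cmod (x - y).
Proof.
pose proof (Cmod_triangle (x - y) y) as H.
replace (x - y + y)%C with x in H by ring; lra.
Qed.

Lemma Cmod_sub_sym (x y : C) : Cmod (x - y) = Cmod (y - x).
Proof.
rewrite <- Cmod_opp; f_equal; ring.
Qed.

Lemma Cmod_pos_neq0 (z : C) : 0 < Cmod z -> z <> 0%C.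
Proof.
apply Cmod_gt_0.
Qed.

(** * Complex series with a geometric majorant *)

Definition geom_dom (M q : R) (a : nat -> C) : Prop :=
  forall n, Cmod (a n) <= M * q ^ n.

Lemma geom_dom_ex (M q : R) (a : nat -> R) :
  0 < q < 1 -> (forall n, Rabs (a n) <= M * q ^ n) ->
  ex_series (fun n => Rabs (a n)) /\ Rabs (Series a) <= M / (1 - q).
Proof.
intros Hq H.
assert (Hg : ex_series (fun n => M * q ^ n)).
{ apply (ex_series_scal (V := R_NormedModule) M), ex_series_geom.
  rewrite Rabs_pos_eq; lra. }
assert (Ha : ex_series (fun n => Rabs (a n))).
{ apply (ex_series_le (V := R_CompleteNormedModule) _ (fun n => M * q ^ n)); [|exact Hg].
  intros n; change (norm (Rabs (a n))) with (Rabs (Rabs (a n))).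
  rewrite Rabs_Rabsolu; apply H. }
split; [exact Ha|].
eapply Rle_trans; [apply Series_Rabs, Ha|].
eapply Rle_trans; [apply (Series_le _ (fun n => M * q ^ n))|].
- intros n; split; [apply Rabs_pos|apply H].
- exact Hg.
- rewrite Series_scal_l, Series_geom by (rewrite Rabs_pos_eq; lra).
  right; field; lra.
Qed.

Lemma geom_dom_Re (M q : R) (a : nat -> C) :
  0 < q < 1 -> geom_dom M q a ->
  ex_series (fun n => Re (a n)) /\ Rabs (Series (fun n => Re (a n))) <= M / (1 - q).
Proof.
intros Hq H.
destruct (geom_dom_ex M q (fun n => Re (a n)) Hq) as [H1 H2].
- intros n; eapply Rle_trans; [apply re_le_Cmod|apply H].
- split; [apply ex_series_Rabs, H1|exact H2].
Qed.

Lemma geom_dom_Im (M q : R) (a : nat -> C) :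
  0 < q < 1 -> geom_dom M q a ->
  ex_series (fun n => Im (a n)) /\ Rabs (Series (fun n => Im (a n))) <= M / (1 - q).
Proof.
intros Hq H.
destruct (geom_dom_ex M q (fun n => Im (a n)) Hq) as [H1 H2].
- intros n; eapply Rle_trans; [apply im_le_Cmod|apply H].
- split; [apply ex_series_Rabs, H1|exact H2].
Qed.

(** The factor 2 comes from bounding the real and imaginary parts separately. *)
Lemma CSeries_bound (M q : R) (a : nat -> C) :
  0 < q < 1 -> geom_dom M q a -> Cmod (CSeries a) <= 2 * M / (1 - q).
Proof.
intros Hq H.
destruct (geom_dom_Re M q a Hq H) as [_ H1].
destruct (geom_dom_Im M q a Hq H) as [_ H2].
eapply Rle_trans; [apply Cmod_le_abs_Re_Im|].
unfold CSeries; simpl; lra.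
Qed.

Lemma CSeries_ext (a b : nat -> C) :
  (forall n, a n = b n) -> CSeries a = CSeries b.
Proof.
intros H; unfold CSeries; f_equal; apply Series_ext; intros n; now rewrite H.
Qed.

(** [Series] is total but additive only on convergent series; the majorants are there to certify
    convergence, and their constants do not enter the conclusion. *)
Lemma CSeries_plus (M N q : R) (a b : nat -> C) :
  0 < q < 1 -> geom_dom M q a -> geom_dom N q b ->
  CSeries (fun n => a n + b n)%C = (CSeries a + CSeries b)%C.
Proof.
intros Hq Ha Hb.
apply injective_projections; simpl; rewrite <- Series_plus.
- reflexivity.
- apply (geom_dom_Re M q a Hq Ha).
- apply (geom_dom_Re N q b Hq Hb).
- reflexivity.
- apply (geom_dom_Im M q a Hq Ha).
- apply (geom_dom_Im N q b Hq Hb).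
Qed.

Lemma geom_dom_scal (M q : R) (c : C) (a : nat -> C) :
  geom_dom M q a -> geom_dom (Cmod c * M) q (fun n => c * a n)%C.
Proof.
intros H n; rewrite Cmod_mult, Rmult_assoc.
apply Rmult_le_compat_l; [apply Cmod_ge_0|apply H].
Qed.

Lemma geom_dom_plus (M N q : R) (a b : nat -> C) :
  geom_dom M q a -> geom_dom N q b -> geom_dom (M + N) q (fun n => a n + b n)%C.
Proof.
intros Ha Hb n; eapply Rle_trans; [apply Cmod_triangle|].
specialize (Ha n); specialize (Hb n); lra.
Qed.

Lemma CSeries_scal (M q : R) (c : C) (a : nat -> C) :
  0 < q < 1 -> geom_dom M q a ->
  CSeries (fun n => c * a n)%C = (c * CSeries a)%C.
Proof.
intros Hq Ha.
destruct (geom_dom_Re M q a Hq Ha) as [H1 _].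
destruct (geom_dom_Im M q a Hq Ha) as [H2 _].
apply injective_projections; simpl; rewrite <- !Series_scal_l.
- rewrite <- Series_minus; try (apply (ex_series_scal (V := R_NormedModule)); assumption).
  apply Series_ext; intros n; simpl; unfold Re, Im; ring.
- rewrite <- Series_plus; try (apply (ex_series_scal (V := R_NormedModule)); assumption).
  apply Series_ext; intros n; simpl; unfold Re, Im; ring.
Qed.

Lemma CSeries_minus (M N q : R) (a b : nat -> C) :
  0 < q < 1 -> geom_dom M q a -> geom_dom N q b ->
  CSeries (fun n => a n - b n)%C = (CSeries a - CSeries b)%C.
Proof.
intros Hq Ha Hb.
rewrite (CSeries_ext _ (fun n => a n + (-1) * b n)%C) by (intros n; ring).
rewrite (CSeries_plus M (Cmod (-1) * N) q); [|assumption..|apply geom_dom_scal, Hb].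
rewrite (CSeries_scal N q) by assumption; ring.
Qed.

Lemma CSeries_incr_1 (M q : R) (a : nat -> C) :
  0 < q < 1 -> geom_dom M q a ->
  CSeries a = (a O + CSeries (fun n => a (S n)))%C.
Proof.
intros Hq Ha.
apply injective_projections; simpl.
- rewrite Series_incr_1 by apply (geom_dom_Re M q a Hq Ha); reflexivity.
- rewrite Series_incr_1 by apply (geom_dom_Im M q a Hq Ha); reflexivity.
Qed.

Lemma CSeries_conj (a : nat -> C) :
  CSeries (fun n => Cconj (a n)) = Cconj (CSeries a).
Proof.
apply injective_projections; simpl; [reflexivity|].
rewrite <- Series_opp; apply Series_ext; reflexivity.
Qed.

(** * The Villat kernel *)

(** Half the sum of the terms of index n and -n of the Villat series, for p = q^n: these terms are 2
    p u / (p u - 1) - 1 and 1 - 2 p / (p - u), so the constants cancel and what is left is of order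
    p. *)
Definition kterm (p : R) (u : C) : C :=
  (p * u / (p * u - 1) - p / (p - u))%C.

Definition kterm' (p : R) (u : C) : C :=
  (- (p / ((p * u - 1) * (p * u - 1))) - p / ((p - u) * (p - u)))%C.

Definition ktail (q : R) (u : C) : C := CSeries (fun n => kterm (q ^ S n) u).

Definition ktail' (q : R) (u : C) : C := CSeries (fun n => kterm' (q ^ S n) u).

(* The Villat kernel [sum_n (q^n u + 1) / (q^n u - 1)] over all integers n,
   summed symmetrically; its poles are the integer powers of q. *)
Definition Kv (q : R) (u : C) : C := ((u + 1) / (u - 1) + 2 * ktail q u)%C.

Definition Kv' (q : R) (u : C) : C :=
  (- (2 / ((u - 1) * (u - 1))) + 2 * ktail' q u)%C.

(** Separation from every pole except 1. The first distance is the one from u to the pole q^-(n+1),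
    multiplied by q^(n+1). A single [d] for all n is what makes the termwise bounds summable. *)
Definition off_poles (q d : R) (u : C) : Prop :=
  forall n, d <= Cmod (RtoC (q ^ S n) * u - 1) /\ d <= Cmod (RtoC (q ^ S n) - u).

Lemma pow_S_bounds (q : R) (n : nat) : 0 < q < 1 -> 0 < q ^ S n <= q ^ n /\ q ^ S n <= q.
Proof.
intros Hq.
assert (0 < q ^ n) by (apply pow_lt; lra).
assert (q ^ n <= 1) by (rewrite <- (pow1 n); apply pow_incr; lra).
simpl; nra.
Qed.

Lemma Cinv_bound (d : R) (a : C) : 0 < d -> d <= Cmod a -> a <> 0%C /\ Cmod (/ a) <= / d.
Proof.
intros Hd Ha.
assert (a <> 0%C) by (apply Cmod_pos_neq0; lra).
split; [assumption|].
rewrite Cmod_inv by assumption.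
apply Rinv_le_contravar; lra.
Qed.

(** The remainder is exactly (b - a)^2 / (a^2 b). All differentiability statements about the kernel
    go back to this identity. *)
Lemma Cinv_taylor2 (d : R) (a b : C) :
  0 < d -> d <= Cmod a -> d <= Cmod b ->
  Cmod (/ b - / a + (b - a) / (a * a)) <= Cmod (b - a) ^ 2 / d ^ 3.
Proof.
intros Hd Ha Hb.
destruct (Cinv_bound d a Hd Ha) as [Ha0 Ha1].
destruct (Cinv_bound d b Hd Hb) as [Hb0 Hb1].
replace (/ b - / a + (b - a) / (a * a))%C with ((b - a) * (b - a) * (/ a * / a * / b))%C
  by (field; split; assumption).
rewrite !Cmod_mult.
replace (Cmod (b - a) ^ 2 / d ^ 3) with (Cmod (b - a) * Cmod (b - a) * (/ d * / d * / d))
  by (field; lra).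
apply Rmult_le_compat_l.
- apply Rmult_le_pos; apply Cmod_ge_0.
- repeat apply Rmult_le_compat; repeat apply Rmult_le_pos; try apply Cmod_ge_0; assumption.
Qed.

Lemma kterm_bound (p d : R) (u : C) :
  0 < p -> 0 < d -> d <= Cmod (p * u - 1) -> d <= Cmod (p - u) ->
  Cmod (kterm p u) <= (Cmod u + 1) / d * p.
Proof.
intros Hp Hd Ha Hb.
destruct (Cinv_bound d _ Hd Ha) as [Ha0 Ha1].
destruct (Cinv_bound d _ Hd Hb) as [Hb0 Hb1].
unfold kterm, Cdiv, Cminus at 1.
eapply Rle_trans; [apply Cmod_triangle|].
rewrite Cmod_opp, !Cmod_mult, Cmod_R, Rabs_pos_eq by lra.
replace ((Cmod u + 1) / d * p) with (p * Cmod u * / d + p * / d) by (field; lra).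
apply Rplus_le_compat; apply Rmult_le_compat_l; try assumption; [|lra].
apply Rmult_le_pos; [lra|apply Cmod_ge_0].
Qed.

Lemma kterm'_bound (p d : R) (u : C) :
  0 < p -> 0 < d -> d <= Cmod (p * u - 1) -> d <= Cmod (p - u) ->
  Cmod (kterm' p u) <= 2 / d ^ 2 * p.
Proof.
intros Hp Hd Ha Hb.
destruct (Cinv_bound d _ Hd Ha) as [Ha0 Ha1].
destruct (Cinv_bound d _ Hd Hb) as [Hb0 Hb1].
unfold kterm', Cdiv, Cminus at 1.
eapply Rle_trans; [apply Cmod_triangle|].
rewrite !Cmod_opp, !Cmod_mult, Cmod_R, Rabs_pos_eq by lra.
rewrite !Cmod_inv, !Cmod_mult by (apply Cmult_neq_0; assumption).
rewrite !Rinv_mult, <- !Cmod_inv by assumption.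
replace (2 / d ^ 2 * p) with (p * (/ d * / d) + p * (/ d * / d)) by (field; lra).
apply Rplus_le_compat; apply Rmult_le_compat_l; try lra;
  apply Rmult_le_compat; try apply Cmod_ge_0; assumption.
Qed.

(** Since [kterm p u] equals 1 + 1 / (p u - 1) - p / (p - u), the remainder splits into two
    instances of [Cinv_taylor2]. In the first one the increment is scaled by p, and p^2 <= p leaves
    the factor p needed for summation. *)
Lemma kterm_taylor2 (p d : R) (u v : C) :
  0 < p <= 1 -> 0 < d -> d <= Cmod (p * u - 1) -> d <= Cmod (p - u) ->
  d <= Cmod (p * v - 1) -> d <= Cmod (p - v) ->
  Cmod (kterm p v - kterm p u - kterm' p u * (v - u)) <= 2 * Cmod (v - u) ^ 2 / d ^ 3 * p.
Proof.
intros Hp Hd Ha Hb Ha' Hb'.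
destruct (Cinv_bound d _ Hd Ha) as [Ha0 _].
destruct (Cinv_bound d _ Hd Hb) as [Hb0 _].
destruct (Cinv_bound d _ Hd Ha') as [Ha0' _].
destruct (Cinv_bound d _ Hd Hb') as [Hb0' _].
replace (kterm p v - kterm p u - kterm' p u * (v - u))%C
  with ((/ (p * v - 1) - / (p * u - 1) + ((p * v - 1) - (p * u - 1)) / ((p * u - 1) * (p * u - 1)))
     - p * (/ (p - v) - / (p - u) + ((p - v) - (p - u)) / ((p - u) * (p - u))))%C
  by (unfold kterm, kterm'; field; repeat split; assumption).
unfold Cminus at 1.
eapply Rle_trans; [apply Cmod_triangle|].
rewrite Cmod_opp, Cmod_mult, Cmod_R, (Rabs_pos_eq p) by lra.
pose proof (Cinv_taylor2 d _ _ Hd Ha Ha') as H1.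
pose proof (Cinv_taylor2 d _ _ Hd Hb Hb') as H2.
replace (p * v - 1 - (p * u - 1))%C with (p * (v - u))%C in * by ring.
replace (p - v - (p - u))%C with (- (v - u))%C in * by ring.
rewrite Cmod_opp in H2. rewrite Cmod_mult, Cmod_R, (Rabs_pos_eq p) in H1 by lra.
set (X := Cmod (v - u)) in *.
assert (HX : 0 <= X ^ 2 / d ^ 3).
{ apply Rmult_le_pos; [apply pow2_ge_0|]. left; apply Rinv_0_lt_compat, pow_lt, Hd. }
replace ((p * X) ^ 2 / d ^ 3) with (p * p * (X ^ 2 / d ^ 3)) in H1 by (field; lra).
replace (2 * X ^ 2 / d ^ 3 * p) with (p * (X ^ 2 / d ^ 3) + p * (X ^ 2 / d ^ 3)) by (field; lra).
apply Rplus_le_compat; [|apply Rmult_le_compat_l; [lra|exact H2]].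
eapply Rle_trans; [exact H1|].
apply Rmult_le_compat_r; [exact HX|nra].
Qed.

Lemma geom_dom_S (M q : R) (a : nat -> C) :
  0 < q < 1 -> 0 <= M -> (forall n, Cmod (a n) <= M * q ^ S n) -> geom_dom M q a.
Proof.
intros Hq HM H n.
eapply Rle_trans; [apply H|].
apply Rmult_le_compat_l; [exact HM|].
apply (pow_S_bounds q n Hq).
Qed.

Lemma ktail_dom (q d : R) (u : C) :
  0 < q < 1 -> 0 < d -> off_poles q d u ->
  geom_dom ((Cmod u + 1) / d) q (fun n => kterm (q ^ S n) u).
Proof.
intros Hq Hd H.
apply geom_dom_S; [exact Hq| |].
- apply Rdiv_le_0_compat; [pose proof (Cmod_ge_0 u); lra|exact Hd].
- intros n; apply kterm_bound; try apply H; try apply (pow_S_bounds q n Hq); exact Hd.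
Qed.

Lemma ktail'_dom (q d : R) (u : C) :
  0 < q < 1 -> 0 < d -> off_poles q d u ->
  geom_dom (2 / d ^ 2) q (fun n => kterm' (q ^ S n) u).
Proof.
intros Hq Hd H.
apply geom_dom_S; [exact Hq| |].
- apply Rdiv_le_0_compat; [lra|apply pow_lt, Hd].
- intros n; apply kterm'_bound; try apply H; try apply (pow_S_bounds q n Hq); exact Hd.
Qed.

Lemma ktail_bound (q d : R) (u : C) :
  0 < q < 1 -> 0 < d -> off_poles q d u ->
  Cmod (ktail q u) <= 2 * ((Cmod u + 1) / d) / (1 - q).
Proof.
intros Hq Hd H; apply CSeries_bound; [exact Hq|]; apply ktail_dom; assumption.
Qed.

Lemma ktail'_bound (q d : R) (u : C) :
  0 < q < 1 -> 0 < d -> off_poles q d u ->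
  Cmod (ktail' q u) <= 2 * (2 / d ^ 2) / (1 - q).
Proof.
intros Hq Hd H; apply CSeries_bound; [exact Hq|]; apply ktail'_dom; assumption.
Qed.

(** Summing the quadratic remainders term by term takes the place of a theorem on differentiating
    series. *)
Lemma ktail_taylor2 (q d : R) (u v : C) :
  0 < q < 1 -> 0 < d -> off_poles q d u -> off_poles q d v ->
  Cmod (ktail q v - ktail q u - ktail' q u * (v - u))
    <= 2 * (2 * Cmod (v - u) ^ 2 / d ^ 3) / (1 - q).
Proof.
intros Hq Hd Hu Hv.
replace (ktail q v - ktail q u - ktail' q u * (v - u))%C
  with (CSeries (fun n => kterm (q ^ S n) v - kterm (q ^ S n) u
                          - (v - u) * kterm' (q ^ S n) u)%C).
- apply CSeries_bound; [exact Hq|].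
  apply geom_dom_S; [exact Hq| |].
  + apply Rdiv_le_0_compat; [|apply pow_lt, Hd].
    pose proof (pow2_ge_0 (Cmod (v - u))); lra.
  + intros n; rewrite (Cmult_comm (v - u)).
    destruct (Hu n), (Hv n), (pow_S_bounds q n Hq) as [[P1 P2] P3].
    apply kterm_taylor2; try assumption; lra.
- unfold ktail, ktail'.
  pose proof (ktail_dom q d u Hq Hd Hu) as Du.
  pose proof (ktail_dom q d v Hq Hd Hv) as Dv.
  pose proof (ktail'_dom q d u Hq Hd Hu) as Du'.
  assert (Duv : geom_dom ((Cmod v + 1) / d + Cmod (-1) * ((Cmod u + 1) / d)) q
     (fun n => kterm (q ^ S n) v - kterm (q ^ S n) u)%C).
  { intros n.
    replace (kterm (q ^ S n) v - kterm (q ^ S n) u)%C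
      with (kterm (q ^ S n) v + (-1) * kterm (q ^ S n) u)%C by ring.
    apply (geom_dom_plus _ _ q _ _ Dv (geom_dom_scal _ q (-1) _ Du) n). }
  rewrite (CSeries_minus _ _ q _ _ Hq Duv (geom_dom_scal _ q (v - u) _ Du')).
  rewrite (CSeries_minus _ _ q _ _ Hq Dv Du), (CSeries_scal _ q _ _ Hq Du').
  ring.
Qed.

Lemma off_poles_perturb (q d : R) (u v : C) :
  0 < q < 1 -> off_poles q d u -> Cmod (v - u) <= d / 2 -> off_poles q (d / 2) v.
Proof.
intros Hq H Huv n.
destruct (H n) as [H1 H2], (pow_S_bounds q n Hq) as [[P1 _] P3].
pose proof (Cmod_ge_0 (v - u)) as Hp.
split.
- pose proof (Cmod_sub_le (RtoC (q ^ S n) * u - 1) (RtoC (q ^ S n) * (u - v))) as E.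
  replace (RtoC (q ^ S n) * u - 1 - RtoC (q ^ S n) * (u - v))%C
    with (RtoC (q ^ S n) * v - 1)%C in E by ring.
  rewrite (Cmod_mult _ (u - v)), Cmod_R, Rabs_pos_eq, (Cmod_sub_sym u v) in E by lra.
  nra.
- pose proof (Cmod_sub_le (RtoC (q ^ S n) - u) (v - u)) as E.
  replace (RtoC (q ^ S n) - u - (v - u))%C
    with (RtoC (q ^ S n) - v)%C in E by ring.
  lra.
Qed.

(** [Kv_C] serves for the quadratic remainder of [Kv] and [Kv_L] for its derivative; in each the
    first summand comes from the pole 1 and the second from the tail. *)
Definition Kv_C (q d : R) : R := 2 / d ^ 3 + 8 / (d ^ 3 * (1 - q)).
Definition Kv_L (q d : R) : R := 2 / d ^ 2 + 8 / (d ^ 2 * (1 - q)).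

Definition regular (q d : R) (u : C) : Prop := d <= Cmod (u - 1) /\ off_poles q d u.

Lemma Kv_taylor2 (q d : R) (u v : C) :
  0 < q < 1 -> 0 < d -> regular q d u -> regular q d v ->
  Cmod (Kv q v - Kv q u - Kv' q u * (v - u)) <= Kv_C q d * Cmod (v - u) ^ 2.
Proof.
intros Hq Hd [Hu1 Hu] [Hv1 Hv].
destruct (Cinv_bound d _ Hd Hu1) as [Hu0 _].
destruct (Cinv_bound d _ Hd Hv1) as [Hv0 _].
replace (Kv q v - Kv q u - Kv' q u * (v - u))%C
  with (2 * (/ (v - 1) - / (u - 1) + ((v - 1) - (u - 1)) / ((u - 1) * (u - 1)))
        + 2 * (ktail q v - ktail q u - ktail' q u * (v - u)))%C
  by (unfold Kv, Kv'; field; split; assumption).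
eapply Rle_trans; [apply Cmod_triangle|].
rewrite !Cmod_mult, Cmod_R, Rabs_pos_eq by lra.
pose proof (Cinv_taylor2 d _ _ Hd Hu1 Hv1) as H1.
pose proof (ktail_taylor2 q d u v Hq Hd Hu Hv) as H2.
replace (v - 1 - (u - 1))%C with (v - u)%C in * by ring.
replace (Kv_C q d * Cmod (v - u) ^ 2)
  with (2 * (Cmod (v - u) ^ 2 / d ^ 3) + 2 * (2 * (2 * Cmod (v - u) ^ 2 / d ^ 3) / (1 - q)))
  by (unfold Kv_C; field; split; lra).
lra.
Qed.

Lemma Kv'_bound (q d : R) (u : C) :
  0 < q < 1 -> 0 < d -> regular q d u -> Cmod (Kv' q u) <= Kv_L q d.
Proof.
intros Hq Hd [Hu1 Hu].
destruct (Cinv_bound d _ Hd Hu1) as [Hu0 Hu2].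
unfold Kv'.
eapply Rle_trans; [apply Cmod_triangle|].
unfold Cdiv; rewrite Cmod_opp, !Cmod_mult, !Cmod_R, !Rabs_pos_eq by lra.
rewrite Cmod_inv, Cmod_mult by (apply Cmult_neq_0; assumption).
rewrite Rinv_mult, <- !Cmod_inv by assumption.
pose proof (ktail'_bound q d u Hq Hd Hu).
replace (Kv_L q d) with (2 * (/ d * / d) + 2 * (2 * (2 / d ^ 2) / (1 - q)))
  by (unfold Kv_L; field; split; lra).
apply Rplus_le_compat; [|lra].
apply Rmult_le_compat_l; [lra|].
apply Rmult_le_compat; try apply Cmod_ge_0; assumption.
Qed.

Lemma Kv_C_pos (q d : R) : 0 < q < 1 -> 0 < d -> 0 < Kv_C q d.
Proof.
intros Hq Hd; unfold Kv_C.
assert (0 < d ^ 3) by (apply pow_lt, Hd).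
apply Rplus_lt_0_compat; apply Rdiv_lt_0_compat; try lra.
apply Rmult_lt_0_compat; lra.
Qed.

Lemma Kv_L_pos (q d : R) : 0 < q < 1 -> 0 < d -> 0 < Kv_L q d.
Proof.
intros Hq Hd; unfold Kv_L.
assert (0 < d ^ 2) by (apply pow_lt, Hd).
apply Rplus_lt_0_compat; apply Rdiv_lt_0_compat; try lra.
apply Rmult_lt_0_compat; lra.
Qed.

Lemma Kv_lipschitz (q d B : R) (u v : C) :
  0 < q < 1 -> 0 < d -> regular q d u -> regular q d v -> Cmod (v - u) <= B ->
  Cmod (Kv q v - Kv q u) <= (Kv_L q d + Kv_C q d * B) * Cmod (v - u).
Proof.
intros Hq Hd Hu Hv HB.
pose proof (Kv_taylor2 q d u v Hq Hd Hu Hv) as H1.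
pose proof (Kv'_bound q d u Hq Hd Hu) as H2.
replace (Kv q v - Kv q u)%C
  with ((Kv q v - Kv q u - Kv' q u * (v - u)) + Kv' q u * (v - u))%C by ring.
eapply Rle_trans; [apply Cmod_triangle|].
rewrite Cmod_mult.
pose proof (Cmod_ge_0 (v - u)).
pose proof (Kv_C_pos q d Hq Hd).
assert (Cmod (Kv' q u) * Cmod (v - u) <= Kv_L q d * Cmod (v - u))
  by (apply Rmult_le_compat_r; assumption).
assert (Kv_C q d * Cmod (v - u) ^ 2 <= Kv_C q d * B * Cmod (v - u)); [|lra].
rewrite Rmult_assoc; apply Rmult_le_compat_l; [lra|].
simpl; rewrite Rmult_1_r; apply Rmult_le_compat_r; assumption.
Qed.

(* Adding the second-order expansions at [u] and at [v] leaves
   [(Kv' u - Kv' v) (v - u)]. *)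
Lemma Kv'_lipschitz (q d : R) (u v : C) :
  0 < q < 1 -> 0 < d -> regular q d u -> regular q d v ->
  Cmod (Kv' q v - Kv' q u) <= 2 * Kv_C q d * Cmod (v - u).
Proof.
intros Hq Hd Hu Hv.
destruct (Req_dec (Cmod (v - u)) 0) as [E|E].
- replace v with u.
  + replace (Kv' q u - Kv' q u)%C with (RtoC 0) by ring.
    replace (u - u)%C with (RtoC 0) by ring. rewrite Cmod_0; lra.
  + apply Cmod_eq_0 in E. replace u with (v - (v - u))%C by ring.
    rewrite E; ring.
- pose proof (Kv_taylor2 q d u v Hq Hd Hu Hv) as H1.
  pose proof (Kv_taylor2 q d v u Hq Hd Hv Hu) as H2.
  pose proof (Cmod_ge_0 (v - u)).
  rewrite (Cmod_sub_sym u v) in H2.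
  apply (Rmult_le_reg_r (Cmod (v - u))); [lra|].
  rewrite <- Cmod_mult.
  replace ((Kv' q v - Kv' q u) * (v - u))%C
    with ((Kv q v - Kv q u - Kv' q u * (v - u)) + (Kv q u - Kv q v - Kv' q v * (u - v)))%C by ring.
  eapply Rle_trans; [apply Cmod_triangle|].
  simpl in *; lra.
Qed.

Lemma regular_perturb (q d : R) (u v : C) :
  0 < q < 1 -> regular q d u -> Cmod (v - u) <= d / 2 -> regular q (d / 2) v.
Proof.
intros Hq [H1 H] Huv; split; [|apply (off_poles_perturb q d u); assumption].
pose proof (Cmod_sub_le (u - 1) (u - v)) as E.
replace (u - 1 - (u - v))%C with (v - 1)%C in E by ring.
rewrite (Cmod_sub_sym u v) in E; lra.
Qed.

(** Inversion exchanges the two fractions of [kterm], so the symmetric sum is odd term by term. *)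
Lemma Kv_inv (q d : R) (u : C) :
  0 < q < 1 -> 0 < d -> u <> 0%C -> regular q d u -> Kv q (/ u) = (- Kv q u)%C.
Proof.
intros Hq Hd Hu0 [Hu1 Hu].
destruct (Cinv_bound d _ Hd Hu1) as [Hu2 _].
unfold Kv, ktail.
rewrite (CSeries_ext (fun n => kterm (q ^ S n) (/ u)) (fun n => (-1) * kterm (q ^ S n) u)%C).
- rewrite (CSeries_scal _ q _ _ Hq (ktail_dom q d u Hq Hd Hu)).
  assert (1 - u <> 0)%C.
  { intros E; apply Hu2; replace (u - 1)%C with (- (1 - u))%C by ring; rewrite E; ring. }
  field; repeat split; assumption.
- intros n; unfold kterm.
  destruct (Hu n) as [H1 H2].
  destruct (Cinv_bound d _ Hd H1) as [H3 _].
  destruct (Cinv_bound d _ Hd H2) as [H4 _].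
  field; repeat split; assumption.
Qed.

Lemma ktail_conj (q d : R) (u : C) :
  0 < d -> off_poles q d u -> ktail q (Cconj u) = Cconj (ktail q u).
Proof.
intros Hd Hu.
assert (HR : forall x : R, Cconj x = x)
  by (intros x; apply injective_projections; simpl; ring).
unfold ktail; rewrite <- CSeries_conj.
apply CSeries_ext; intros n; unfold kterm.
destruct (Hu n) as [H1 H2].
destruct (Cinv_bound d _ Hd H1) as [H3 _].
destruct (Cinv_bound d _ Hd H2) as [H4 _].
rewrite Cminus_conj, !Cdiv_conj, !Cminus_conj, !Cmult_conj, !HR by assumption.
reflexivity.
Qed.

Lemma Kv_conj (q d : R) (u : C) :
  0 < d -> regular q d u -> Kv q (Cconj u) = Cconj (Kv q u).
Proof.
intros Hd [Hu1 Hu].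
destruct (Cinv_bound d _ Hd Hu1) as [Hu2 _].
assert (HR : forall x : R, Cconj x = x)
  by (intros x; apply injective_projections; simpl; ring).
unfold Kv; rewrite (ktail_conj q d u Hd Hu).
rewrite Cplus_conj, Cmult_conj, Cdiv_conj, Cplus_conj, Cminus_conj, !HR by assumption.
reflexivity.
Qed.

(** Only the poles other than 1 are kept away from, so this applies where u itself tends to 1 and
    the singular part is treated separately. *)
Lemma ktail_lipschitz (q d B : R) (u v : C) :
  0 < q < 1 -> 0 < d -> off_poles q d u -> off_poles q d v -> Cmod (v - u) <= B ->
  Cmod (ktail q v - ktail q u) <= (4 / (d ^ 2 * (1 - q)) + 4 / (d ^ 3 * (1 - q)) * B) * Cmod (v - u).
Proof.
intros Hq Hd Hu Hv HB.
pose proof (ktail_taylor2 q d u v Hq Hd Hu Hv) as H1.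
pose proof (ktail'_bound q d u Hq Hd Hu) as H2.
replace (ktail q v - ktail q u)%C
  with ((ktail q v - ktail q u - ktail' q u * (v - u)) + ktail' q u * (v - u))%C by ring.
eapply Rle_trans; [apply Cmod_triangle|].
rewrite Cmod_mult.
pose proof (Cmod_ge_0 (v - u)) as Hp.
assert (0 < d ^ 2 /\ 0 < d ^ 3) as [D2 D3] by (split; apply pow_lt, Hd).
assert (HC : 0 < 4 / (d ^ 3 * (1 - q)))
  by (apply Rdiv_lt_0_compat; [lra|apply Rmult_lt_0_compat; lra]).
replace (2 * (2 * Cmod (v - u) ^ 2 / d ^ 3) / (1 - q))
  with (4 / (d ^ 3 * (1 - q)) * (Cmod (v - u) * Cmod (v - u))) in H1 by (field; split; lra).
replace (2 * (2 / d ^ 2) / (1 - q)) with (4 / (d ^ 2 * (1 - q))) in H2 by (field; split; lra).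
assert (T1 : Cmod (ktail' q u) * Cmod (v - u) <= 4 / (d ^ 2 * (1 - q)) * Cmod (v - u))
  by (apply Rmult_le_compat_r; assumption).
assert (T2 : 4 / (d ^ 3 * (1 - q)) * (Cmod (v - u) * Cmod (v - u))
   <= 4 / (d ^ 3 * (1 - q)) * (B * Cmod (v - u))).
{ apply Rmult_le_compat_l; [lra|]. apply Rmult_le_compat_r; assumption. }
lra.
Qed.

(** Each of the two fractions of [kterm] is summable on its own. Multiplication by q shifts one of
    these series forward and the other backward, and the two boundary terms together with the
    fraction at the pole 1 leave the constant -2. *)
Lemma Kv_shift (q d : R) (u : C) :
  0 < q < 1 -> 0 < d -> regular q d u -> Kv q (q * u)%C = (Kv q u - 2)%C.
Proof.
intros Hq Hd [Hu1 Hu].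
assert (Hq0 : RtoC q <> 0%C) by (intros E; apply RtoC_inj in E; lra).
(* [a] starts at q^1 and [b] at q^0, so that the tails at u and at q u are both differences of these
   two series, each time with one of them shifted by one. *)
set (a := fun n => (RtoC (q ^ S n) * u / (RtoC (q ^ S n) * u - 1))%C).
set (b := fun n => (RtoC (q ^ n) / (RtoC (q ^ n) - u))%C).
assert (Da : geom_dom (Cmod u / d) q a).
{ apply geom_dom_S; [exact Hq|apply Rdiv_le_0_compat; [apply Cmod_ge_0|exact Hd]|].
  intros n; destruct (Hu n) as [H _]; destruct (Cinv_bound d _ Hd H) as [H1 H2].
  destruct (pow_S_bounds q n Hq) as [[P1 _] _].
  unfold a, Cdiv; rewrite !Cmod_mult, Cmod_R, Rabs_pos_eq by lra.
  replace (Cmod u / d * q ^ S n) with (q ^ S n * Cmod u * / d) by (field; lra).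
  apply Rmult_le_compat_l; [|exact H2].
  apply Rmult_le_pos; [lra|apply Cmod_ge_0]. }
assert (Hb : forall n, d <= Cmod (RtoC (q ^ n) - u)).
{ intros [|n]; [|apply Hu]. simpl; rewrite Cmod_sub_sym; exact Hu1. }
assert (Db : geom_dom (/ d) q b).
{ intros n; destruct (Cinv_bound d _ Hd (Hb n)) as [H1 H2].
  assert (0 < q ^ n) by (apply pow_lt; lra).
  unfold b, Cdiv; rewrite Cmod_mult, Cmod_R, Rabs_pos_eq by lra.
  rewrite Rmult_comm; apply Rmult_le_compat_r; [lra|exact H2]. }
assert (DaS : geom_dom (Cmod u / d) q (fun n => a (S n))).
{ intros n; eapply Rle_trans; [apply Da|].
  apply Rmult_le_compat_l; [apply Rdiv_le_0_compat; [apply Cmod_ge_0|exact Hd]|].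
  apply (pow_S_bounds q n Hq). }
assert (DbS : geom_dom (/ d) q (fun n => b (S n))).
{ intros n; eapply Rle_trans; [apply Db|].
  apply Rmult_le_compat_l; [left; apply Rinv_0_lt_compat, Hd|].
  apply (pow_S_bounds q n Hq). }
assert (E1 : ktail q u = (CSeries a - CSeries (fun n => b (S n)))%C).
{ rewrite <- (CSeries_minus _ _ q _ _ Hq Da DbS); reflexivity. }
assert (E2 : ktail q (q * u)%C = (CSeries (fun n => a (S n)) - CSeries b)%C).
{ rewrite <- (CSeries_minus _ _ q _ _ Hq DaS Db).
  apply CSeries_ext; intros n; unfold kterm, a, b.
  pose proof (proj1 (Cinv_bound d _ Hd (Hb n))) as H1.
  pose proof (proj1 (Cinv_bound d _ Hd (proj1 (Hu (S n))))) as H2.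
  change (q ^ S (S n)) with (q * q ^ S n) in *. change (q ^ S n) with (q * q ^ n) in *.
  rewrite !RtoC_mult in *.
  assert (E : (q * RtoC (q ^ n) - q * u = q * (RtoC (q ^ n) - u))%C) by ring.
  field; repeat split; try assumption.
  rewrite E; apply Cmult_neq_0; assumption. }
rewrite (CSeries_incr_1 _ q _ Hq Da) in E1.
rewrite (CSeries_incr_1 _ q _ Hq Db) in E2.
revert E1 E2.
generalize (CSeries (fun n => a (S n))) (CSeries (fun n => b (S n))); intros X Y E1 E2.
unfold Kv; rewrite E1, E2; unfold a, b.
pose proof (proj1 (Cinv_bound d _ Hd (Hb O))) as H1.
pose proof (proj1 (Cinv_bound d _ Hd (proj1 (Hu O)))) as H2.
simpl pow in *; rewrite Rmult_1_r in *.
assert (u - 1 <> 0)%C.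
{ intros F; apply H1; replace (1 - u)%C with (- (u - 1))%C by ring; rewrite F; ring. }
field; repeat split; assumption.
Qed.

Lemma regular_inv (q d B : R) (u : C) :
  0 < d -> u <> 0%C -> Cmod u <= B -> regular q d u -> regular q (d / B) (/ u).
Proof.
intros Hd Hu0 HB [Hu1 Hu].
pose proof (proj1 (Cmod_gt_0 u) Hu0) as Hp.
assert (Hk : forall x : C, d <= Cmod x -> d / B <= Cmod (x / u)).
{ intros x Hx; rewrite Cmod_div by assumption.
  apply Rmult_le_compat; [lra| |exact Hx|].
  - left; apply Rinv_0_lt_compat; lra.
  - apply Rinv_le_contravar; lra. }
split; [|intros n; split].
- replace (/ u - 1)%C with (- (u - 1) / u)%C by (field; exact Hu0).
  apply Hk; rewrite Cmod_opp; exact Hu1.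
- replace (RtoC (q ^ S n) * / u - 1)%C with ((RtoC (q ^ S n) - u) / u)%C by (field; exact Hu0).
  apply Hk, Hu.
- replace (RtoC (q ^ S n) - / u)%C with ((RtoC (q ^ S n) * u - 1) / u)%C by (field; exact Hu0).
  apply Hk, Hu.
Qed.

Lemma regular_shift (q d : R) (u : C) :
  0 < q < 1 -> 0 < d -> regular q d u -> regular q (q * d) (q * u)%C.
Proof.
intros Hq Hd [Hu1 Hu].
assert (E : q * d <= d) by nra.
split; [|intros n; split].
- pose proof (proj1 (Hu O)) as H; simpl in H; rewrite Rmult_1_r in H; lra.
- pose proof (proj1 (Hu (S n))) as H.
  replace (RtoC (q ^ S n) * (q * u) - 1)%C with (RtoC (q ^ S (S n)) * u - 1)%C; [lra|].
  simpl pow; rewrite !RtoC_mult; ring.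
- assert (H : d <= Cmod (RtoC (q ^ n) - u)).
  { destruct n as [|n]; [simpl; rewrite Cmod_sub_sym; exact Hu1|apply Hu]. }
  replace (RtoC (q ^ S n) - q * u)%C with (q * (RtoC (q ^ n) - u))%C by (simpl pow; rewrite RtoC_mult; ring).
  rewrite Cmod_mult, Cmod_R, Rabs_pos_eq by lra.
  apply Rmult_le_compat_l; lra.
Qed.

(** * Real part of the Villat kernel on the circles of squared radius 1, q and 1/q *)

Lemma Cmod_sqr_conj (u : C) : (u * Cconj u)%C = RtoC (Cmod u ^ 2).
Proof. rewrite <- Cmod2_conj; reflexivity. Qed.

Lemma Cconj_eq_div (u : C) (m : R) :
  u <> 0%C -> Cmod u ^ 2 = m -> Cconj u = (m * / u)%C.
Proof.
intros Hu Hm; rewrite <- Hm, <- Cmod_sqr_conj; field; exact Hu.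
Qed.

Lemma Cmod_sqr_neq0 (u : C) : 0 < Cmod u ^ 2 -> u <> 0%C.
Proof. intros H E; rewrite E, Cmod_0 in H; simpl in H; lra. Qed.

(** On a circle of squared radius m, conjugation is the map u -> m / u. For m = 1 oddness makes the
    kernel purely imaginary; the cases m = q and m = 1/q below need one shift more. *)
Lemma Re_Kv_mod1 (q d : R) (u : C) :
  0 < q < 1 -> 0 < d -> regular q d u -> Cmod u ^ 2 = 1 -> Re (Kv q u) = 0.
Proof.
intros Hq Hd Hu Hm.
assert (Hu0 : u <> 0%C) by (apply Cmod_sqr_neq0; lra).
pose proof (Kv_conj q d u Hd Hu) as H1.
rewrite (Cconj_eq_div u 1 Hu0 Hm), Cmult_1_l, (Kv_inv q d u Hq Hd Hu0 Hu) in H1.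
apply (f_equal Re) in H1; rewrite re_conj, re_opp in H1; lra.
Qed.

Lemma Kv_conj_modq (q d : R) (u : C) :
  0 < q < 1 -> 0 < d -> u <> 0%C -> regular q d u ->
  Kv q (q * / u)%C = (- Kv q u - 2)%C.
Proof.
intros Hq Hd Hu0 Hu.
rewrite (Kv_shift q (d / Cmod u)).
- rewrite (Kv_inv q d) by assumption; reflexivity.
- exact Hq.
- apply Rdiv_lt_0_compat; [exact Hd|apply Cmod_gt_0, Hu0].
- apply (regular_inv q d (Cmod u)); try assumption; lra.
Qed.

Lemma Re_Kv_modq (q d : R) (u : C) :
  0 < q < 1 -> 0 < d -> regular q d u -> Cmod u ^ 2 = q -> Re (Kv q u) = -1.
Proof.
intros Hq Hd Hu Hm.
assert (Hu0 : u <> 0%C) by (apply Cmod_sqr_neq0; lra).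
pose proof (Kv_conj q d u Hd Hu) as H1.
rewrite (Cconj_eq_div u q Hu0 Hm), (Kv_conj_modq q d u) in H1 by assumption.
apply (f_equal Re) in H1; rewrite re_conj, re_minus, re_opp, re_RtoC in H1; lra.
Qed.

Lemma Re_Kv_modqinv (q d : R) (u : C) :
  0 < q < 1 -> 0 < d -> regular q d u -> Cmod u ^ 2 = / q -> Re (Kv q u) = 1.
Proof.
intros Hq Hd Hu Hm.
pose proof (Re_Kv_modq q (q * d) (q * u)%C Hq (Rmult_lt_0_compat q d (proj1 Hq) Hd) (regular_shift q d u Hq Hd Hu)) as H.
rewrite Cmod_mult, Cmod_R, Rabs_pos_eq, Rpow_mult_distr, Hm in H by lra.
rewrite (Kv_shift q d u Hq Hd Hu) in H.
assert (E : q ^ 2 * / q = q) by (field; lra).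
specialize (H E); rewrite re_minus, re_RtoC in H; lra.
Qed.

Lemma polar_mult (s a t b : R) : (polar s a * polar t b)%C = polar (s * t) (a + b).
Proof.
unfold polar; apply injective_projections; simpl; rewrite ?cos_plus, ?sin_plus; ring.
Qed.

Lemma Cmod_polar (s a : R) : 0 <= s -> Cmod (polar s a) = s.
Proof.
intros Hs; unfold Cmod, polar; simpl.
replace (_ + _) with (s * s * ((sin a)² + (cos a)²)) by (unfold Rsqr; ring).
rewrite sin2_cos2, Rmult_1_r; apply sqrt_square, Hs.
Qed.

Lemma Cconj_polar (s a : R) : Cconj (polar s a) = polar s (- a).
Proof.
unfold polar, Cconj; simpl; rewrite cos_neg, sin_neg; f_equal; ring.
Qed.

Lemma polar_0 (s : R) : polar s 0 = RtoC s.
Proof.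
unfold polar; rewrite cos_0, sin_0; unfold RtoC; f_equal; ring.
Qed.

Lemma polar_PI (s : R) : polar s PI = RtoC (- s).
Proof.
unfold polar; rewrite cos_PI, sin_PI; unfold RtoC; f_equal; ring.
Qed.

(** * Poisson kernels of the half ring *)

Definition half_ring (rho : R) (w : C) : Prop :=
  rho <= Cmod w <= 1 /\ 0 <= Im w.

Lemma sqr_lt_1 (rho : R) : 0 < rho < 1 -> 0 < rho ^ 2 < 1.
Proof. intros H; simpl; split; nra. Qed.

(** With q = rho^2 the pole 1 is the only one in this annulus; the two distances are at least 1 -
    rho and rho - rho^2. *)
Lemma off_poles_annulus (rho : R) (u : C) :
  0 < rho < 1 -> rho <= Cmod u <= / rho -> off_poles (rho ^ 2) (rho * (1 - rho)) u.
Proof.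
intros Hr Hu n.
destruct (pow_S_bounds (rho ^ 2) n (sqr_lt_1 rho Hr)) as [[P1 _] P2].
set (p := (rho ^ 2) ^ S n) in *.
split.
- pose proof (Cmod_sub_le 1 (p * u)) as E.
  rewrite Cmod_1, Cmod_mult, Cmod_R, Rabs_pos_eq, Cmod_sub_sym in E by lra.
  assert (p * Cmod u <= rho ^ 2 * / rho) by (apply Rmult_le_compat; lra).
  replace (rho ^ 2 * / rho) with rho in * by (field; lra).
  nra.
- pose proof (Cmod_sub_le u p) as E.
  rewrite Cmod_sub_sym, Cmod_R, Rabs_pos_eq in E by lra.
  simpl in P2; nra.
Qed.

(** A product x w with x on a straight side can have modulus as small as rho^2 = q, so it may
    approach the pole q as well as 1. The entry rho d is the separation from q, and rho^2 (1 - rho)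
    the one from q^2, q^3 and so on. *)
Definition sep_const (rho d : R) : R := Rmin (rho * d) (rho ^ 2 * (1 - rho)).

Lemma sep_const_pos (rho d : R) : 0 < rho < 1 -> 0 < d -> 0 < sep_const rho d.
Proof.
intros Hr Hd; apply Rmin_glb_lt; [nra|].
apply Rmult_lt_0_compat; [apply pow_lt|]; lra.
Qed.

Lemma sep_const_le (rho d : R) :
  0 < rho < 1 -> 0 < d ->
  sep_const rho d <= rho * d /\ sep_const rho d <= d /\
  sep_const rho d <= rho * (1 - rho) /\ sep_const rho d <= rho ^ 2 * (1 - rho).
Proof.
intros Hr Hd; unfold sep_const.
pose proof (Rmin_l (rho * d) (rho ^ 2 * (1 - rho))).
pose proof (Rmin_r (rho * d) (rho ^ 2 * (1 - rho))).
assert (rho * d <= d) by nra.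
assert (rho ^ 2 * (1 - rho) <= rho * (1 - rho)) by (apply Rmult_le_compat_r; simpl; nra).
repeat split; lra.
Qed.

Lemma off_poles_le (q d d' : R) (u : C) : d' <= d -> off_poles q d u -> off_poles q d' u.
Proof.
intros H Hu n; destruct (Hu n); split; lra.
Qed.

Lemma Cmod_sqr (z : C) : Cmod z ^ 2 = Re z ^ 2 + Im z ^ 2.
Proof. apply Cmod2_alt. Qed.

Lemma sqr_le_le (x y : R) : 0 <= y -> x ^ 2 <= y ^ 2 -> x <= y.
Proof. intros; apply Rnot_lt_le; nra. Qed.

(** The squares of the two sides differ by 4 Im w Im o. This comparison decides later which of two
    poles is the nearer one. *)
Lemma Cmod_sub_conj_le (w o : C) :
  0 <= Im w -> 0 <= Im o -> Cmod (w - o) <= Cmod (w - Cconj o).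
Proof.
intros Hw Ho; apply sqr_le_le; [apply Cmod_ge_0|].
rewrite !Cmod_sqr; simpl; unfold Re, Im in *.
nra.
Qed.

Lemma arc_annulus (rho sig a : R) (w : C) :
  0 < rho < 1 -> half_ring rho w -> sig = 1 \/ sig = / rho ->
  rho <= Cmod (polar sig a * w) <= / rho.
Proof.
intros Hr [Hw _] Hs.
assert (H1 : 1 <= / rho) by (rewrite <- Rinv_1; apply Rinv_le_contravar; lra).
assert (E : rho * / rho = 1) by (field; lra).
rewrite Cmod_mult, Cmod_polar by (destruct Hs; lra).
destruct Hs; subst sig; nra.
Qed.

Lemma arc_dist (sig a : R) (w : C) :
  0 < sig -> Cmod (polar sig (- a) * w - 1) = sig * Cmod (w - polar (/ sig) a).
Proof.
intros Hs.
replace (polar sig (- a) * w - 1)%C with (polar sig (- a) * (w - polar (/ sig) a))%C.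
- rewrite Cmod_mult, Cmod_polar; lra.
- transitivity (polar sig (- a) * w - polar sig (- a) * polar (/ sig) a)%C; [ring|].
  rewrite polar_mult, Rinv_r, Rplus_opp_l, polar_0 by lra; reflexivity.
Qed.

Lemma arc_regular (rho d sig a : R) (w : C) :
  0 < rho < 1 -> 0 < d -> half_ring rho w -> sig = 1 \/ sig = / rho -> 0 <= sin a ->
  d <= Cmod (w - polar (/ sig) a) ->
  regular (rho ^ 2) (sep_const rho d) (polar sig a * w) /\
  regular (rho ^ 2) (sep_const rho d) (polar sig (- a) * w).
Proof.
intros Hr Hd Hw Hs Ha H.
destruct (sep_const_le rho d Hr Hd) as (L1 & L2 & L3 & L4).
assert (H1 : 1 <= sig).
{ destruct Hs; subst; [lra|]. rewrite <- Rinv_1 at 1; apply Rinv_le_contravar; lra. }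
split; (split; [|apply (off_poles_le _ (rho * (1 - rho))); [lra|];
   apply off_poles_annulus; [exact Hr|]; apply arc_annulus; assumption]).
- replace a with (- - a) by ring.
  rewrite arc_dist, <- Cconj_polar by lra.
  assert (Cmod (w - polar (/ sig) a) <= Cmod (w - Cconj (polar (/ sig) a))).
  { apply Cmod_sub_conj_le; [apply Hw|].
    simpl; apply Rmult_le_pos; [left; apply Rinv_0_lt_compat; lra|exact Ha]. }
  nra.
- rewrite arc_dist by lra; nra.
Qed.

(** The squares differ by (1 - x^2) (1 - |w|^2): reflection in the unit circle moves x away from
    w. *)
Lemma seg_dist_1 (x : R) (w : C) :
  Rabs x <= 1 -> Cmod w <= 1 -> Cmod (w - x) <= Cmod (x * w - 1).
Proof.
intros Hx Hw; apply sqr_le_le; [apply Cmod_ge_0|].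
pose proof (Cmod_sqr w) as E.
assert (Cmod w ^ 2 <= 1) by (pose proof (Cmod_ge_0 w); simpl; nra).
assert (x ^ 2 <= 1) by (rewrite <- (pow2_abs x); pose proof (Rabs_pos x); simpl; nra).
rewrite !Cmod_sqr; simpl in *; unfold Re, Im in *; nra.
Qed.

(** The squares differ by (x^2 - rho^2) (|w|^2 - rho^2), the same principle for reflection in the
    inner circle. *)
Lemma seg_dist_q (rho x : R) (w : C) :
  0 < rho -> rho <= Rabs x -> rho <= Cmod w -> rho * Cmod (w - x) <= Cmod (RtoC (rho ^ 2) - x * w).
Proof.
intros Hr Hx Hw; apply sqr_le_le; [apply Cmod_ge_0|].
pose proof (Cmod_sqr w) as E.
assert (rho ^ 2 <= Cmod w ^ 2) by (simpl; nra).
assert (rho ^ 2 <= x ^ 2) by (rewrite <- (pow2_abs x); simpl; nra).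
rewrite Rpow_mult_distr, !Cmod_sqr; simpl in *; unfold Re, Im in *; nra.
Qed.

Lemma seg_regular (rho d x : R) (w : C) :
  0 < rho < 1 -> 0 < d -> half_ring rho w -> rho <= Rabs x <= 1 -> d <= Cmod (w - x) ->
  regular (rho ^ 2) (sep_const rho d) (x * w) /\
  regular (rho ^ 2) (sep_const rho d) (RtoC (/ x) * w).
Proof.
intros Hr Hd [Hw _] Hx H.
destruct (sep_const_le rho d Hr Hd) as (L1 & L2 & L3 & L4).
assert (Hx0 : x <> 0) by (intros E; subst; rewrite Rabs_R0 in Hx; lra).
split; split.
- pose proof (seg_dist_1 x w ltac:(lra) ltac:(lra)); lra.
- pose proof (seg_dist_q rho x w ltac:(lra) ltac:(lra) ltac:(lra)).
  assert (Hxw : rho ^ 2 <= Cmod (x * w) <= 1).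
  { rewrite Cmod_mult, Cmod_R; simpl; nra. }
  pose proof (sqr_lt_1 rho Hr) as Hq.
  intros n; destruct (pow_S_bounds _ n Hq) as [[P1 _] P2].
  split.
  + pose proof (Cmod_sub_le 1 (RtoC ((rho ^ 2) ^ S n) * (x * w))) as E.
    rewrite Cmod_1, (Cmod_mult (RtoC ((rho ^ 2) ^ S n))), Cmod_R, (Rabs_pos_eq ((rho ^ 2) ^ S n)), Cmod_sub_sym in E by lra.
    assert ((rho ^ 2) ^ S n * Cmod (x * w) <= rho ^ 2 * 1) by (apply Rmult_le_compat; lra).
    assert (rho * (1 - rho) <= 1 - rho ^ 2) by (simpl; nra).
    lra.
  (* Only the pole q can be approached by x w, and there [seg_dist_q] is needed; the poles q^2, q^3,
     ... are excluded by the modulus alone. *)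
  + destruct n as [|n].
    * rewrite pow_1.
      assert (rho * d <= rho * Cmod (w - x)) by (apply Rmult_le_compat_l; lra); lra.
    * destruct (pow_S_bounds _ n Hq) as [[Q1 _] Q2].
      assert (P3 : (rho ^ 2) ^ S (S n) <= rho ^ 2 * rho ^ 2).
      { change ((rho ^ 2) ^ S (S n)) with (rho ^ 2 * (rho ^ 2) ^ S n).
        apply Rmult_le_compat_l; lra. }
      pose proof (Cmod_sub_le (x * w) (RtoC ((rho ^ 2) ^ S (S n)))) as E.
      rewrite Cmod_sub_sym, (Cmod_R ((rho ^ 2) ^ S (S n))), Rabs_pos_eq in E by lra.
      assert (rho ^ 2 * rho ^ 2 <= rho ^ 2 * rho) by (apply Rmult_le_compat_l; simpl; nra).
      lra.
- replace (RtoC (/ x) * w - 1)%C with (RtoC (/ x) * (w - x))%C.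
  + rewrite Cmod_mult, Cmod_R, Rabs_inv.
    assert (1 <= / Rabs x) by (rewrite <- Rinv_1; apply Rinv_le_contravar; lra).
    pose proof (Cmod_ge_0 (w - x)); nra.
  + rewrite RtoC_inv by exact Hx0. field; intros E; apply Hx0, RtoC_inj, E.
- apply (off_poles_le _ (rho * (1 - rho))); [lra|].
  apply off_poles_annulus; [exact Hr|].
  rewrite Cmod_mult, Cmod_R, Rabs_inv.
  assert (1 <= / Rabs x <= / rho).
  { split; [rewrite <- Rinv_1|]; apply Rinv_le_contravar; lra. }
  nra.
Qed.

(* With [sig = 1 / |zeta|] this is [H1 w zeta] for [zeta] of argument [a];
   it uses [Kv q (/ u) = - Kv q u]. *)
Definition arc_kernel (rho sig a : R) (w : C) : C :=
  (Kv (rho ^ 2) (polar sig a * w) - Kv (rho ^ 2) (polar sig (- a) * w))%C.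

(** For real x this is 2 x H2 w x minus the constant 2 (see [H2_Kv]). The segments contribute
    through the imaginary part, to which that real constant adds nothing. *)
Definition seg_kernel (rho x : R) (w : C) : C :=
  (Kv (rho ^ 2) (x * w) - Kv (rho ^ 2) (RtoC (/ x) * w))%C.

Definition half_ring_bdry (rho : R) (t : C) : Prop :=
  half_ring rho t /\ (Im t = 0 \/ Cmod t = 1 \/ Cmod t = rho).

Lemma Cconj_real (z : C) : Im z = 0 -> Cconj z = z.
Proof.
intros H; apply injective_projections; [reflexivity|].
unfold Im in H; simpl; rewrite H; ring.
Qed.

(** For real t the two terms are conjugate. On the arcs both arguments have the same squared
    modulus, one of 1, q and 1/q, where the real part of the Villat kernel is constant, so the terms
    cancel. *)
Lemma arc_kernel_bdry (rho d sig a : R) (t : C) :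
  0 < rho < 1 -> 0 < d -> half_ring_bdry rho t -> sig = 1 \/ sig = / rho -> 0 <= sin a ->
  d <= Cmod (t - polar (/ sig) a) -> Re (arc_kernel rho sig a t) = 0.
Proof.
intros Hr Hd [Ht Hb] Hs Ha H.
destruct (arc_regular rho d sig a t Hr Hd Ht Hs Ha H) as [R1 R2].
pose proof (sqr_lt_1 rho Hr) as Hq.
pose proof (sep_const_pos rho d Hr Hd) as Hc.
assert (Hsp : 0 < sig).
{ destruct Hs; subst; [lra|]. apply Rinv_0_lt_compat; lra. }
unfold arc_kernel; rewrite re_minus.
destruct Hb as [Hb|Hb].
- rewrite <- Cconj_polar, <- (Cconj_real t Hb) at 1.
  rewrite (Cconj_real t Hb).
  replace (Cconj (polar sig a) * t)%C with (Cconj (polar sig a * t))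
    by (rewrite Cmult_conj, (Cconj_real t Hb); reflexivity).
  rewrite (Kv_conj _ (sep_const rho d)), re_conj by assumption; ring.
- assert (M : forall b, Cmod (polar sig b * t) ^ 2 = (sig * Cmod t) ^ 2).
  { intros b; rewrite Cmod_mult, Cmod_polar by lra; reflexivity. }
  destruct Hs as [Hs|Hs], Hb as [Hb|Hb]; rewrite Hs, Hb in M.
  + rewrite !(Re_Kv_mod1 _ (sep_const rho d)); subst; try assumption; try ring;
      rewrite M; ring.
  + rewrite !(Re_Kv_modq _ (sep_const rho d)); subst; try assumption; try ring;
      rewrite M; ring.
  + rewrite !(Re_Kv_modqinv _ (sep_const rho d)); subst; try assumption; try ring;
      rewrite M; field; lra.
  + rewrite !(Re_Kv_mod1 _ (sep_const rho d)); subst; try assumption; try ring;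
      rewrite M; field; lra.
Qed.

(** For real t both terms are real. If |t|^2 = m, the conjugate of x t is m divided by t / x, and
    for m = 1 and m = q the functional equations give both terms the same imaginary part. *)
Lemma seg_kernel_bdry (rho d x : R) (t : C) :
  0 < rho < 1 -> 0 < d -> half_ring_bdry rho t -> rho <= Rabs x <= 1 ->
  d <= Cmod (t - x) -> Im (seg_kernel rho x t) = 0.
Proof.
intros Hr Hd [Ht Hb] Hx H.
destruct (seg_regular rho d x t Hr Hd Ht Hx H) as [R1 R2].
pose proof (sqr_lt_1 rho Hr) as Hq.
pose proof (sep_const_pos rho d Hr Hd) as Hc.
assert (Hx0 : x <> 0) by (intros E; subst; rewrite Rabs_R0 in Hx; lra).
assert (Ht0 : t <> 0%C) by (apply Cmod_pos_neq0; destruct Ht; lra).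
assert (HxC : RtoC x <> 0%C) by (intros E; apply Hx0, RtoC_inj, E).
set (v := (RtoC (/ x) * t)%C) in *.
assert (Hv0 : v <> 0%C).
{ apply Cmult_neq_0; [|exact Ht0].
  intros E; apply (Rinv_neq_0_compat x Hx0), RtoC_inj, E. }
assert (Hc1 : forall m, Cmod t ^ 2 = m -> Cconj (x * t) = (m * / v)%C).
{ intros m Hm. rewrite Cmult_conj, (Cconj_eq_div t m Ht0 Hm).
  unfold v; rewrite RtoC_inv by exact Hx0.
  replace (Cconj x) with (RtoC x) by (rewrite Cconj_real; reflexivity).
  field; split; assumption. }
pose proof (Kv_conj _ _ _ Hc R1) as K1.
unfold seg_kernel; fold v; rewrite im_minus.
destruct Hb as [Hb|[Hb|Hb]].
- assert (Hz : forall y : R, regular (rho ^ 2) (sep_const rho d) (y * t) -> Im (Kv (rho ^ 2) (y * t)%C) = 0).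
  { intros y Hy; pose proof (Kv_conj _ _ _ Hc Hy) as E.
    rewrite Cconj_real in E.
    - apply (f_equal Im) in E; rewrite im_conj in E; lra.
    - rewrite im_mult, Hb; simpl; ring. }
  unfold v; rewrite !Hz by assumption; ring.
- rewrite (Hc1 1), Cmult_1_l, (Kv_inv _ _ v Hq Hc Hv0 R2) in K1 by (rewrite Hb; ring).
  apply (f_equal Im) in K1; rewrite im_conj, im_opp in K1; lra.
- rewrite (Hc1 (rho ^ 2)), (Kv_conj_modq _ _ v Hq Hc Hv0 R2) in K1 by (rewrite Hb; ring).
  apply (f_equal Im) in K1; rewrite im_conj, im_minus, im_opp, im_RtoC in K1; lra.
Qed.

(** * Lower bounds for the kernels, uniform up to the boundary *)

Definition tail_const (rho : R) : R :=
  2 * ((/ rho + 1) / (rho * (1 - rho))) / (1 - rho ^ 2).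

Lemma ktail_annulus (rho : R) (u : C) :
  0 < rho < 1 -> rho <= Cmod u <= / rho -> Cmod (ktail (rho ^ 2) u) <= tail_const rho.
Proof.
intros Hr Hu.
pose proof (sqr_lt_1 rho Hr) as Hq.
assert (Hp : 0 < rho * (1 - rho)) by nra.
eapply Rle_trans; [apply (ktail_bound _ (rho * (1 - rho)) u Hq Hp (off_poles_annulus rho u Hr Hu))|].
unfold tail_const, Rdiv.
apply Rmult_le_compat_r; [left; apply Rinv_0_lt_compat; lra|].
apply Rmult_le_compat_l; [lra|].
apply Rmult_le_compat_r; [left; apply Rinv_0_lt_compat; lra|lra].
Qed.

Lemma mobius_parts (u : C) :
  u <> 1%C ->
  Re ((u + 1) / (u - 1)) = (Cmod u ^ 2 - 1) * / Cmod (u - 1) ^ 2 /\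
  Im ((u + 1) / (u - 1)) = - 2 * Im u * / Cmod (u - 1) ^ 2.
Proof.
intros Hu.
assert (H : Cmod (u - 1) ^ 2 <> 0).
{ apply pow_nonzero; intros E; apply Cmod_eq_0 in E; apply Hu.
  replace u with (u - 1 + 1)%C by ring; rewrite E; ring. }
rewrite (Cmod_sqr u) in *. rewrite (Cmod_sqr (u - 1)) in *.
destruct u as [a b]; simpl in *; split; field; intros E; apply H; simpl; lra.
Qed.

Lemma Rinv_sqr_le (a b : R) : 0 < a -> a <= b -> 0 < / b ^ 2 <= / a ^ 2.
Proof.
intros Ha Hab.
assert (0 < a ^ 2) by (apply pow_lt, Ha).
assert (a ^ 2 <= b ^ 2) by (apply pow_incr; lra).
split; [apply Rinv_0_lt_compat; lra|apply Rinv_le_contravar; lra].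
Qed.

Lemma regular_neq1 (q d : R) (u : C) : 0 < d -> regular q d u -> u <> 1%C.
Proof.
intros Hd [H _] E; subst.
replace (1 - 1)%C with (RtoC 0) in H by ring; rewrite Cmod_0 in H; lra.
Qed.

Lemma Re_Kv_split (q : R) (u : C) :
  u <> 1%C -> Re (Kv q u) = (Cmod u ^ 2 - 1) * / Cmod (u - 1) ^ 2 + 2 * Re (ktail q u).
Proof.
intros H; unfold Kv; rewrite re_plus, re_scal_l, (proj1 (mobius_parts u H)); reflexivity.
Qed.

Lemma Im_Kv_split (q : R) (u : C) :
  u <> 1%C -> Im (Kv q u) = - 2 * Im u * / Cmod (u - 1) ^ 2 + 2 * Im (ktail q u).
Proof.
intros H; unfold Kv; rewrite im_plus, im_scal_l, (proj2 (mobius_parts u H)); reflexivity.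
Qed.

(** Orientation sign: the inner arc, for which sig = 1 / rho, is run backwards. *)
Definition arc_sign (sig : R) : R := if Req_EM_T sig 1 then 1 else -1.

(** The singular parts of the two terms have the common numerator |sig w|^2 - 1, and
    [polar sig (- a) * w] is the argument nearer to the pole 1, so their difference has a fixed
    sign. The rest is two tails. The bound is independent of [d], which is what makes it usable as w
    tends to the boundary. *)
Lemma arc_kernel_lower (rho d sig a : R) (w : C) :
  0 < rho < 1 -> 0 < d -> half_ring rho w -> sig = 1 \/ sig = / rho -> 0 <= sin a ->
  d <= Cmod (w - polar (/ sig) a) ->
  - (4 * tail_const rho) <= arc_sign sig * Re (arc_kernel rho sig a w).
Proof.
intros Hr Hd Hw Hs Ha H.
destruct (arc_regular rho d sig a w Hr Hd Hw Hs Ha H) as [R1 R2].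
pose proof (sep_const_pos rho d Hr Hd) as Hc.
pose proof (arc_annulus rho sig a w Hr Hw Hs) as A1.
pose proof (arc_annulus rho sig (- a) w Hr Hw Hs) as A2.
assert (H1r : 1 < / rho) by (rewrite <- Rinv_1; apply Rinv_lt_contravar; lra).
assert (Hsp : 0 < sig) by (destruct Hs; lra).
set (u := (polar sig a * w)%C) in *. set (v := (polar sig (- a) * w)%C) in *.
assert (Mu : Cmod u = sig * Cmod w) by (unfold u; rewrite Cmod_mult, Cmod_polar; lra).
assert (Mv : Cmod v = sig * Cmod w) by (unfold v; rewrite Cmod_mult, Cmod_polar; lra).
unfold arc_kernel; fold u v.
rewrite re_minus, !Re_Kv_split
  by (apply (regular_neq1 (rho ^ 2) (sep_const rho d)); assumption).
pose proof (ktail_annulus rho u Hr A1) as T1.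
pose proof (ktail_annulus rho v Hr A2) as T2.
pose proof (re_le_Cmod (ktail (rho ^ 2) u)) as T3.
pose proof (re_le_Cmod (ktail (rho ^ 2) v)) as T4.
apply Rabs_le_between in T3. apply Rabs_le_between in T4.
assert (L : Cmod (v - 1) <= Cmod (u - 1)).
{ unfold u, v; replace a with (- - a) at 2 by ring.
  rewrite !arc_dist, <- (Cconj_polar _ a) by lra.
  apply Rmult_le_compat_l; [lra|]; apply Cmod_sub_conj_le; [apply Hw|].
  simpl; apply Rmult_le_pos; [left; apply Rinv_0_lt_compat; lra|exact Ha]. }
destruct R2 as [R2 _].
destruct (Rinv_sqr_le (Cmod (v - 1)) (Cmod (u - 1)) ltac:(lra) L) as [I1 I2].
rewrite Mu, Mv.
set (X := / Cmod (u - 1) ^ 2) in *. set (Y := / Cmod (v - 1) ^ 2) in *.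
unfold arc_sign; destruct Hw as [Hw _].
destruct Hs as [Hs|Hs].
- destruct (Req_EM_T sig 1) as [_|F]; [|contradiction].
  rewrite Hs, Rmult_1_l.
  assert (Cmod w ^ 2 <= 1) by (simpl; nra).
  nra.
- destruct (Req_EM_T sig 1) as [F|_]; [lra|].
  assert (1 <= sig * Cmod w).
  { rewrite Hs; replace 1 with (/ rho * rho) by (field; lra).
    apply Rmult_le_compat_l; lra. }
  assert (1 <= (sig * Cmod w) ^ 2) by (simpl; nra).
  set (m := (sig * Cmod w) ^ 2) in *. nra.
Qed.

Lemma sign_mult_abs (x : R) : sign x * x = Rabs x.
Proof.
destruct (Rtotal_order x 0) as [H|[H|H]].
- rewrite sign_eq_m1, Rabs_left by assumption; ring.
- rewrite H, Rabs_R0; ring.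
- rewrite sign_eq_1, Rabs_pos_eq by lra; ring.
Qed.

Lemma sign_bound (x y : R) : Rabs y <= x -> forall s : R, - x <= sign s * y.
Proof.
intros H s; apply Rabs_le_between in H.
destruct (Rtotal_order s 0) as [E|[E|E]].
- rewrite sign_eq_m1 by exact E; lra.
- rewrite E, sign_0; lra.
- rewrite sign_eq_1 by exact E; lra.
Qed.

Lemma Cmod_sub_neq (d : R) (w v : C) : 0 < d -> d <= Cmod (w - v) -> w <> v.
Proof.
intros Hd H E; subst; replace (v - v)%C with (RtoC 0) in H by ring; rewrite Cmod_0 in H; lra.
Qed.

Lemma Cdiv_sub_1 (x : R) (w : C) :
  x <> 0 -> (RtoC (/ x) * w - 1 = RtoC (/ x) * (w - x))%C.
Proof.
intros Hx; transitivity (RtoC (/ x) * w - RtoC (/ x) * RtoC x)%C; [|ring].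
rewrite <- (RtoC_mult (/ x) x), Rinv_l by exact Hx; reflexivity.
Qed.

Lemma Im_Kv_div (q x : R) (w : C) :
  x <> 0 -> w <> RtoC x ->
  Im (Kv q (RtoC (/ x) * w))
    = - (2 * x * Im w * / Cmod (w - x) ^ 2) + 2 * Im (ktail q (RtoC (/ x) * w)).
Proof.
intros Hx Hwx.
assert (H : 0 < Cmod (w - x)).
{ apply Cmod_gt_0; intros E; apply Hwx; replace w with (w - x + x)%C by ring; rewrite E; ring. }
rewrite Im_Kv_split.
- f_equal; rewrite (Cdiv_sub_1 x w Hx), Cmod_mult, Cmod_R, im_scal_l, Rpow_mult_distr, pow2_abs.
  field; split; [lra|exact Hx].
- intros E; apply (f_equal (fun z => z - 1)%C) in E; rewrite (Cdiv_sub_1 x w Hx) in E.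
  replace (1 - 1)%C with (RtoC 0) in E by ring.
  apply (f_equal Cmod) in E; rewrite Cmod_mult, Cmod_R, Cmod_0 in E.
  apply Rmult_integral in E; destruct E as [E|E]; [|lra].
  revert E; apply Rabs_no_R0, Rinv_neq_0_compat, Hx.
Qed.

(* [Kv (x w)] has poles close to both [1] and [q]; the one at [q] is moved to
   [1] by [Kv_shift] when [Cmod (x w) < rho]. In both cases its singular part is
   at most that of [Kv (w / x)], which has the favourable sign. *)
Lemma seg_kernel_lower (rho d x : R) (w : C) :
  0 < rho < 1 -> 0 < d -> half_ring rho w -> rho <= Rabs x <= 1 -> d <= Cmod (w - x) ->
  - (4 * tail_const rho) <= sign x * Im (seg_kernel rho x w).
Proof.
intros Hr Hd Hw Hx H.
destruct (seg_regular rho d x w Hr Hd Hw Hx H) as [R1 R2].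
pose proof (sqr_lt_1 rho Hr) as Hq.
pose proof (sep_const_pos rho d Hr Hd) as Hc.
assert (Hx0 : x <> 0) by (intros E; subst; rewrite Rabs_R0 in Hx; lra).
assert (H1r : 1 < / rho) by (rewrite <- Rinv_1; apply Rinv_lt_contravar; lra).
destruct Hw as [Hw Hi].
pose proof (Rinv_0_lt_compat _ (pow_lt _ 2 (Rlt_le_trans _ _ _ Hd H))) as Hp0.
assert (Av : rho <= Cmod (RtoC (/ x) * w) <= / rho).
{ rewrite Cmod_mult, Cmod_R, Rabs_inv.
  assert (1 <= / Rabs x <= / rho).
  { split; [rewrite <- Rinv_1|]; apply Rinv_le_contravar; lra. }
  nra. }
assert (Hwx : w <> RtoC x) by (apply (Cmod_sub_neq d); assumption).
pose proof (Im_Kv_div (rho ^ 2) x w Hx0 Hwx) as Ev.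
(* [u] is the argument whose tail is estimated, either x w or x w / q, and [X] is the weight of 2 x
   Im w in the singular part; the favourable sign amounts to [X] being at most 1 / |w - x|^2. *)
assert (Eu : exists u X, rho <= Cmod u <= / rho /\ X <= / Cmod (w - x) ^ 2 /\
   Im (Kv (rho ^ 2) (x * w)) = - (2 * x * Im w * X) + 2 * Im (ktail (rho ^ 2) u)).
{ destruct (Rle_dec rho (Cmod (x * w))) as [C|C].
  - exists (x * w)%C, (/ Cmod (x * w - 1) ^ 2); split; [|split].
    + split; [exact C|]. rewrite Cmod_mult, Cmod_R; nra.
    + apply Rinv_sqr_le; [lra|apply seg_dist_1; lra].
    + rewrite Im_Kv_split by (apply (regular_neq1 (rho ^ 2) (sep_const rho d)); assumption).
      rewrite im_scal_l; ring.
  - apply Rnot_le_lt in C.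
    set (u := (RtoC (/ rho ^ 2) * (x * w))%C).
    assert (Hu : (x * w = RtoC (rho ^ 2) * u)%C).
    { unfold u; rewrite Cmult_assoc, <- RtoC_mult, Rinv_r by lra; ring. }
    assert (Mu : Cmod u = / rho ^ 2 * Cmod (x * w)).
    { unfold u; rewrite (Cmod_mult _ (x * w)), Cmod_R, Rabs_pos_eq; [reflexivity|].
      left; apply Rinv_0_lt_compat; lra. }
    assert (Hxw : rho ^ 2 <= Cmod (x * w)) by (rewrite Cmod_mult, Cmod_R; simpl; nra).
    pose proof (Rinv_0_lt_compat (rho ^ 2) (proj1 Hq)) as Hqi.
    assert (Au : rho <= Cmod u <= / rho).
    { rewrite Mu; split.
      - apply Rle_trans with (/ rho ^ 2 * rho ^ 2); [rewrite Rinv_l; lra|].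
        apply Rmult_le_compat_l; lra.
      - apply Rle_trans with (/ rho ^ 2 * rho); [apply Rmult_le_compat_l; lra|].
        right; field; lra. }
    assert (Du : (u - 1 = RtoC (- / rho ^ 2) * (RtoC (rho ^ 2) - x * w))%C).
    { unfold u; rewrite RtoC_opp.
      transitivity (RtoC (/ rho ^ 2) * (x * w) - RtoC (/ rho ^ 2) * RtoC (rho ^ 2))%C.
      - rewrite <- (RtoC_mult (/ rho ^ 2)), Rinv_l by lra; reflexivity.
      - ring. }
    assert (Mu1 : Cmod (u - 1) = / rho ^ 2 * Cmod (RtoC (rho ^ 2) - x * w)).
    { rewrite Du, Cmod_mult, Cmod_R, Rabs_Ropp, Rabs_pos_eq by lra; reflexivity. }
    pose proof (seg_dist_q rho x w ltac:(lra) ltac:(lra) ltac:(lra)) as Dq.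
    assert (Hrd : 0 < rho * Cmod (w - x)) by (apply Rmult_lt_0_compat; lra).
    assert (Hu1 : 0 < Cmod (u - 1)) by (rewrite Mu1; apply Rmult_lt_0_compat; lra).
    exists u, (/ rho ^ 2 * / Cmod (u - 1) ^ 2); split; [exact Au|split].
    + rewrite Mu1, Rpow_mult_distr.
      destruct (Rinv_sqr_le _ _ Hrd Dq) as [_ I].
      rewrite Rpow_mult_distr in I.
      rewrite Rinv_mult in I |- *.
      replace (/ rho ^ 2 * (/ (/ rho ^ 2) ^ 2 * / Cmod (RtoC (rho ^ 2) - x * w) ^ 2))
        with (rho ^ 2 * / Cmod (RtoC (rho ^ 2) - x * w) ^ 2)
        by (field; split; [intros E; rewrite E in Dq|]; lra).
      apply (Rmult_le_compat_l (rho ^ 2)) in I; [|lra].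
      rewrite <- Rmult_assoc, Rinv_r, Rmult_1_l in I by lra; exact I.
    + set (du := Rmin (Cmod (u - 1)) (rho * (1 - rho))).
      assert (Ru : regular (rho ^ 2) du u).
      { split; [apply Rmin_l|]. apply (off_poles_le _ (rho * (1 - rho))); [apply Rmin_r|].
        apply off_poles_annulus; assumption. }
      assert (Hdu : 0 < du) by (apply Rmin_glb_lt; [exact Hu1|nra]).
      rewrite Hu, (Kv_shift _ du u Hq Hdu Ru), im_minus, Im_Kv_split
        by apply (regular_neq1 _ du u Hdu Ru).
      unfold u at 1; rewrite !im_scal_l; simpl Im; ring. }
destruct Eu as (u & X & Au & HX & Eu).
unfold seg_kernel; rewrite im_minus, Eu, Ev.
pose proof (ktail_annulus rho u Hr Au) as T1.
pose proof (ktail_annulus rho _ Hr Av) as T2.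
pose proof (im_le_Cmod (ktail (rho ^ 2) u)) as T3.
pose proof (im_le_Cmod (ktail (rho ^ 2) (RtoC (/ x) * w))) as T4.
apply Rle_trans with (1 := T3) in T1. apply Rle_trans with (1 := T4) in T2.
set (A := Im (ktail (rho ^ 2) u)) in *.
set (B := Im (ktail (rho ^ 2) (RtoC (/ x) * w))) in *.
set (Y := / Cmod (w - x) ^ 2) in *.
replace (sign x * (- (2 * x * Im w * X) + 2 * A - (- (2 * x * Im w * Y) + 2 * B)))
  with (2 * (sign x * x) * Im w * (Y - X) + sign x * (2 * A - 2 * B)) by ring.
rewrite sign_mult_abs.
assert (0 <= 2 * Rabs x * Im w * (Y - X)).
{ repeat apply Rmult_le_pos; try lra. }
assert (T5 : Rabs (2 * A - 2 * B) <= 4 * tail_const rho).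
{ apply Rabs_le_between; apply Rabs_le_between in T1; apply Rabs_le_between in T2; lra. }
pose proof (sign_bound _ _ T5 x); lra.
Qed.

(** * Decay of the kernels away from their poles *)

(** A Lipschitz constant for a difference of two terms K(c w), whence the outer 2, with |c| <= 1 /
    rho and |w - t| <= 2. The separation is d / 2 because the boundary point compared with w may be
    nearer to the pole by that much. *)
Definition far_const (rho d : R) : R :=
  let c := sep_const rho (d / 2) in
  2 * ((Kv_L (rho ^ 2) c + Kv_C (rho ^ 2) c * (2 / rho)) * / rho).

Lemma far_const_pos (rho d : R) : 0 < rho < 1 -> 0 < d -> 0 < far_const rho d.
Proof.
intros Hr Hd; unfold far_const.
pose proof (sep_const_pos rho (d / 2) Hr ltac:(lra)) as Hc.
pose proof (sqr_lt_1 rho Hr) as Hq.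
pose proof (Kv_L_pos _ _ Hq Hc). pose proof (Kv_C_pos _ _ Hq Hc).
pose proof (Rinv_0_lt_compat rho ltac:(lra)).
assert (0 < 2 / rho) by (unfold Rdiv; lra).
repeat apply Rmult_lt_0_compat; try lra.
apply Rplus_lt_0_compat; [lra|apply Rmult_lt_0_compat; lra].
Qed.

Lemma Kv_lipschitz_lin (rho d : R) (c w t : C) :
  0 < rho < 1 -> 0 < d -> Cmod c <= / rho -> Cmod w <= 1 -> Cmod t <= 1 ->
  regular (rho ^ 2) d (c * w) -> regular (rho ^ 2) d (c * t) ->
  Cmod (Kv (rho ^ 2) (c * w) - Kv (rho ^ 2) (c * t))
    <= (Kv_L (rho ^ 2) d + Kv_C (rho ^ 2) d * (2 / rho)) * / rho * Cmod (w - t).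
Proof.
intros Hr Hd Hc Hw Ht R1 R2.
pose proof (sqr_lt_1 rho Hr) as Hq.
pose proof (Kv_L_pos _ _ Hq Hd). pose proof (Kv_C_pos _ _ Hq Hd).
pose proof (Rinv_0_lt_compat rho ltac:(lra)).
assert (0 < 2 / rho) by (unfold Rdiv; lra).
assert (E : Cmod (c * w - c * t) <= / rho * Cmod (w - t)).
{ replace (c * w - c * t)%C with (c * (w - t))%C by ring.
  rewrite Cmod_mult; apply Rmult_le_compat_r; [apply Cmod_ge_0|exact Hc]. }
assert (E2 : Cmod (w - t) <= 2).
{ unfold Cminus; eapply Rle_trans; [apply Cmod_triangle|]; rewrite Cmod_opp; lra. }
assert (E3 : Cmod (c * w - c * t) <= 2 / rho).
{ eapply Rle_trans; [exact E|]. unfold Rdiv; rewrite (Rmult_comm 2).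
  apply Rmult_le_compat_l; lra. }
eapply Rle_trans; [apply (Kv_lipschitz _ d (2 / rho) _ _ Hq Hd R2 R1 E3)|].
rewrite Rmult_assoc; apply Rmult_le_compat_l; [|exact E].
apply Rplus_le_le_0_compat; [lra|apply Rmult_le_pos; lra].
Qed.

Lemma kernel_far_arith (a b a' b' : C) (L : R) :
  Cmod (a - a') <= L -> Cmod (b - b') <= L -> Cmod ((a - b) - (a' - b')) <= 2 * L.
Proof.
intros H1 H2.
replace ((a - b) - (a' - b'))%C with ((a - a') + - (b - b'))%C by ring.
eapply Rle_trans; [apply Cmod_triangle|]; rewrite Cmod_opp; lra.
Qed.

(** The kernel vanishes at the boundary point t, so a Lipschitz bound between w and t is already a
    decay bound. *)
Lemma arc_kernel_far (rho d sig a : R) (w t : C) :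
  0 < rho < 1 -> 0 < d -> half_ring rho w -> half_ring_bdry rho t ->
  sig = 1 \/ sig = / rho -> 0 <= sin a ->
  d <= Cmod (w - polar (/ sig) a) -> Cmod (w - t) <= d / 2 ->
  Rabs (Re (arc_kernel rho sig a w)) <= far_const rho d * Cmod (w - t).
Proof.
intros Hr Hd Hw Ht Hs Ha H Hwt.
assert (H' : d / 2 <= Cmod (t - polar (/ sig) a)).
{ pose proof (Cmod_sub_le (w - polar (/ sig) a) (w - t)) as E.
  replace (w - polar (/ sig) a - (w - t))%C with (t - polar (/ sig) a)%C in E by ring. lra. }
assert (Hd2 : 0 < d / 2) by lra.
destruct (arc_regular rho (d / 2) sig a w Hr Hd2 Hw Hs Ha ltac:(lra)) as [R1 R2].
destruct (arc_regular rho (d / 2) sig a t Hr Hd2 (proj1 Ht) Hs Ha H') as [R3 R4].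
pose proof (arc_kernel_bdry rho (d / 2) sig a t Hr Hd2 Ht Hs Ha H') as Z.
pose proof (sep_const_pos rho (d / 2) Hr Hd2) as Hc.
replace (Re (arc_kernel rho sig a w))
  with (Re (arc_kernel rho sig a w - arc_kernel rho sig a t)) by (rewrite re_minus; lra).
eapply Rle_trans; [apply re_le_Cmod|].
assert (H1r : 1 < / rho) by (rewrite <- Rinv_1; apply Rinv_lt_contravar; lra).
assert (Hm : forall b, Cmod (polar sig b) <= / rho)
  by (intros b; rewrite Cmod_polar; destruct Hs; lra).
unfold arc_kernel, far_const; rewrite Rmult_assoc.
apply kernel_far_arith; apply Kv_lipschitz_lin; try assumption; try apply Hm;
  try apply Hw; apply Ht.
Qed.

Lemma seg_kernel_far (rho d x : R) (w t : C) :
  0 < rho < 1 -> 0 < d -> half_ring rho w -> half_ring_bdry rho t ->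
  rho <= Rabs x <= 1 -> d <= Cmod (w - x) -> Cmod (w - t) <= d / 2 ->
  Rabs (Im (seg_kernel rho x w)) <= far_const rho d * Cmod (w - t).
Proof.
intros Hr Hd Hw Ht Hx H Hwt.
assert (H' : d / 2 <= Cmod (t - x)).
{ pose proof (Cmod_sub_le (w - x) (w - t)) as E.
  replace (w - x - (w - t))%C with (t - x)%C in E by ring. lra. }
assert (Hd2 : 0 < d / 2) by lra.
destruct (seg_regular rho (d / 2) x w Hr Hd2 Hw Hx ltac:(lra)) as [R1 R2].
destruct (seg_regular rho (d / 2) x t Hr Hd2 (proj1 Ht) Hx H') as [R3 R4].
pose proof (seg_kernel_bdry rho (d / 2) x t Hr Hd2 Ht Hx H') as Z.
pose proof (sep_const_pos rho (d / 2) Hr Hd2) as Hc.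
replace (Im (seg_kernel rho x w))
  with (Im (seg_kernel rho x w - seg_kernel rho x t)) by (rewrite im_minus; lra).
eapply Rle_trans; [apply im_le_Cmod|].
unfold seg_kernel, far_const; rewrite Rmult_assoc.
assert (1 < / rho) by (rewrite <- Rinv_1; apply Rinv_lt_contravar; lra).
assert (/ Rabs x <= / rho) by (apply Rinv_le_contravar; lra).
apply kernel_far_arith; apply Kv_lipschitz_lin; try assumption; try apply Hw; try apply Ht;
  rewrite Cmod_R, ?Rabs_inv; lra.
Qed.

(** * Wirtinger derivatives *)

Lemma locally_Cmod (z : C) (P : C -> Prop) :
  locally z P <-> exists d, 0 < d /\ forall y, Cmod (y - z) < d -> P y.
Proof.
split.
- intros [e He]; exists e; split; [apply e|].
  intros y Hy; apply He; split; unfold ball; simpl; unfold AbsRing_ball, abs, minus, plus, opp; simpl.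
  + apply Rle_lt_trans with (2 := Hy), (re_le_Cmod (y - z)).
  + apply Rle_lt_trans with (2 := Hy), (im_le_Cmod (y - z)).
- intros (d & Hd & H).
  assert (Hd2 : 0 < d / 2) by lra.
  exists (mkposreal _ Hd2); intros y [H1 H2]; apply H.
  unfold ball in H1, H2; simpl in H1, H2;
    unfold AbsRing_ball, abs, minus, plus, opp in H1, H2; simpl in H1, H2.
  eapply Rle_lt_trans; [apply Cmod_le_abs_Re_Im|].
  change (Re (y - z)) with (fst y + - fst z); change (Im (y - z)) with (snd y + - snd z).
  lra.
Qed.

Lemma norm_C_R (z : C) : norm (K := R_AbsRing) (V := C_R_NormedModule) z = Cmod z.
Proof.
unfold norm; simpl; unfold prod_norm, Cmod, norm, abs; simpl.
f_equal.
rewrite !Rmult_1_r, <- !Rabs_mult, !Rabs_pos_eq by apply Rle_0_sqr; reflexivity.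
Qed.

Lemma is_derive_small_o (f : R -> R) (x l : R) :
  (forall eps, 0 < eps -> exists d, 0 < d /\ forall t, Rabs t < d ->
     Rabs (f (x + t) - f x - l * t) <= eps * Rabs t) ->
  is_derive f x l.
Proof.
intros H; apply is_derive_Reals; intros eps Heps.
destruct (H (eps / 2) ltac:(lra)) as (d & Hd & Hf).
exists (mkposreal d Hd); intros t Ht0 Ht; simpl in Ht.
specialize (Hf t Ht).
assert (0 < Rabs t) by (apply Rabs_pos_lt, Ht0).
replace ((f (x + t) - f x) / t - l) with ((f (x + t) - f x - l * t) / t) by (field; exact Ht0).
rewrite Rabs_div by exact Ht0.
apply Rle_lt_trans with (eps / 2); [|lra].
apply (Rmult_le_reg_r (Rabs t)); [assumption|].
unfold Rdiv at 1; rewrite Rmult_assoc, Rinv_l, Rmult_1_r by lra; exact Hf.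
Qed.

(* [A] and [B] are the Wirtinger derivatives of [f] at [z]. *)
Definition rdiff (f : C -> C) (z A B : C) : Prop :=
  forall eps, 0 < eps -> exists d, 0 < d /\ forall h, Cmod h < d ->
    Cmod (f (z + h)%C - f z - (A * h + B * Cconj h)) <= eps * Cmod h.

Lemma rdiff_dbar (f : C -> C) (z A B : C) : rdiff f z A B -> dbar f z = B.
Proof.
intros H.
(* [g] stands for [Re] and [Im]. A real increment t contributes (A + B) t and an imaginary one i (A
   - B) t; half of the first coefficient plus i times the second is B. *)
assert (Hx : forall g : C -> R,
    (forall a b, g (a - b)%C = g a - g b) -> (forall (t : R) a, g (a * t)%C = g a * t) ->
    (forall a, Rabs (g a) <= Cmod a) ->
    Derive (fun x => g (f (x, Im z))) (Re z) = g (A + B)%C).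
{ intros g Gm Gs Gb; apply is_derive_unique, is_derive_small_o; intros eps Heps.
  destruct (H eps Heps) as (d & Hd & Hf); exists d; split; [exact Hd|].
  intros t Ht; specialize (Hf (RtoC t)); rewrite Cmod_R in Hf; specialize (Hf Ht).
  eapply Rle_trans; [|exact Hf].
  rewrite <- Gs, <- !Gm.
  eapply Rle_trans; [apply Gb|]; right; f_equal.
  replace (z + RtoC t)%C with ((Re z + t, Im z) : C)
    by (apply injective_projections; simpl; unfold Re, Im; ring).
  replace (Cconj (RtoC t)) with (RtoC t) by (rewrite Cconj_real; reflexivity).
  replace ((Re z, Im z) : C) with z by (destruct z; reflexivity). ring. }
assert (Hy : forall g : C -> R,
    (forall a b, g (a - b)%C = g a - g b) -> (forall (t : R) a, g (a * t)%C = g a * t) ->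
    (forall a, Rabs (g a) <= Cmod a) ->
    Derive (fun y => g (f (Re z, y))) (Im z) = g (Ci * (A - B))%C).
{ intros g Gm Gs Gb; apply is_derive_unique, is_derive_small_o; intros eps Heps.
  destruct (H eps Heps) as (d & Hd & Hf); exists d; split; [exact Hd|].
  intros t Ht; specialize (Hf (Ci * RtoC t)%C).
  rewrite Cmod_mult, Cmod_Ci, Rmult_1_l, Cmod_R in Hf; specialize (Hf Ht).
  eapply Rle_trans; [|exact Hf].
  rewrite <- Gs, <- !Gm.
  eapply Rle_trans; [apply Gb|]; right; f_equal.
  replace (z + Ci * RtoC t)%C with ((Re z, Im z + t) : C)
    by (apply injective_projections; simpl; unfold Re, Im; ring).
  replace (Cconj (Ci * RtoC t)) with (- Ci * RtoC t)%C
    by (apply injective_projections; simpl; ring).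
  replace ((Re z, Im z) : C) with z by (destruct z; reflexivity). ring. }
unfold dbar, partial_x, partial_y.
assert (Re_s : forall (t : R) a, Re (a * t) = Re a * t) by (intros; apply re_scal_r).
assert (Im_s : forall (t : R) a, Im (a * t) = Im a * t) by (intros; apply im_scal_r).
rewrite (Hx Re re_minus Re_s re_le_Cmod), (Hx Im im_minus Im_s im_le_Cmod).
rewrite (Hy Re re_minus Re_s re_le_Cmod), (Hy Im im_minus Im_s im_le_Cmod).
assert (E : forall w : C, (Re w, Im w) = w) by (intros []; reflexivity).
rewrite !E.
replace (A + B + Ci * (Ci * (A - B)))%C with (A + B + (Ci * Ci) * (A - B))%C by ring.
replace (Ci * Ci)%C with (- RtoC 1)%C by (apply injective_projections; simpl; ring).
field.
Qed.

Lemma rdiff_R_differentiable (f : C -> C) (z A B : C) :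
  rdiff f z A B -> R_differentiable f z.
Proof.
intros H; exists (fun h : C => (A * h + B * Cconj h)%C); split.
- split.
  + assert (E : forall x y : C, (A * (x + y) + B * Cconj (x + y)
        = (A * x + B * Cconj x) + (A * y + B * Cconj y))%C)
      by (intros x y; rewrite Cplus_conj; ring).
    exact E.
  + intros k x. 
    assert (E : forall y : C, @scal R_Ring C_R_NormedModule k y = (k * y)%C).
    { intros y; apply injective_projections; simpl; unfold scal; simpl; unfold mult; simpl; ring. }
    rewrite !E, Cmult_conj, (Cconj_real k) by reflexivity.
    assert (E2 : forall y z : C, (A * (k * y) + B * (k * z) = k * (A * y + B * z))%C)
      by (intros; ring).
    apply E2.
  + exists (Cmod A + Cmod B + 1); split.
    * pose proof (Cmod_ge_0 A); pose proof (Cmod_ge_0 B); lra.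
    * intros x; rewrite !norm_C_R.
      eapply Rle_trans; [apply Cmod_triangle|].
      rewrite !Cmod_mult, Cmod_conj. pose proof (Cmod_ge_0 x); nra.
- intros x Hx.
  apply (is_filter_lim_locally_unique (K := R_AbsRing) (V := C_R_NormedModule)) in Hx; subst x.
  intros eps.
  destruct (H eps (cond_pos eps)) as (d & Hd & Hf).
  apply locally_Cmod; exists d; split; [exact Hd|]; intros y Hy.
  rewrite !norm_C_R.
  specialize (Hf (y - z)%C Hy).
  replace (z + (y - z))%C with y in Hf by ring.
  exact Hf.
Qed.

Lemma rdiff_ext_loc (f g : C -> C) (z A B : C) :
  locally z (fun y => f y = g y) -> rdiff f z A B -> rdiff g z A B.
Proof.
intros Hl H eps Heps.
apply locally_Cmod in Hl; destruct Hl as (d0 & Hd0 & E).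
destruct (H eps Heps) as (d & Hd & Hf).
exists (Rmin d d0); split; [apply Rmin_glb_lt; assumption|].
intros h Hh.
rewrite <- !E.
- apply Hf; eapply Rlt_le_trans; [exact Hh|apply Rmin_l].
- replace (z - z)%C with (RtoC 0) by ring; rewrite Cmod_0; exact Hd0.
- replace (z + h - z)%C with h by ring.
  eapply Rlt_le_trans; [exact Hh|apply Rmin_r].
Qed.

Lemma rdiff_plus (f g : C -> C) (z A B A' B' : C) :
  rdiff f z A B -> rdiff g z A' B' -> rdiff (fun y => f y + g y)%C z (A + A') (B + B').
Proof.
intros Hf Hg eps Heps.
destruct (Hf (eps / 2) ltac:(lra)) as (d1 & Hd1 & H1).
destruct (Hg (eps / 2) ltac:(lra)) as (d2 & Hd2 & H2).
exists (Rmin d1 d2); split; [apply Rmin_glb_lt; assumption|].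
intros h Hh.
specialize (H1 h (Rlt_le_trans _ _ _ Hh (Rmin_l _ _))).
specialize (H2 h (Rlt_le_trans _ _ _ Hh (Rmin_r _ _))).
replace (f (z + h) + g (z + h) - (f z + g z) - ((A + A') * h + (B + B') * Cconj h))%C
  with ((f (z + h) - f z - (A * h + B * Cconj h)) + (g (z + h) - g z - (A' * h + B' * Cconj h)))%C
  by ring.
eapply Rle_trans; [apply Cmod_triangle|]; lra.
Qed.

Lemma rdiff_scal (c : C) (f : C -> C) (z A B : C) :
  rdiff f z A B -> rdiff (fun y => c * f y)%C z (c * A) (c * B).
Proof.
intros Hf eps Heps.
pose proof (Cmod_ge_0 c) as Hc.
destruct (Hf (eps / (Cmod c + 1)) ltac:(apply Rdiv_lt_0_compat; lra)) as (d & Hd & H).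
exists d; split; [exact Hd|]; intros h Hh; specialize (H h Hh).
replace (c * f (z + h) - c * f z - (c * A * h + c * B * Cconj h))%C
  with (c * (f (z + h) - f z - (A * h + B * Cconj h)))%C by ring.
rewrite Cmod_mult.
apply Rle_trans with (Cmod c * (eps / (Cmod c + 1) * Cmod h)); [apply Rmult_le_compat_l; assumption|].
replace (Cmod c * (eps / (Cmod c + 1) * Cmod h)) with (Cmod c / (Cmod c + 1) * (eps * Cmod h))
  by (field; lra).
rewrite <- (Rmult_1_l (eps * Cmod h)) at 2.
apply Rmult_le_compat_r; [apply Rmult_le_pos; [lra|apply Cmod_ge_0]|].
apply (Rmult_le_reg_r (Cmod c + 1)); [lra|].
unfold Rdiv; rewrite Rmult_assoc, Rinv_l; lra.
Qed.

Lemma rdiff_const (c z : C) : rdiff (fun _ => c) z 0 0.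
Proof.
intros eps Heps; exists 1; split; [lra|]; intros h _.
replace (c - c - (0 * h + 0 * Cconj h))%C with (RtoC 0) by ring.
rewrite Cmod_0; apply Rmult_le_pos; [lra|apply Cmod_ge_0].
Qed.

Lemma rdiff_lip (f : C -> C) (z A B : C) :
  rdiff f z A B -> exists d, 0 < d /\ forall h, Cmod h < d ->
    Cmod (f (z + h)%C - f z) <= (Cmod A + Cmod B + 1) * Cmod h.
Proof.
intros Hf; destruct (Hf 1 Rlt_0_1) as (d & Hd & H).
exists d; split; [exact Hd|]; intros h Hh; specialize (H h Hh).
replace (f (z + h) - f z)%C
  with ((f (z + h) - f z - (A * h + B * Cconj h)) + (A * h + B * Cconj h))%C by ring.
eapply Rle_trans; [apply Cmod_triangle|].
pose proof (Cmod_triangle (A * h) (B * Cconj h)) as E.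
rewrite !Cmod_mult, Cmod_conj in E; lra.
Qed.

(** Since 2 Re z = z + Cconj z, both Wirtinger derivatives of the factor are 1. The extra [f z] in
    the conjugate derivative is the source of all nonzero dbar derivatives of the moments. *)
Lemma rdiff_mult_2Re (f : C -> C) (z A B : C) :
  rdiff f z A B ->
  rdiff (fun y => RtoC (2 * Re y) * f y)%C z (RtoC (2 * Re z) * A + f z) (RtoC (2 * Re z) * B + f z).
Proof.
intros Hf eps Heps.
destruct (rdiff_lip _ _ _ _ Hf) as (d1 & Hd1 & H1).
destruct (rdiff_scal (RtoC (2 * Re z)) _ _ _ _ Hf (eps / 2) ltac:(lra)) as (d2 & Hd2 & H2).
set (L := Cmod A + Cmod B + 1) in *.
assert (HL : 0 < L) by (pose proof (Cmod_ge_0 A); pose proof (Cmod_ge_0 B); unfold L; lra).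
exists (Rmin (eps / (4 * L)) (Rmin d1 d2)); split.
{ repeat apply Rmin_glb_lt; try assumption. apply Rdiv_lt_0_compat; lra. }
intros h Hh.
pose proof (Rlt_le_trans _ _ _ Hh (Rmin_l _ _)) as Hh1.
pose proof (Rlt_le_trans _ _ _ Hh (Rmin_r _ _)) as Hh2.
specialize (H1 h (Rlt_le_trans _ _ _ Hh2 (Rmin_l _ _))).
specialize (H2 h (Rlt_le_trans _ _ _ Hh2 (Rmin_r _ _))).
assert (E : RtoC (2 * Re (z + h)) = (RtoC (2 * Re z) + RtoC (2 * Re h))%C)
  by (rewrite re_plus, <- RtoC_plus; f_equal; ring).
assert (E2 : (h + Cconj h)%C = RtoC (2 * Re h))
  by (apply injective_projections; simpl; unfold Re; ring).
replace (RtoC (2 * Re (z + h)) * f (z + h) - RtoC (2 * Re z) * f z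
   - ((RtoC (2 * Re z) * A + f z) * h + (RtoC (2 * Re z) * B + f z) * Cconj h))%C
  with ((RtoC (2 * Re z) * f (z + h) - RtoC (2 * Re z) * f z
         - (RtoC (2 * Re z) * A * h + RtoC (2 * Re z) * B * Cconj h))
        + RtoC (2 * Re h) * (f (z + h) - f z))%C by (rewrite E, <- E2; ring).
eapply Rle_trans; [apply Cmod_triangle|].
rewrite (Cmod_mult (RtoC (2 * Re h))), Cmod_R, Rabs_mult, (Rabs_pos_eq 2) by lra.
pose proof (re_le_Cmod h) as Hre. pose proof (Cmod_ge_0 h).
assert (T : 2 * Rabs (Re h) * Cmod (f (z + h)%C - f z) <= 2 * Cmod h * (L * Cmod h)).
{ apply Rmult_le_compat; try lra; try apply Cmod_ge_0.
  pose proof (Rabs_pos (Re h)); lra. }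
assert (T2 : L * Cmod h <= eps / 4).
{ replace (eps / 4) with (L * (eps / (4 * L))) by (field; lra).
  apply Rmult_le_compat_l; lra. }
nra.
Qed.

Lemma rdiff_comp (F g : C -> C) (z L A : C) :
  rdiff g z A 0 -> rdiff F (g z) L 0 -> rdiff (fun y => F (g y)) z (L * A) 0.
Proof.
intros Hg HF eps Heps.
destruct (rdiff_lip _ _ _ _ Hg) as (d1 & Hd1 & H1).
rewrite Cmod_0, Rplus_0_r in H1.
set (M := Cmod A + 1) in *.
assert (HM : 0 < M) by (pose proof (Cmod_ge_0 A); unfold M; lra).
destruct (HF (eps / (2 * M)) ltac:(apply Rdiv_lt_0_compat; lra)) as (d2 & Hd2 & H2).
destruct (rdiff_scal L _ _ _ _ Hg (eps / 2) ltac:(lra)) as (d3 & Hd3 & H3).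
exists (Rmin (d2 / M) (Rmin d1 d3)); split.
{ repeat apply Rmin_glb_lt; try assumption. apply Rdiv_lt_0_compat; lra. }
intros h Hh.
pose proof (Rlt_le_trans _ _ _ Hh (Rmin_l _ _)) as Hh1.
pose proof (Rlt_le_trans _ _ _ Hh (Rmin_r _ _)) as Hh2.
specialize (H1 h (Rlt_le_trans _ _ _ Hh2 (Rmin_l _ _))).
specialize (H3 h (Rlt_le_trans _ _ _ Hh2 (Rmin_r _ _))).
set (k := (g (z + h) - g z)%C) in *.
assert (Hk : Cmod k < d2).
{ eapply Rle_lt_trans; [exact H1|].
  replace d2 with (M * (d2 / M)) by (field; lra).
  apply Rmult_lt_compat_l; lra. }
specialize (H2 k Hk).
replace (g z + k)%C with (g (z + h)%C) in H2 by (unfold k; ring).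
replace (F (g (z + h)) - F (g z) - (L * A * h + 0 * Cconj h))%C
  with ((F (g (z + h)) - F (g z) - (L * k + 0 * Cconj k))
        + (L * g (z + h) - L * g z - (L * A * h + L * 0 * Cconj h)))%C by (unfold k; ring).
eapply Rle_trans; [apply Cmod_triangle|].
assert (eps / (2 * M) * Cmod k <= eps / 2 * Cmod h); [|lra].
replace (eps / 2 * Cmod h) with (eps / (2 * M) * (M * Cmod h)) by (field; lra).
apply Rmult_le_compat_l; [|exact H1].
left; apply Rdiv_lt_0_compat; lra.
Qed.

Lemma rdiff_quadratic (f : C -> C) (z A : C) (d M : R) :
  0 < d ->
  (forall h, Cmod h < d -> Cmod (f (z + h)%C - f z - A * h) <= M * Cmod h ^ 2) ->
  rdiff f z A 0.
Proof.
intros Hd H eps Heps.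
set (N := Rabs M + 1).
assert (HN : 0 < N) by (pose proof (Rabs_pos M); unfold N; lra).
exists (Rmin d (eps / N)); split.
{ apply Rmin_glb_lt; [exact Hd|apply Rdiv_lt_0_compat; lra]. }
intros h Hh.
specialize (H h (Rlt_le_trans _ _ _ Hh (Rmin_l _ _))).
pose proof (Rlt_le_trans _ _ _ Hh (Rmin_r _ _)) as Hh2.
replace (A * h + 0 * Cconj h)%C with (A * h)%C by ring.
eapply Rle_trans; [exact H|].
pose proof (Cmod_ge_0 h) as Hp. pose proof (Rle_abs M).
assert (N * Cmod h <= eps).
{ replace eps with (N * (eps / N)) by (field; lra). apply Rmult_le_compat_l; lra. }
unfold N in *; simpl; nra.
Qed.

(** * Complex-valued integrals of a real variable *)

Definition is_CRInt (f : R -> C) (a b : R) (l : C) : Prop :=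
  is_RInt (V := C_R_NormedModule) f a b l.

Definition ex_CRInt (f : R -> C) (a b : R) : Prop := exists l, is_CRInt f a b l.

Lemma is_CRInt_unique (f : R -> C) (a b : R) (l : C) :
  is_CRInt f a b l -> CRInt f a b = l.
Proof.
intros H; unfold CRInt; apply (is_RInt_unique (V := C_R_CompleteNormedModule)); exact H.
Qed.

Lemma CRInt_correct (f : R -> C) (a b : R) :
  ex_CRInt f a b -> is_CRInt f a b (CRInt f a b).
Proof.
intros [l H]; rewrite (is_CRInt_unique f a b l H); exact H.
Qed.

Lemma is_CRInt_parts (f : R -> C) (a b : R) (l : C) :
  is_CRInt f a b l <->
  is_RInt (fun s => Re (f s)) a b (Re l) /\ is_RInt (fun s => Im (f s)) a b (Im l).
Proof.
split.
- intros H; split.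
  + apply (is_RInt_fct_extend_fst (U := R_NormedModule) (V := R_NormedModule) f a b l H).
  + apply (is_RInt_fct_extend_snd (U := R_NormedModule) (V := R_NormedModule) f a b l H).
- intros [H1 H2]; destruct l as [l1 l2].
  apply (is_RInt_fct_extend_pair (U := R_NormedModule) (V := R_NormedModule) f a b l1 l2 H1 H2).
Qed.

Lemma Re_CRInt (f : R -> C) (a b : R) :
  ex_CRInt f a b -> is_RInt (fun s => Re (f s)) a b (Re (CRInt f a b)).
Proof. intros H; apply CRInt_correct, is_CRInt_parts in H; apply H. Qed.

Lemma Im_CRInt (f : R -> C) (a b : R) :
  ex_CRInt f a b -> is_RInt (fun s => Im (f s)) a b (Im (CRInt f a b)).
Proof. intros H; apply CRInt_correct, is_CRInt_parts in H; apply H. Qed.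

Lemma is_CRInt_plus (f g : R -> C) (a b : R) (l m : C) :
  is_CRInt f a b l -> is_CRInt g a b m -> is_CRInt (fun s => f s + g s)%C a b (l + m)%C.
Proof. apply (is_RInt_plus (V := C_R_NormedModule)). Qed.

Lemma is_CRInt_scal (c : C) (f : R -> C) (a b : R) (l : C) :
  is_CRInt f a b l -> is_CRInt (fun s => c * f s)%C a b (c * l)%C.
Proof.
intros H; apply is_CRInt_parts in H; destruct H as [H1 H2].
apply is_CRInt_parts; split.
- apply (is_RInt_minus (V := R_NormedModule)
    (fun s => Re c * Re (f s)) (fun s => Im c * Im (f s)) a b (Re c * Re l) (Im c * Im l));
    apply (is_RInt_scal (V := R_NormedModule)); assumption.
- apply (is_RInt_plus (V := R_NormedModule)
    (fun s => Re c * Im (f s)) (fun s => Im c * Re (f s)) a b (Re c * Im l) (Im c * Re l));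
    apply (is_RInt_scal (V := R_NormedModule)); assumption.
Qed.

Lemma is_CRInt_ext (f g : R -> C) (a b : R) (l : C) :
  a <= b -> (forall s, a <= s <= b -> f s = g s) -> is_CRInt f a b l -> is_CRInt g a b l.
Proof.
intros Hab E; apply (is_RInt_ext (V := C_R_NormedModule)).
intros s; rewrite Rmin_left, Rmax_right by exact Hab; intros Hs; apply E; lra.
Qed.

Lemma CRInt_ext (f g : R -> C) (a b : R) :
  a <= b -> (forall s, a <= s <= b -> f s = g s) -> CRInt f a b = CRInt g a b.
Proof.
intros Hab E; apply (RInt_ext (V := C_R_CompleteNormedModule)).
intros s; rewrite Rmin_left, Rmax_right by exact Hab; intros Hs; apply E; lra.
Qed.

Lemma ex_CRInt_ext (f g : R -> C) (a b : R) :
  a <= b -> (forall s, a <= s <= b -> f s = g s) -> ex_CRInt f a b -> ex_CRInt g a b.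
Proof. intros Hab E [l H]; exists l; apply (is_CRInt_ext f g); assumption. Qed.

Lemma CRInt_swap (f : R -> C) (a b : R) :
  ex_CRInt f a b -> CRInt f b a = (- CRInt f a b)%C.
Proof.
intros H; apply is_CRInt_unique.
apply (is_RInt_swap (V := C_R_NormedModule)), CRInt_correct, H.
Qed.

Lemma CRInt_plus (f g : R -> C) (a b : R) :
  ex_CRInt f a b -> ex_CRInt g a b ->
  CRInt (fun s => f s + g s)%C a b = (CRInt f a b + CRInt g a b)%C.
Proof.
intros Hf Hg; apply is_CRInt_unique, is_CRInt_plus; apply CRInt_correct; assumption.
Qed.

Lemma CRInt_scal (c : C) (f : R -> C) (a b : R) :
  ex_CRInt f a b -> CRInt (fun s => c * f s)%C a b = (c * CRInt f a b)%C.
Proof. intros Hf; apply is_CRInt_unique, is_CRInt_scal, CRInt_correct, Hf. Qed.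

Lemma ex_CRInt_scal (c : C) (f : R -> C) (a b : R) :
  ex_CRInt f a b -> ex_CRInt (fun s => c * f s)%C a b.
Proof. intros [l H]; exists (c * l)%C; apply is_CRInt_scal, H. Qed.

Lemma is_CRInt_bound (f : R -> C) (a b M : R) (l : C) :
  a <= b -> (forall s, a <= s <= b -> Cmod (f s) <= M) -> is_CRInt f a b l ->
  Cmod l <= M * (b - a).
Proof.
intros Hab Hf H; rewrite <- norm_C_R, Rmult_comm.
apply (norm_RInt_le (V := C_R_NormedModule) f (fun _ => M) a b l ((b - a) * M) Hab).
- intros s Hs; rewrite norm_C_R; apply Hf, Hs.
- exact H.
- apply (is_RInt_const (V := R_NormedModule)).
Qed.

Definition Ccontinuous_at (f : R -> C) (s : R) : Prop :=
  continuous (U := C_UniformSpace) f s.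

Lemma ex_CRInt_continuous (f : R -> C) (a b : R) :
  a <= b -> (forall s, a <= s <= b -> Ccontinuous_at f s) -> ex_CRInt f a b.
Proof.
intros Hab H.
apply (ex_RInt_continuous (V := C_R_CompleteNormedModule)).
intros s; rewrite Rmin_left, Rmax_right by exact Hab; apply H.
Qed.

Lemma Ccontinuous_mult (f g : R -> C) (s : R) :
  Ccontinuous_at f s -> Ccontinuous_at g s -> Ccontinuous_at (fun t => f t * g t)%C s.
Proof.
intros Hf Hg.
assert (P : forall k, Ccontinuous_at k s ->
   continuous (fun t => Re (k t)) s /\ continuous (fun t => Im (k t)) s).
{ intros k Hk; split.
  - apply (continuous_comp (V := C_UniformSpace) k fst); [exact Hk|apply continuous_fst].
  - apply (continuous_comp (V := C_UniformSpace) k snd); [exact Hk|apply continuous_snd]. }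
destruct (P f Hf) as [F1 F2], (P g Hg) as [G1 G2].
unfold Ccontinuous_at.
apply (continuous_comp_2 (U := R_UniformSpace) (V := R_UniformSpace) (W := R_UniformSpace) (X := C_UniformSpace)
  (fun t => Re (f t) * Re (g t) - Im (f t) * Im (g t))
  (fun t => Re (f t) * Im (g t) + Im (f t) * Re (g t)) (fun x y => (x, y) : C)).
- apply (continuous_minus (V := R_NormedModule));
    apply (continuous_mult (K := R_AbsRing)); assumption.
- apply (continuous_plus (V := R_NormedModule));
    apply (continuous_mult (K := R_AbsRing)); assumption.
- apply (continuous_ext (fun x => x)); [intros []; reflexivity|apply continuous_id].
Qed.

Lemma Ccontinuous_plus (f g : R -> C) (s : R) :
  Ccontinuous_at f s -> Ccontinuous_at g s -> Ccontinuous_at (fun t => f t + g t)%C s.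
Proof. apply (continuous_plus (V := C_R_NormedModule)). Qed.

Lemma Ccontinuous_minus (f g : R -> C) (s : R) :
  Ccontinuous_at f s -> Ccontinuous_at g s -> Ccontinuous_at (fun t => f t - g t)%C s.
Proof. apply (continuous_minus (V := C_R_NormedModule)). Qed.

Lemma Ccontinuous_pair (f g : R -> R) (s : R) :
  continuous f s -> continuous g s -> Ccontinuous_at (fun t => (f t, g t)) s.
Proof.
intros Hf Hg.
apply (continuous_comp_2 (U := R_UniformSpace) (V := R_UniformSpace) (W := R_UniformSpace) (X := C_UniformSpace)
  f g (fun x y => (x, y) : C) s Hf Hg).
apply (continuous_ext (fun x => x)); [intros []; reflexivity|apply continuous_id].
Qed.

Lemma Ccontinuous_RtoC (f : R -> R) (s : R) :
  continuous f s -> Ccontinuous_at (fun t => RtoC (f t)) s.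
Proof. intros Hf; apply Ccontinuous_pair; [exact Hf|apply continuous_const]. Qed.

Lemma Ccontinuous_const (c : C) (s : R) : Ccontinuous_at (fun _ => c) s.
Proof. apply continuous_const. Qed.

Lemma Ccontinuous_comp (f : R -> C) (g : C -> C) (s : R) (d L : R) :
  Ccontinuous_at f s -> 0 < d ->
  (forall v, Cmod (v - f s) <= d -> Cmod (g v - g (f s)) <= L * Cmod (v - f s)) ->
  Ccontinuous_at (fun t => g (f t)) s.
Proof.
intros Hf Hd H; unfold Ccontinuous_at.
apply (continuous_comp (V := C_UniformSpace) (W := C_UniformSpace) f g); [exact Hf|].
intros P HP; change (locally (f s) (fun v => P (g v))).
apply locally_Cmod in HP; destruct HP as (e & He & HP).
apply locally_Cmod.
assert (HL : 0 < Rabs L + 1) by (pose proof (Rabs_pos L); lra).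
exists (Rmin d (e / (Rabs L + 1))); split.
{ apply Rmin_glb_lt; [exact Hd|apply Rdiv_lt_0_compat; lra]. }
intros v Hv; apply HP.
pose proof (Rlt_le_trans _ _ _ Hv (Rmin_l _ _)) as H1.
pose proof (Rlt_le_trans _ _ _ Hv (Rmin_r _ _)) as H2.
eapply Rle_lt_trans; [apply H; lra|].
apply Rle_lt_trans with ((Rabs L + 1) * Cmod (v - f s)).
- apply Rmult_le_compat_r; [apply Cmod_ge_0|pose proof (Rle_abs L); lra].
- replace e with ((Rabs L + 1) * (e / (Rabs L + 1))) by (field; lra).
  apply Rmult_lt_compat_l; lra.
Qed.

Lemma regular_mono (q d d' : R) (u : C) : d' <= d -> regular q d u -> regular q d' u.
Proof.
intros H [H1 H2]; split; [lra|apply (off_poles_le q d); assumption].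
Qed.

Lemma Kv_continuous (q d : R) (f : R -> C) (s : R) :
  0 < q < 1 -> 0 < d -> Ccontinuous_at f s -> regular q d (f s) ->
  Ccontinuous_at (fun t => Kv q (f t)) s.
Proof.
intros Hq Hd Hf Hr.
apply (Ccontinuous_comp f _ s (d / 2) (Kv_L q (d / 2) + Kv_C q (d / 2) * (d / 2)) Hf); [lra|].
intros v Hv; apply Kv_lipschitz; try assumption; try lra.
- apply (regular_mono q d); [lra|exact Hr].
- apply (regular_perturb q d (f s)); assumption.
Qed.

Lemma Kv'_continuous (q d : R) (f : R -> C) (s : R) :
  0 < q < 1 -> 0 < d -> Ccontinuous_at f s -> regular q d (f s) ->
  Ccontinuous_at (fun t => Kv' q (f t)) s.
Proof.
intros Hq Hd Hf Hr.
apply (Ccontinuous_comp f _ s (d / 2) (2 * Kv_C q (d / 2)) Hf); [lra|].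
intros v Hv; apply Kv'_lipschitz; try assumption; try lra.
- apply (regular_mono q d); [lra|exact Hr].
- apply (regular_perturb q d (f s)); assumption.
Qed.

(* A function on [a, b] that is the restriction of a continuous one, so that
   no one-sided continuity is needed at the endpoints. *)
Definition cont_ext (a b : R) (g : R -> R) : Prop :=
  exists g', (forall s, continuous g' s) /\ forall s, a <= s <= b -> g s = g' s.

Lemma cont_ext_mult (a b : R) (g h : R -> R) :
  cont_ext a b g -> cont_ext a b h -> cont_ext a b (fun s => g s * h s).
Proof.
intros (g' & G1 & G2) (h' & H1 & H2); exists (fun s => g' s * h' s); split.
- intros s; apply (continuous_mult (K := R_AbsRing)); auto.
- intros s Hs; rewrite G2, H2; auto.
Qed.

Lemma cont_ext_continuous (a b : R) (g : R -> R) :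
  (forall s, continuous g s) -> cont_ext a b g.
Proof. intros H; exists g; split; auto. Qed.

Lemma cont_ext_bounded (a b : R) (g : R -> R) :
  a <= b -> cont_ext a b g -> exists M, 0 < M /\ forall s, a <= s <= b -> Rabs (g s) <= M.
Proof.
intros Hab (g' & G1 & G2).
destruct (continuity_ab_maj (fun s => Rabs (g' s)) a b Hab) as (m & Hm & _).
- intros s _; apply continuity_pt_filterlim, continuous_Rabs_comp, G1.
- exists (Rabs (g' m) + 1); split; [pose proof (Rabs_pos (g' m)); lra|].
  intros s Hs; rewrite (G2 s Hs); specialize (Hm s Hs); lra.
Qed.

Lemma ex_CRInt_weight (a b : R) (g : R -> R) (k : R -> C) :
  a <= b -> cont_ext a b g -> (forall s, a <= s <= b -> Ccontinuous_at k s) ->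
  ex_CRInt (fun s => RtoC (g s) * k s)%C a b.
Proof.
intros Hab (g' & G1 & G2) Hk.
apply (ex_CRInt_ext (fun s => RtoC (g' s) * k s)%C); [exact Hab| |].
- intros s Hs; rewrite G2 by exact Hs; reflexivity.
- apply ex_CRInt_continuous; [exact Hab|]; intros s Hs.
  apply Ccontinuous_mult; [|apply Hk, Hs].
  apply Ccontinuous_RtoC, G1.
Qed.

(** Integrating a quadratic remainder that is uniform in s gives a quadratic remainder again, so no
    convergence theorem for integrals enters. *)
Lemma CRInt_rdiff (k : C -> R -> C) (dk : R -> C) (a b d M : R) (w : C) :
  a <= b -> 0 < d ->
  (forall h, Cmod h < d -> ex_CRInt (k (w + h)%C) a b) -> ex_CRInt dk a b ->
  (forall h s, Cmod h < d -> a <= s <= b ->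
     Cmod (k (w + h)%C s - k w s - dk s * h) <= M * Cmod h ^ 2) ->
  rdiff (fun y => CRInt (k y) a b) w (CRInt dk a b) 0.
Proof.
intros Hab Hd Hk Hdk H.
apply (rdiff_quadratic _ _ _ d (M * (b - a)) Hd).
intros h Hh.
replace (M * (b - a) * Cmod h ^ 2) with (M * Cmod h ^ 2 * (b - a)) by ring.
assert (Hk0 : ex_CRInt (k w) a b).
{ replace w with (w + 0)%C by ring; apply Hk; rewrite Cmod_0; exact Hd. }
apply (is_CRInt_bound (fun s => k (w + h)%C s + (-1) * k w s + (- h) * dk s)%C a b _ _ Hab).
- intros s Hs. replace (k (w + h) s + (-1) * k w s + - h * dk s)%C
    with (k (w + h) s - k w s - dk s * h)%C by ring.
  apply H; assumption.
- replace (CRInt (k (w + h)%C) a b - CRInt (k w) a b - CRInt dk a b * h)%C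
    with (CRInt (k (w + h)%C) a b + (-1) * CRInt (k w) a b + (- h) * CRInt dk a b)%C by ring.
  apply is_CRInt_plus; [apply is_CRInt_plus; [|apply is_CRInt_scal]|apply is_CRInt_scal];
    apply CRInt_correct; auto.
Qed.

Definition curve_derive (f : R -> C) (s : R) (v : C) : Prop :=
  is_derive (K := R_AbsRing) (V := C_R_NormedModule) f s v.

Lemma curve_derive_parts (f : R -> C) (s : R) (v : C) :
  is_derive (fun t => Re (f t)) s (Re v) -> is_derive (fun t => Im (f t)) s (Im v) ->
  curve_derive f s v.
Proof.
intros H1 H2; split.
- apply (is_linear_scal_l (K := R_AbsRing) (V := C_R_NormedModule)).
- intros x Hx eps.
  destruct H1 as [_ H1], H2 as [_ H2].
  assert (Heps : 0 < eps / 2) by (pose proof (cond_pos eps); lra).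
  specialize (H1 x Hx (mkposreal _ Heps)); specialize (H2 x Hx (mkposreal _ Heps)).
  generalize (filter_and _ _ H1 H2); apply filter_imp; intros y [E1 E2].
  simpl in E1, E2.
  rewrite norm_C_R.
  eapply Rle_trans; [apply Cmod_le_abs_Re_Im|].
  eapply Rle_trans; [exact (Rplus_le_compat _ _ _ _ E1 E2)|right; field].
Qed.

Lemma is_derive_lin_approx (f : R -> R) (x l : R) :
  is_derive f x l -> forall eps, 0 < eps -> exists d, 0 < d /\ forall t, Rabs t < d ->
     Rabs (f (x + t) - f x - l * t) <= eps * Rabs t.
Proof.
intros H eps Heps; apply is_derive_Reals in H; destruct (H eps Heps) as [d Hd].
exists d; split; [apply d|]; intros t Ht.
destruct (Req_dec t 0) as [->|Ht0].
- rewrite Rplus_0_r, Rabs_R0; replace (f x - f x - l * 0) with 0 by ring; rewrite Rabs_R0; lra.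
- specialize (Hd t Ht0 Ht).
  replace (f (x + t) - f x - l * t) with (((f (x + t) - f x) / t - l) * t) by (field; exact Ht0).
  rewrite Rabs_mult; apply Rmult_le_compat_r; [apply Rabs_pos|lra].
Qed.

Lemma curve_derive_comp (f : C -> C) (c1 c2 : R -> R) (s v1 v2 : R) (A : C) :
  is_derive c1 s v1 -> is_derive c2 s v2 -> rdiff f (c1 s, c2 s) A 0 ->
  curve_derive (fun t => f (c1 t, c2 t)) s (A * (v1, v2)).
Proof.
intros H1 H2 Hf.
set (V := ((v1, v2) : C)).
assert (K : forall eps, 0 < eps -> exists d, 0 < d /\ forall t, Rabs t < d ->
   Cmod (f (c1 (s + t)%R, c2 (s + t)%R) - f (c1 s, c2 s) - A * V * RtoC t) <= eps * Rabs t).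
{ intros eps Heps.
  set (M := Cmod V + 1).
  assert (HM : 0 < M) by (pose proof (Cmod_ge_0 V); unfold M; lra).
  set (N := Cmod A + 1).
  assert (HN : 0 < N) by (pose proof (Cmod_ge_0 A); unfold N; lra).
  destruct (Hf (eps / (2 * M)) ltac:(apply Rdiv_lt_0_compat; lra)) as (d1 & Hd1 & F).
  (* The two components contribute errors e |t| each: the bound 1/2 gives |h| <= (|V| + 1) |t|, and
     eps / (4 N) keeps A times the total error below eps / 2 |t|. *)
  set (e := Rmin (1 / 2) (eps / (4 * N))).
  assert (He : 0 < e) by (apply Rmin_glb_lt; [lra|apply Rdiv_lt_0_compat; lra]).
  destruct (is_derive_lin_approx _ _ _ H1 e He) as (d2 & Hd2 & F1).
  destruct (is_derive_lin_approx _ _ _ H2 e He) as (d3 & Hd3 & F2).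
  exists (Rmin (d1 / M) (Rmin d2 d3)); split.
  { repeat apply Rmin_glb_lt; try assumption; apply Rdiv_lt_0_compat; lra. }
  intros t Ht.
  pose proof (Rlt_le_trans _ _ _ Ht (Rmin_l _ _)) as Ht1.
  pose proof (Rlt_le_trans _ _ _ Ht (Rmin_r _ _)) as Ht2.
  specialize (F1 t (Rlt_le_trans _ _ _ Ht2 (Rmin_l _ _))).
  specialize (F2 t (Rlt_le_trans _ _ _ Ht2 (Rmin_r _ _))).
  set (h := ((c1 (s + t) - c1 s, c2 (s + t) - c2 s) : C)).
  assert (Eh : Cmod (h - V * RtoC t) <= 2 * e * Rabs t).
  { eapply Rle_trans; [apply Cmod_le_abs_Re_Im|].
    replace (Re (h - V * RtoC t)) with (c1 (s + t) - c1 s - v1 * t) by (simpl; ring).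
    replace (Im (h - V * RtoC t)) with (c2 (s + t) - c2 s - v2 * t) by (simpl; ring).
    lra. }
  pose proof (Rmin_l (1 / 2) (eps / (4 * N))) as e1.
  pose proof (Rmin_r (1 / 2) (eps / (4 * N))) as e2.
  pose proof (Rabs_pos t) as Hpt.
  assert (Mh : Cmod h <= M * Rabs t).
  { replace h with (V * RtoC t + (h - V * RtoC t))%C by ring.
    eapply Rle_trans; [apply Cmod_triangle|]; rewrite Cmod_mult, Cmod_R.
    unfold M, e in *; nra. }
  assert (Hh : Cmod h < d1).
  { eapply Rle_lt_trans; [exact Mh|].
    replace d1 with (M * (d1 / M)) by (field; lra).
    apply Rmult_lt_compat_l; lra. }
  specialize (F h Hh).
  replace (((c1 s, c2 s) : C) + h)%C with ((c1 (s + t), c2 (s + t)) : C) in F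
    by (apply injective_projections; simpl; ring).
  match goal with |- Cmod ?X <= _ => replace X with
    ((f (c1 (s + t)%R, c2 (s + t)%R) - f (c1 s, c2 s) - (A * h + 0 * Cconj h))
     + A * (h - V * RtoC t))%C by ring end.
  eapply Rle_trans; [apply Cmod_triangle|]; rewrite (Cmod_mult A).
  assert (T1 : eps / (2 * M) * Cmod h <= eps / 2 * Rabs t).
  { replace (eps / 2 * Rabs t) with (eps / (2 * M) * (M * Rabs t)) by (field; lra).
    apply Rmult_le_compat_l; [left; apply Rdiv_lt_0_compat; lra|exact Mh]. }
  assert (T2 : Cmod A * Cmod (h - V * RtoC t) <= N * (2 * (eps / (4 * N)) * Rabs t)).
  { apply Rmult_le_compat; try apply Cmod_ge_0; [unfold N; lra|].
    eapply Rle_trans; [exact Eh|]. apply Rmult_le_compat_r; [exact Hpt|unfold e; lra]. }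
  replace (N * (2 * (eps / (4 * N)) * Rabs t)) with (eps / 2 * Rabs t) in T2 by (field; lra).
  lra. }
apply curve_derive_parts; apply is_derive_small_o; intros eps Heps;
  destruct (K eps Heps) as (d & Hd & F); exists d; (split; [exact Hd|]);
  intros t Ht; eapply Rle_trans; [|exact (F t Ht)| |exact (F t Ht)].
- rewrite <- re_scal_r, <- !re_minus; apply re_le_Cmod.
- rewrite <- im_scal_r, <- !im_minus; apply im_le_Cmod.
Qed.

Lemma CRInt_FTC (f df : R -> C) (a b : R) :
  a <= b -> (forall s, a <= s <= b -> curve_derive f s (df s)) ->
  (forall s, a <= s <= b -> Ccontinuous_at df s) ->
  is_CRInt df a b (f b - f a)%C.
Proof.
intros Hab H1 H2.
apply (is_RInt_derive (V := C_R_CompleteNormedModule) f df a b);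
  intros s; rewrite Rmin_left, Rmax_right by exact Hab; intros Hs;
  [exact (H1 s Hs)|exact (H2 s Hs)].
Qed.

(** * The Schwarz integral in the half ring *)

(** Common form of the two kernels, so that their integrals are differentiated once. On the arcs the
    coefficients are conjugate and e = 0; on the segments they are x and 1 / x and e = 2. *)
Definition pair_kernel (q : R) (c1 c2 e w : C) : C :=
  (Kv q (c1 * w) - Kv q (c2 * w) + e)%C.

Definition pair_kernel' (q : R) (c1 c2 w : C) : C :=
  (c1 * Kv' q (c1 * w) - c2 * Kv' q (c2 * w))%C.

Lemma pair_kernel_continuous (q d : R) (c1 c2 : R -> C) (e w : C) (s : R) :
  0 < q < 1 -> 0 < d -> Ccontinuous_at c1 s -> Ccontinuous_at c2 s ->
  regular q d (c1 s * w) -> regular q d (c2 s * w) ->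
  Ccontinuous_at (fun t => pair_kernel q (c1 t) (c2 t) e w) s.
Proof.
intros Hq Hd H1 H2 R1 R2.
apply Ccontinuous_plus; [apply Ccontinuous_minus|apply Ccontinuous_const].
- apply (Kv_continuous q d (fun t => c1 t * w)%C); try assumption.
  apply Ccontinuous_mult; [exact H1|apply Ccontinuous_const].
- apply (Kv_continuous q d (fun t => c2 t * w)%C); try assumption.
  apply Ccontinuous_mult; [exact H2|apply Ccontinuous_const].
Qed.

Lemma pair_kernel'_continuous (q d : R) (c1 c2 : R -> C) (w : C) (s : R) :
  0 < q < 1 -> 0 < d -> Ccontinuous_at c1 s -> Ccontinuous_at c2 s ->
  regular q d (c1 s * w) -> regular q d (c2 s * w) ->
  Ccontinuous_at (fun t => pair_kernel' q (c1 t) (c2 t) w) s.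
Proof.
intros Hq Hd H1 H2 R1 R2.
apply Ccontinuous_minus; apply Ccontinuous_mult; try assumption.
- apply (Kv'_continuous q d (fun t => c1 t * w)%C); try assumption.
  apply Ccontinuous_mult; [exact H1|apply Ccontinuous_const].
- apply (Kv'_continuous q d (fun t => c2 t * w)%C); try assumption.
  apply Ccontinuous_mult; [exact H2|apply Ccontinuous_const].
Qed.

Lemma pair_integral_rdiff (q d d0 L a b : R) (g : R -> R) (c1 c2 : R -> C) (e w : C) :
  0 < q < 1 -> 0 < d -> 0 < d0 -> a <= b -> cont_ext a b g ->
  (forall s, a <= s <= b -> Ccontinuous_at c1 s /\ Ccontinuous_at c2 s) ->
  (forall s, a <= s <= b -> Cmod (c1 s) <= L /\ Cmod (c2 s) <= L) ->
  (forall h s, Cmod h < d0 -> a <= s <= b ->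
     regular q d (c1 s * (w + h)) /\ regular q d (c2 s * (w + h))) ->
  rdiff (fun y => CRInt (fun s => RtoC (g s) * pair_kernel q (c1 s) (c2 s) e y) a b)%C w
    (CRInt (fun s => RtoC (g s) * pair_kernel' q (c1 s) (c2 s) w)%C a b) 0.
Proof.
intros Hq Hd Hd0 Hab Hg Hc HL Hr.
destruct (cont_ext_bounded a b g Hab Hg) as (M & HM & Hg1).
assert (Hr0 : forall s, a <= s <= b -> regular q d (c1 s * w) /\ regular q d (c2 s * w)).
{ intros s Hs; replace w with (w + 0)%C by ring; apply Hr; [rewrite Cmod_0|]; assumption. }
pose proof (Kv_C_pos q d Hq Hd) as HC.
apply (CRInt_rdiff (fun y s => RtoC (g s) * pair_kernel q (c1 s) (c2 s) e y)%C
   (fun s => RtoC (g s) * pair_kernel' q (c1 s) (c2 s) w)%C a b d0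
   (M * (2 * (Kv_C q d * L ^ 2))) w Hab Hd0).
- intros h Hh; apply ex_CRInt_weight; try assumption; intros s Hs.
  destruct (Hc s Hs), (Hr h s Hh Hs).
  apply (pair_kernel_continuous q d); assumption.
- apply ex_CRInt_weight; try assumption; intros s Hs.
  destruct (Hc s Hs), (Hr0 s Hs).
  apply (pair_kernel'_continuous q d); assumption.
- intros h s Hh Hs.
  destruct (Hr h s Hh Hs) as [A1 A2], (Hr0 s Hs) as [B1 B2], (HL s Hs) as [L1 L2].
  assert (T : forall c : C, Cmod c <= L -> regular q d (c * (w + h)) -> regular q d (c * w) ->
     Cmod (Kv q (c * (w + h)) - Kv q (c * w) - c * Kv' q (c * w) * h) <= Kv_C q d * L ^ 2 * Cmod h ^ 2).
  { intros c Hcl R1 R2.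
    pose proof (Kv_taylor2 q d _ _ Hq Hd R2 R1) as E.
    replace (c * (w + h) - c * w)%C with (c * h)%C in E by ring.
    replace (c * Kv' q (c * w) * h)%C with (Kv' q (c * w) * (c * h))%C by ring.
    eapply Rle_trans; [exact E|].
    rewrite Rmult_assoc; apply Rmult_le_compat_l; [lra|].
    rewrite Cmod_mult, Rpow_mult_distr.
    apply Rmult_le_compat_r; [apply pow2_ge_0|].
    apply pow_incr; split; [apply Cmod_ge_0|exact Hcl]. }
  replace (RtoC (g s) * pair_kernel q (c1 s) (c2 s) e (w + h)
           - RtoC (g s) * pair_kernel q (c1 s) (c2 s) e w
           - RtoC (g s) * pair_kernel' q (c1 s) (c2 s) w * h)%C
   with (RtoC (g s) * ((Kv q (c1 s * (w + h)) - Kv q (c1 s * w) - c1 s * Kv' q (c1 s * w) * h)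
      + - (Kv q (c2 s * (w + h)) - Kv q (c2 s * w) - c2 s * Kv' q (c2 s * w) * h)))%C
    by (unfold pair_kernel, pair_kernel'; ring).
  rewrite Cmod_mult, Cmod_R, Rmult_assoc.
  apply Rmult_le_compat; [apply Rabs_pos|apply Cmod_ge_0|apply Hg1, Hs|].
  eapply Rle_trans; [apply Cmod_triangle|]; rewrite Cmod_opp.
  pose proof (T (c1 s) L1 A1 B1); pose proof (T (c2 s) L2 A2 B2); lra.
Qed.

Definition open_half_ring (rho : R) (w : C) : Prop :=
  rho < Cmod w < 1 /\ 0 < Im w.

(** A lower bound for the distance from w to all four sides, which yields one separation constant
    for the poles of all kernels at once. *)
Definition gap (rho : R) (w : C) : R :=
  Rmin (Im w) (Rmin (1 - Cmod w) (Cmod w - rho)).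

Lemma gap_pos (rho : R) (w : C) : open_half_ring rho w -> 0 < gap rho w.
Proof. intros [H1 H2]; repeat apply Rmin_glb_lt; lra. Qed.

Lemma gap_le (rho : R) (w : C) :
  gap rho w <= Im w /\ gap rho w <= 1 - Cmod w /\ gap rho w <= Cmod w - rho.
Proof.
unfold gap.
pose proof (Rmin_l (Im w) (Rmin (1 - Cmod w) (Cmod w - rho))).
pose proof (Rmin_r (Im w) (Rmin (1 - Cmod w) (Cmod w - rho))).
pose proof (Rmin_l (1 - Cmod w) (Cmod w - rho)).
pose proof (Rmin_r (1 - Cmod w) (Cmod w - rho)).
lra.
Qed.

Lemma half_ring_open (rho : R) (w : C) : open_half_ring rho w -> half_ring rho w.
Proof. intros [H1 H2]; split; lra. Qed.

Lemma open_half_ring_perturb (rho : R) (w h : C) :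
  open_half_ring rho w -> Cmod h < gap rho w -> open_half_ring rho (w + h).
Proof.
intros Hw Hh; destruct (gap_le rho w) as (G1 & G2 & G3).
pose proof (Cmod_triangle w h) as E1.
pose proof (Cmod_sub_le w (- h)) as E2; rewrite Cmod_opp in E2.
replace (w - - h)%C with (w + h)%C in E2 by ring.
pose proof (im_le_Cmod h) as E3; apply Rabs_le_between in E3.
split; [lra|rewrite im_plus; lra].
Qed.

Lemma gap_arc (rho sig a : R) (w : C) :
  0 < rho < 1 -> open_half_ring rho w -> sig = 1 \/ sig = / rho ->
  gap rho w <= Cmod (w - polar (/ sig) a).
Proof.
intros Hr Hw Hs; destruct (gap_le rho w) as (G1 & G2 & G3).
pose proof (Cmod_sub_le w (polar (/ sig) a)) as E1.
pose proof (Cmod_sub_le (polar (/ sig) a) w) as E2.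
rewrite (Cmod_sub_sym _ w) in E2.
destruct Hs; subst sig; rewrite ?Rinv_1, ?Rinv_inv in *; rewrite Cmod_polar in * by lra; lra.
Qed.

Lemma gap_seg (rho x : R) (w : C) : gap rho w <= Cmod (w - x).
Proof.
destruct (gap_le rho w) as (G1 & _).
pose proof (im_le_Cmod (w - x)) as E; rewrite im_minus, im_RtoC, Rminus_0_r in E.
pose proof (Rle_abs (Im w)); lra.
Qed.

Lemma arc_regular_near (rho sig a : R) (w h : C) :
  0 < rho < 1 -> open_half_ring rho w -> sig = 1 \/ sig = / rho -> 0 <= sin a ->
  Cmod h < gap rho w / 2 ->
  regular (rho ^ 2) (sep_const rho (gap rho w / 2)) (polar sig a * (w + h)) /\
  regular (rho ^ 2) (sep_const rho (gap rho w / 2)) (polar sig (- a) * (w + h)).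
Proof.
intros Hr Hw Hs Ha Hh.
pose proof (gap_pos rho w Hw) as Hg.
apply arc_regular; try assumption; [lra| |].
- apply half_ring_open, open_half_ring_perturb; [exact Hw|lra].
- pose proof (gap_arc rho sig a w Hr Hw Hs) as G.
  pose proof (Cmod_sub_le (w - polar (/ sig) a) (- h)) as E; rewrite Cmod_opp in E.
  replace (w - polar (/ sig) a - - h)%C with (w + h - polar (/ sig) a)%C in E by ring.
  lra.
Qed.

Lemma seg_regular_near (rho x : R) (w h : C) :
  0 < rho < 1 -> open_half_ring rho w -> rho <= Rabs x <= 1 ->
  Cmod h < gap rho w / 2 ->
  regular (rho ^ 2) (sep_const rho (gap rho w / 2)) (x * (w + h)) /\
  regular (rho ^ 2) (sep_const rho (gap rho w / 2)) (RtoC (/ x) * (w + h)).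
Proof.
intros Hr Hw Hx Hh.
pose proof (gap_pos rho w Hw) as Hg.
apply seg_regular; try assumption; [lra| |].
- apply half_ring_open, open_half_ring_perturb; [exact Hw|lra].
- pose proof (gap_seg rho x w) as G.
  pose proof (Cmod_sub_le (w - x) (- h)) as E; rewrite Cmod_opp in E.
  replace (w - x - - h)%C with (w + h - x)%C in E by ring.
  lra.
Qed.

Lemma arc_regular_at (rho sig a : R) (w : C) :
  0 < rho < 1 -> open_half_ring rho w -> sig = 1 \/ sig = / rho -> 0 <= sin a ->
  regular (rho ^ 2) (sep_const rho (gap rho w / 2)) (polar sig a * w) /\
  regular (rho ^ 2) (sep_const rho (gap rho w / 2)) (polar sig (- a) * w).
Proof.
intros Hr Hw Hs Ha; replace w with (w + 0)%C at 2 4 by ring.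
apply arc_regular_near; try assumption; rewrite Cmod_0.
pose proof (gap_pos rho w Hw); lra.
Qed.

Lemma seg_regular_at (rho x : R) (w : C) :
  0 < rho < 1 -> open_half_ring rho w -> rho <= Rabs x <= 1 ->
  regular (rho ^ 2) (sep_const rho (gap rho w / 2)) (x * w) /\
  regular (rho ^ 2) (sep_const rho (gap rho w / 2)) (RtoC (/ x) * w).
Proof.
intros Hr Hw Hx; replace w with (w + 0)%C at 2 4 by ring.
apply seg_regular_near; try assumption; rewrite Cmod_0.
pose proof (gap_pos rho w Hw); lra.
Qed.

Lemma Rpower_1_base (b : R) : Rpower 1 b = 1.
Proof. unfold Rpower; rewrite ln_1, Rmult_0_r; apply exp_0. Qed.

Lemma Rpower_bounds (r alpha s : R) :
  0 < r < 1 -> 0 < alpha -> r <= s <= 1 -> Rpower r alpha <= Rpower s alpha <= 1.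
Proof.
intros Hr Ha Hs; split.
- apply Rle_Rpower_l; lra.
- rewrite <- (Rpower_1_base alpha); apply Rle_Rpower_l; lra.
Qed.

Lemma Rpower_in_01 (r alpha : R) : 0 < r < 1 -> 0 < alpha -> 0 < Rpower r alpha < 1.
Proof.
intros Hr Ha; split; [apply exp_pos|].
rewrite <- (Rpower_1_base alpha); apply Rlt_Rpower_l; lra.
Qed.

Definition arc_int (r alpha sig : R) (g : R -> R) (w : C) : C :=
  CRInt (fun tau => RtoC (g tau) * pair_kernel (Rpower r alpha ^ 2)
    (polar sig (alpha * tau)) (polar sig (- (alpha * tau))) 0 w)%C 0 (PI / alpha).

(** The sign [eps] is -1 on the side of argument PI / alpha, which the power map sends to the
    negative real axis. The weight [/ s] is what remains of zeta^(alpha - 1) dzeta once zeta^alpha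
    has been absorbed into the kernel. *)
Definition seg_int (r alpha eps : R) (g : R -> R) (w : C) : C :=
  CRInt (fun s => RtoC (g s * / s) * pair_kernel (Rpower r alpha ^ 2)
    (RtoC (eps * Rpower s alpha)) (RtoC (/ (eps * Rpower s alpha))) 2 w)%C r 1.

(* The Schwarz integral of the data [g] (indexed by modulus and argument in
   the sector ring) as a function of [w = z ^ alpha] in the half ring. *)
Definition Schwarz_w (r alpha : R) (g : R -> R -> R) (w : C) : C :=
  (RtoC (alpha / (2 * PI)) *
    (arc_int r alpha 1 (g 1%R) w - arc_int r alpha (/ Rpower r alpha) (g r) w
     + Ci * (seg_int r alpha (-1) (fun s => g s (PI / alpha)%R) w
             - seg_int r alpha 1 (fun s => g s 0%R) w)))%C.

(** Continuity on each side as a function of its parameter; how the sides fit together at the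
    corners enters through [data_close]. *)
Definition data_ok (r alpha : R) (g : R -> R -> R) : Prop :=
  cont_ext 0 (PI / alpha) (g 1) /\ cont_ext 0 (PI / alpha) (g r) /\
  cont_ext r 1 (fun s => g s (PI / alpha)) /\ cont_ext r 1 (fun s => g s 0).

Definition arc_int' (r alpha sig : R) (g : R -> R) (w : C) : C :=
  CRInt (fun tau => RtoC (g tau) * pair_kernel' (Rpower r alpha ^ 2)
    (polar sig (alpha * tau)) (polar sig (- (alpha * tau))) w)%C 0 (PI / alpha).

Definition seg_int' (r alpha eps : R) (g : R -> R) (w : C) : C :=
  CRInt (fun s => RtoC (g s * / s) * pair_kernel' (Rpower r alpha ^ 2)
    (RtoC (eps * Rpower s alpha)) (RtoC (/ (eps * Rpower s alpha))) w)%C r 1.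

Definition Schwarz_w' (r alpha : R) (g : R -> R -> R) (w : C) : C :=
  (RtoC (alpha / (2 * PI)) *
    (arc_int' r alpha 1 (g 1%R) w - arc_int' r alpha (/ Rpower r alpha) (g r) w
     + Ci * (seg_int' r alpha (-1) (fun s => g s (PI / alpha)%R) w
             - seg_int' r alpha 1 (fun s => g s 0%R) w)))%C.

Lemma arc_angle (alpha tau : R) :
  0 < alpha -> 0 <= tau <= PI / alpha -> 0 <= alpha * tau <= PI.
Proof.
intros Ha Ht; split; [apply Rmult_le_pos; lra|].
replace PI with (alpha * (PI / alpha)) at 1 by (field; lra).
apply Rmult_le_compat_l; lra.
Qed.

Lemma arc_sin (alpha tau : R) :
  0 < alpha -> 0 <= tau <= PI / alpha -> 0 <= sin (alpha * tau).
Proof. intros Ha Ht; apply sin_ge_0; apply (arc_angle alpha tau); assumption. Qed.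

Lemma seg_abs (r alpha eps s : R) :
  0 < r < 1 -> 0 < alpha -> eps = 1 \/ eps = -1 -> r <= s <= 1 ->
  Rpower r alpha <= Rabs (eps * Rpower s alpha) <= 1.
Proof.
intros Hr Ha He Hs; rewrite Rabs_mult.
replace (Rabs eps) with 1 by (destruct He; subst; rewrite ?Rabs_Ropp, ?Rabs_R1; [|rewrite Rabs_left]; lra).
rewrite Rmult_1_l, Rabs_pos_eq by (left; apply exp_pos).
apply Rpower_bounds; assumption.
Qed.

Lemma theta_pos (alpha : R) : 0 < alpha -> 0 < PI / alpha.
Proof. intros Ha; apply Rdiv_lt_0_compat; [apply PI_RGT_0|exact Ha]. Qed.

Lemma polar_lin_continuous (sig b tau : R) :
  Ccontinuous_at (fun t => polar sig (b * t)) tau.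
Proof.
apply Ccontinuous_pair;
  apply (ex_derive_continuous (K := R_AbsRing) (V := R_NormedModule)); auto_derive; trivial.
Qed.

Lemma arc_curves_continuous (sig alpha tau : R) :
  Ccontinuous_at (fun t => polar sig (alpha * t)) tau /\
  Ccontinuous_at (fun t => polar sig (- (alpha * t))) tau.
Proof.
split; [apply polar_lin_continuous|].
apply (continuous_ext (fun t => polar sig (- alpha * t))); [|apply polar_lin_continuous].
intros t; f_equal; ring.
Qed.

Lemma is_derive_Rpower (alpha s : R) :
  0 < s -> is_derive (fun t => Rpower t alpha) s (alpha * Rpower s alpha * / s).
Proof.
intros Hs; apply is_derive_Reals.
replace (alpha * Rpower s alpha * / s) with (alpha * Rpower s (alpha - 1)).
- apply derivable_pt_lim_power, Hs.
- unfold Rminus; rewrite Rpower_plus, Rpower_Ropp, Rpower_1 by exact Hs; ring.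
Qed.

Lemma is_derive_seg_inv (alpha eps s : R) :
  0 < s -> eps <> 0 ->
  is_derive (fun t => / (eps * Rpower t alpha)) s (- (alpha * / (eps * Rpower s alpha) * / s)).
Proof.
intros Hs He.
assert (Hp : 0 < Rpower s alpha) by apply exp_pos.
assert (He2 : eps * Rpower s alpha <> 0) by (apply Rmult_integral_contrapositive; lra).
replace (- (alpha * / (eps * Rpower s alpha) * / s))
  with (- (eps * (alpha * Rpower s alpha * / s)) / (eps * Rpower s alpha) ^ 2) by (field; lra).
apply (is_derive_inv (fun t => eps * Rpower t alpha)); [|exact He2].
apply (is_derive_scal (fun t => Rpower t alpha)), is_derive_Rpower, Hs.
Qed.

Lemma seg_curves_continuous (alpha eps s : R) :
  0 < s -> eps = 1 \/ eps = -1 ->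
  Ccontinuous_at (fun t => RtoC (eps * Rpower t alpha)) s /\
  Ccontinuous_at (fun t => RtoC (/ (eps * Rpower t alpha))) s.
Proof.
intros Hs He; split; apply Ccontinuous_RtoC;
  apply (ex_derive_continuous (K := R_AbsRing) (V := R_NormedModule)).
- eexists; apply (is_derive_scal (fun t => Rpower t alpha)), is_derive_Rpower, Hs.
- eexists; apply is_derive_seg_inv; [exact Hs|destruct He; lra].
Qed.

Lemma Rmax_continuous (a s : R) : continuous (fun t => Rmax a t) s.
Proof.
apply (continuous_ext (fun s => (a + s + Rabs (a - s)) / 2)).
- intros t; unfold Rmax, Rabs; destruct (Rle_dec a t), (Rcase_abs (a - t)); simpl; lra.
- apply (continuous_mult (K := R_AbsRing)); [|apply continuous_const].
  apply (continuous_plus (V := R_NormedModule)).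
  + apply (continuous_plus (V := R_NormedModule)); [apply continuous_const|apply continuous_id].
  + apply continuous_Rabs_comp, (continuous_minus (V := R_NormedModule));
      [apply continuous_const|apply continuous_id].
Qed.

Lemma cont_ext_inv (a b : R) : 0 < a -> cont_ext a b (fun s => / s).
Proof.
intros Ha; exists (fun s => / Rmax a s); split.
- intros s; apply (continuous_comp (fun s => Rmax a s) Rinv); [apply Rmax_continuous|].
  apply continuous_Rinv.
  pose proof (Rmax_l a s); lra.
- intros s Hs; rewrite Rmax_right; lra.
Qed.

Lemma arc_int_rdiff (r alpha sig : R) (g : R -> R) (w : C) :
  0 < r < 1 -> 0 < alpha -> sig = 1 \/ sig = / Rpower r alpha ->
  cont_ext 0 (PI / alpha) g -> open_half_ring (Rpower r alpha) w ->
  rdiff (arc_int r alpha sig g) w (arc_int' r alpha sig g w) 0.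
Proof.
intros Hr Ha Hs Hg Hw.
pose proof (Rpower_in_01 r alpha Hr Ha) as Hrho.
pose proof (gap_pos _ w Hw) as Hgap.
pose proof (theta_pos alpha Ha) as Hth.
assert (Hsp : 0 < sig).
{ destruct Hs; subst; [lra|apply Rinv_0_lt_compat; lra]. }
apply (pair_integral_rdiff (Rpower r alpha ^ 2) (sep_const (Rpower r alpha) (gap (Rpower r alpha) w / 2))
  (gap (Rpower r alpha) w / 2) sig 0 (PI / alpha) g
  (fun t => polar sig (alpha * t)) (fun t => polar sig (- (alpha * t))) 0 w).
- apply sqr_lt_1, Hrho.
- apply sep_const_pos; lra.
- lra.
- lra.
- exact Hg.
- intros s _; apply arc_curves_continuous.
- intros s _; rewrite !Cmod_polar by lra; lra.
- intros h s Hh Hs2; apply arc_regular_near; try assumption; apply arc_sin; assumption.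
Qed.

Lemma seg_int_rdiff (r alpha eps : R) (g : R -> R) (w : C) :
  0 < r < 1 -> 0 < alpha -> eps = 1 \/ eps = -1 ->
  cont_ext r 1 g -> open_half_ring (Rpower r alpha) w ->
  rdiff (seg_int r alpha eps g) w (seg_int' r alpha eps g w) 0.
Proof.
intros Hr Ha He Hg Hw.
pose proof (Rpower_in_01 r alpha Hr Ha) as Hrho.
pose proof (gap_pos _ w Hw) as Hgap.
apply (pair_integral_rdiff (Rpower r alpha ^ 2) (sep_const (Rpower r alpha) (gap (Rpower r alpha) w / 2))
  (gap (Rpower r alpha) w / 2) (/ Rpower r alpha) r 1 (fun s => g s * / s)
  (fun t => RtoC (eps * Rpower t alpha)) (fun t => RtoC (/ (eps * Rpower t alpha))) 2 w).
- apply sqr_lt_1, Hrho.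
- apply sep_const_pos; lra.
- lra.
- lra.
- apply cont_ext_mult; [exact Hg|apply cont_ext_inv; lra].
- intros s Hs; apply seg_curves_continuous; [lra|exact He].
- intros s Hs; rewrite !Cmod_R, Rabs_inv.
  pose proof (seg_abs r alpha eps s Hr Ha He Hs) as B.
  assert (1 < / Rpower r alpha) by (rewrite <- Rinv_1; apply Rinv_lt_contravar; lra).
  split; [lra|apply Rinv_le_contravar; lra].
- intros h s Hh Hs; apply seg_regular_near; try assumption; apply seg_abs; assumption.
Qed.

Lemma rdiff_eq (f : C -> C) (z A B A' B' : C) :
  rdiff f z A B -> A = A' -> B = B' -> rdiff f z A' B'.
Proof. intros H <- <-; exact H. Qed.

Lemma rdiff_ext (f g : C -> C) (z A B : C) :
  (forall y, f y = g y) -> rdiff f z A B -> rdiff g z A B.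
Proof.
intros E H eps Heps; destruct (H eps Heps) as (d & Hd & F); exists d; split; [exact Hd|].
intros h Hh; rewrite <- !E; apply F, Hh.
Qed.

Lemma Schwarz_w_rdiff (r alpha : R) (g : R -> R -> R) (w : C) :
  0 < r < 1 -> 0 < alpha -> data_ok r alpha g -> open_half_ring (Rpower r alpha) w ->
  rdiff (Schwarz_w r alpha g) w (Schwarz_w' r alpha g w) 0.
Proof.
intros Hr Ha (G1 & G2 & G3 & G4) Hw.
pose proof (arc_int_rdiff r alpha 1 _ w Hr Ha (or_introl eq_refl) G1 Hw) as D1.
pose proof (arc_int_rdiff r alpha _ _ w Hr Ha (or_intror eq_refl) G2 Hw) as D2.
pose proof (seg_int_rdiff r alpha _ _ w Hr Ha (or_intror eq_refl) G3 Hw) as D3.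
pose proof (seg_int_rdiff r alpha _ _ w Hr Ha (or_introl eq_refl) G4 Hw) as D4.
pose proof (rdiff_plus _ _ _ _ _ _ _ D1 (rdiff_scal (-1) _ _ _ _ D2)) as E1.
pose proof (rdiff_scal Ci _ _ _ _ (rdiff_plus _ _ _ _ _ _ _ D3 (rdiff_scal (-1) _ _ _ _ D4))) as E2.
pose proof (rdiff_scal (RtoC (alpha / (2 * PI))) _ _ _ _ (rdiff_plus _ _ _ _ _ _ _ E1 E2)) as E.
eapply rdiff_eq; [eapply rdiff_ext; [|exact E]| |].
- intros y; unfold Schwarz_w; ring.
- unfold Schwarz_w'; ring.
- ring.
Qed.

(** * Constancy of the total mass *)

Lemma Kv_rdiff (q d : R) (u : C) :
  0 < q < 1 -> 0 < d -> regular q d u -> rdiff (Kv q) u (Kv' q u) 0.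
Proof.
intros Hq Hd Hu.
apply (rdiff_quadratic _ _ _ (d / 2) (Kv_C q (d / 2))); [lra|].
intros h Hh.
assert (R1 : regular q (d / 2) u) by (apply (regular_mono q d); [lra|exact Hu]).
assert (R2 : regular q (d / 2) (u + h)).
{ apply (regular_perturb q d u); try assumption.
  replace (u + h - u)%C with h by ring; lra. }
pose proof (Kv_taylor2 q (d / 2) u (u + h) Hq ltac:(lra) R1 R2) as E.
replace (u + h - u)%C with h in E by ring; exact E.
Qed.

(** Here w is fixed and the coefficient varies: this is the derivative along the contour. *)
Lemma Kv_scaled_rdiff (q d : R) (w v : C) :
  0 < q < 1 -> 0 < d -> regular q d (v * w) ->
  rdiff (fun y => Kv q (y * w)) v (Kv' q (v * w) * w) 0.
Proof.
intros Hq Hd Hv.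
apply (rdiff_comp (Kv q) (fun y => y * w)%C).
- apply (rdiff_quadratic _ _ _ 1 0); [lra|]; intros h _.
  replace ((v + h) * w - v * w - w * h)%C with (RtoC 0) by ring.
  rewrite Cmod_0; lra.
- apply (Kv_rdiff q d); assumption.
Qed.

Lemma is_CRInt_eq (f : R -> C) (a b : R) (l m : C) :
  is_CRInt f a b l -> l = m -> is_CRInt f a b m.
Proof. intros H <-; exact H. Qed.

Lemma curve_derive_plus (f g : R -> C) (s : R) (v1 v2 : C) :
  curve_derive f s v1 -> curve_derive g s v2 -> curve_derive (fun t => f t + g t)%C s (v1 + v2)%C.
Proof. apply (is_derive_plus (K := R_AbsRing) (V := C_R_NormedModule)). Qed.

Lemma curve_derive_eq (f : R -> C) (s : R) (v1 v2 : C) :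
  curve_derive f s v1 -> v1 = v2 -> curve_derive f s v2.
Proof. intros H <-; exact H. Qed.

Lemma polar_curve_derive (f : C -> C) (sig b tau : R) (A : C) :
  rdiff f (polar sig (b * tau)) A 0 ->
  curve_derive (fun t => f (polar sig (b * t))) tau (A * (Ci * b * polar sig (b * tau))).
Proof.
intros Hf.
eapply curve_derive_eq.
- apply (curve_derive_comp f (fun t => sig * cos (b * t)) (fun t => sig * sin (b * t)) tau
    (sig * (- sin (b * tau) * b)) (sig * (cos (b * tau) * b)) A).
  + auto_derive; [trivial|ring].
  + auto_derive; [trivial|ring].
  + exact Hf.
- f_equal; unfold polar; apply injective_projections; simpl; ring.
Qed.

Lemma real_curve_derive (f : C -> C) (c : R -> R) (s v : R) (A : C) :
  is_derive c s v -> rdiff f (RtoC (c s)) A 0 ->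
  curve_derive (fun t => f (RtoC (c t))) s (A * RtoC v).
Proof.
intros Hc Hf.
apply (curve_derive_comp f c (fun _ => 0) s v 0 A Hc); [|exact Hf].
apply (is_derive_const (K := R_AbsRing) (V := R_NormedModule)).
Qed.

Lemma open_half_ring_neq0 (rho : R) (w : C) : 0 < rho -> open_half_ring rho w -> w <> 0%C.
Proof. intros Hr [Hw _]; apply Cmod_pos_neq0; lra. Qed.

(* As [w d/dw Kv (c w) = c d/dc Kv (c w)], the integrand is the derivative
   along the arc of [Kv (c w) + Kv (c' w)], up to a constant factor. *)
Lemma arc_int'_one (r alpha sig : R) (w : C) :
  0 < r < 1 -> 0 < alpha -> sig = 1 \/ sig = / Rpower r alpha ->
  open_half_ring (Rpower r alpha) w ->
  (Ci * alpha * w * arc_int' r alpha sig (fun _ => 1%R) w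
   = 2 * Kv (Rpower r alpha ^ 2) (RtoC (- sig) * w) - 2 * Kv (Rpower r alpha ^ 2) (RtoC sig * w))%C.
Proof.
intros Hr Ha Hs Hw.
pose proof (Rpower_in_01 r alpha Hr Ha) as Hrho.
pose proof (gap_pos _ w Hw) as Hgap.
pose proof (theta_pos alpha Ha) as Hth.
set (rho := Rpower r alpha) in *.
set (d := sep_const rho (gap rho w / 2)).
assert (Hd : 0 < d) by (apply sep_const_pos; lra).
pose proof (sqr_lt_1 rho Hrho) as Hq.
assert (Hreg : forall tau, 0 <= tau <= PI / alpha ->
  regular (rho ^ 2) d (polar sig (alpha * tau) * w) /\
  regular (rho ^ 2) d (polar sig (- (alpha * tau)) * w)).
{ intros tau Ht; apply arc_regular_at; try assumption; apply arc_sin; assumption. }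
assert (Hk : forall tau, 0 <= tau <= PI / alpha ->
  Ccontinuous_at (fun t => pair_kernel' (rho ^ 2) (polar sig (alpha * t)) (polar sig (- (alpha * t))) w) tau).
{ intros tau Ht; destruct (Hreg tau Ht), (arc_curves_continuous sig alpha tau).
  apply (pair_kernel'_continuous _ d); assumption. }
assert (Hex : ex_CRInt (fun tau => RtoC 1 * pair_kernel' (rho ^ 2)
    (polar sig (alpha * tau)) (polar sig (- (alpha * tau))) w)%C 0 (PI / alpha)).
{ apply (ex_CRInt_weight 0 (PI / alpha) (fun _ => 1)); [lra| |exact Hk].
  apply cont_ext_continuous; intros s; apply continuous_const. }
unfold arc_int'; fold rho.
rewrite <- CRInt_scal by exact Hex.
apply is_CRInt_unique.
(* The kernel is a difference but its primitive is a sum, because the coefficient of the second term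
   runs along the arc in the opposite direction. *)
set (F := fun t => (Kv (rho ^ 2) (polar sig (alpha * t) * w)
                   + Kv (rho ^ 2) (polar sig (- alpha * t) * w))%C).
eapply is_CRInt_eq; [apply (CRInt_FTC F)|].
- lra.
- intros tau Ht; destruct (Hreg tau Ht) as [R1 R2].
  replace (- (alpha * tau)) with (- alpha * tau) in * by ring.
  eapply curve_derive_eq.
  + apply curve_derive_plus.
    * apply (polar_curve_derive (fun y => Kv (rho ^ 2) (y * w))).
      apply (Kv_scaled_rdiff _ d); assumption.
    * apply (polar_curve_derive (fun y => Kv (rho ^ 2) (y * w))).
      apply (Kv_scaled_rdiff _ d); assumption.
  + unfold pair_kernel'; rewrite RtoC_opp; ring.
- intros tau Ht; apply Ccontinuous_mult; [apply Ccontinuous_const|].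
  apply Ccontinuous_mult; [apply Ccontinuous_const|apply Hk, Ht].
- unfold F.
  replace (alpha * (PI / alpha)) with PI by (field; lra).
  replace (- alpha * (PI / alpha)) with (- PI) by (field; lra).
  rewrite !Rmult_0_r, !polar_0, polar_PI.
  replace (polar sig (- PI)) with (RtoC (- sig)).
  + ring.
  + rewrite <- Cconj_polar, polar_PI, Cconj_real; reflexivity.
Qed.

(** The principle of the arcs applied to x and 1 / x, whose logarithmic derivatives along the
    segment are opposite. The constant 2 is created by one shift, which replaces the value at
    coefficient eps rho by the one at eps / rho. *)
Lemma seg_int'_one (r alpha eps : R) (w : C) :
  0 < r < 1 -> 0 < alpha -> eps = 1 \/ eps = -1 ->
  open_half_ring (Rpower r alpha) w ->
  (alpha * w * seg_int' r alpha eps (fun _ => 1%R) w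
   = 2 * Kv (Rpower r alpha ^ 2) (RtoC eps * w)
     - 2 * Kv (Rpower r alpha ^ 2) (RtoC (eps * / Rpower r alpha) * w) + 2)%C.
Proof.
intros Hr Ha He Hw.
pose proof (Rpower_in_01 r alpha Hr Ha) as Hrho.
pose proof (gap_pos _ w Hw) as Hgap.
assert (He0 : eps <> 0) by (destruct He; lra).
assert (Hei : / eps = eps) by (destruct He; subst; field).
set (d := sep_const (Rpower r alpha) (gap (Rpower r alpha) w / 2)).
assert (Hd : 0 < d) by (apply sep_const_pos; lra).
pose proof (sqr_lt_1 _ Hrho) as Hq.
set (q := Rpower r alpha ^ 2) in *.
assert (Hreg : forall s, r <= s <= 1 ->
  regular q d (RtoC (eps * Rpower s alpha) * w) /\
  regular q d (RtoC (/ (eps * Rpower s alpha)) * w)).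
{ intros s Hs; apply seg_regular_at; try assumption; apply seg_abs; assumption. }
assert (Hk : forall s, r <= s <= 1 ->
  Ccontinuous_at (fun t => pair_kernel' q (RtoC (eps * Rpower t alpha)) (RtoC (/ (eps * Rpower t alpha))) w) s).
{ intros s Hs; destruct (Hreg s Hs), (seg_curves_continuous alpha eps s ltac:(lra) He).
  apply (pair_kernel'_continuous _ d); assumption. }
assert (Hex : ex_CRInt (fun s => RtoC (1 * / s) * pair_kernel' q
    (RtoC (eps * Rpower s alpha)) (RtoC (/ (eps * Rpower s alpha))) w)%C r 1).
{ apply (ex_CRInt_weight r 1 (fun s => 1 * / s)); [lra| |exact Hk].
  apply cont_ext_mult; [|apply cont_ext_inv; lra].
  apply cont_ext_continuous; intros s; apply continuous_const. }
unfold seg_int'; fold q.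
rewrite <- CRInt_scal by exact Hex.
apply is_CRInt_unique.
set (F := fun t => (Kv q (RtoC (eps * Rpower t alpha) * w)
                   + Kv q (RtoC (/ (eps * Rpower t alpha)) * w))%C).
eapply is_CRInt_eq; [apply (CRInt_FTC F)|].
- lra.
- intros s Hs; destruct (Hreg s Hs) as [R1 R2].
  eapply curve_derive_eq.
  + apply curve_derive_plus.
    * apply (real_curve_derive (fun y => Kv q (y * w)) (fun t => eps * Rpower t alpha)).
      -- apply (is_derive_scal (fun t => Rpower t alpha)), is_derive_Rpower; lra.
      -- apply (Kv_scaled_rdiff _ d); assumption.
    * apply (real_curve_derive (fun y => Kv q (y * w)) (fun t => / (eps * Rpower t alpha))).
      -- apply is_derive_seg_inv; [lra|exact He0].
      -- apply (Kv_scaled_rdiff _ d); assumption.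
  + unfold pair_kernel'; rewrite !RtoC_mult, !RtoC_opp, !RtoC_mult; ring.
- intros s Hs; apply Ccontinuous_mult; [apply Ccontinuous_const|].
  apply Ccontinuous_mult; [|apply Hk, Hs].
  apply Ccontinuous_RtoC, (ex_derive_continuous (K := R_AbsRing) (V := R_NormedModule)).
  auto_derive; lra.
- unfold F.
  rewrite !Rpower_1_base, !Rmult_1_r, Rinv_mult, Hei.
  destruct (Hreg r ltac:(lra)) as [_ R2]; rewrite Rinv_mult, Hei in R2.
  replace (RtoC (eps * Rpower r alpha) * w)%C with (q * (RtoC (eps * / Rpower r alpha) * w))%C.
  + rewrite (Kv_shift q d _ Hq Hd R2); ring.
  + rewrite Cmult_assoc, <- RtoC_mult; do 2 f_equal; unfold q; field; lra.
Qed.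

(** Each side contributes kernel values at the coefficients of its two end points, which are 1, -1,
    1 / rho and -1 / rho. Round the contour these cancel, and so do the constants 2 of the two
    segments. *)
Lemma Schwarz_w'_one (r alpha : R) (w : C) :
  0 < r < 1 -> 0 < alpha -> open_half_ring (Rpower r alpha) w ->
  Schwarz_w' r alpha (fun _ _ => 1) w = 0%C.
Proof.
intros Hr Ha Hw.
pose proof (Rpower_in_01 r alpha Hr Ha) as Hrho.
pose proof (arc_int'_one r alpha 1 w Hr Ha (or_introl eq_refl) Hw) as E1.
pose proof (arc_int'_one r alpha _ w Hr Ha (or_intror eq_refl) Hw) as E2.
pose proof (seg_int'_one r alpha _ w Hr Ha (or_intror eq_refl) Hw) as E3.
pose proof (seg_int'_one r alpha _ w Hr Ha (or_introl eq_refl) Hw) as E4.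
replace (-1 * / Rpower r alpha) with (- / Rpower r alpha) in E3 by ring.
replace (1 * / Rpower r alpha) with (/ Rpower r alpha) in E4 by ring.
replace (- (1)) with (-1) in E1 by ring.
unfold Schwarz_w'.
set (a1 := arc_int' r alpha 1 (fun _ => 1) w) in *.
set (a2 := arc_int' r alpha (/ Rpower r alpha) (fun _ => 1) w) in *.
set (a3 := seg_int' r alpha (-1) (fun _ => 1) w) in *.
set (a4 := seg_int' r alpha 1 (fun _ => 1) w) in *.
assert (Hw0 : w <> 0%C) by (apply (open_half_ring_neq0 (Rpower r alpha)); [lra|exact Hw]).
assert (HaC : RtoC alpha <> 0%C) by (intros F; apply RtoC_inj in F; lra).
assert (HCi : Ci <> 0%C) by (intros F; apply (f_equal snd) in F; simpl in F; lra).
assert (Z : (Ci * alpha * w * (a1 - a2 + Ci * (a3 - a4)) = 0)%C).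
{ replace (Ci * alpha * w * (a1 - a2 + Ci * (a3 - a4)))%C
    with (Ci * alpha * w * a1 - Ci * alpha * w * a2
          + (Ci * Ci) * (alpha * w * a3 - alpha * w * a4))%C by ring.
  rewrite E1, E2, E3, E4.
  replace (Ci * Ci)%C with (- RtoC 1)%C by (apply injective_projections; simpl; ring).
  ring. }
assert (Hc : (Ci * alpha * w <> 0)%C) by (repeat apply Cmult_neq_0; assumption).
apply (f_equal (fun x => / (Ci * alpha * w) * x)%C) in Z.
rewrite Cmult_assoc, Cinv_l, Cmult_1_l in Z by exact Hc.
rewrite Z; ring.
Qed.

Lemma data_ok_one (r alpha : R) : data_ok r alpha (fun _ _ => 1).
Proof.
repeat split; apply cont_ext_continuous; intros s; apply continuous_const.
Qed.

Lemma open_half_ring_polar (rho t a : R) :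
  0 < rho -> rho < t < 1 -> 0 < a < PI -> open_half_ring rho (polar t a).
Proof.
intros Hr Ht Ha; split; [rewrite Cmod_polar; lra|].
simpl; apply Rmult_lt_0_compat; [lra|apply sin_gt_0; lra].
Qed.

Lemma open_half_ring_polar_form (rho : R) (w : C) :
  0 < rho -> open_half_ring rho w ->
  exists t a, rho < t < 1 /\ 0 < a < PI /\ w = polar t a.
Proof.
intros Hr [H1 H2]; exists (Cmod w), (acos (Re w / Cmod w)).
pose proof (Cmod_sqr w) as E.
assert (Hc : -1 < Re w / Cmod w < 1).
{ assert (Re w ^ 2 < Cmod w ^ 2) by (rewrite E; nra).
  split; apply (Rmult_lt_reg_r (Cmod w)); try lra;
    unfold Rdiv; rewrite Rmult_assoc, Rinv_l, Rmult_1_r by lra; nra. }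
split; [exact H1|]; split; [apply acos_bound_lt; exact Hc|].
unfold polar; rewrite cos_acos, sin_acos by lra.
apply injective_projections; simpl.
- unfold Re; field; lra.
- replace (1 - (Re w / Cmod w)²) with ((Im w / Cmod w) * (Im w / Cmod w)).
  + rewrite sqrt_square by (apply Rlt_le, Rdiv_lt_0_compat; lra).
    unfold Im; field; lra.
  + unfold Rsqr. apply (Rmult_eq_reg_r (Cmod w ^ 2)); [|apply pow_nonzero; lra].
    transitivity (Im w ^ 2); [field; lra|].
    transitivity (Cmod w ^ 2 - Re w ^ 2); [rewrite E; ring|field; lra].
Qed.

Lemma curve_const (f : R -> C) (a b : R) :
  a <= b -> (forall s, a <= s <= b -> curve_derive f s 0) -> f a = f b.
Proof.
intros Hab H; destruct (Req_dec a b) as [->|Hne]; [reflexivity|].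
apply (eq_is_derive (V := C_R_NormedModule)); [exact H|lra].
Qed.

(** In polar coordinates the open half ring is a rectangle, so one circular and one radial path join
    any two points, and the derivative vanishes along both. *)
Lemma Schwarz_w_one_const (r alpha : R) (w1 w2 : C) :
  0 < r < 1 -> 0 < alpha ->
  open_half_ring (Rpower r alpha) w1 -> open_half_ring (Rpower r alpha) w2 ->
  Schwarz_w r alpha (fun _ _ => 1) w1 = Schwarz_w r alpha (fun _ _ => 1) w2.
Proof.
intros Hr Ha H1 H2.
pose proof (Rpower_in_01 r alpha Hr Ha) as Hrho.
set (rho := Rpower r alpha) in *.
set (M := Schwarz_w r alpha (fun _ _ => 1)).
assert (HM : forall w, open_half_ring rho w -> rdiff M w 0 0).
{ intros w Hw; eapply rdiff_eq;
    [apply (Schwarz_w_rdiff r alpha (fun _ _ => 1) w Hr Ha); [apply data_ok_one|exact Hw]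
    |exact (Schwarz_w'_one r alpha w Hr Ha Hw)|reflexivity]. }
assert (Crad : forall a t t', 0 < a < PI -> rho < t < 1 -> rho < t' < 1 -> t <= t' ->
   M (polar t a) = M (polar t' a)).
{ intros a t t' Haa Ht Ht' Htt; apply (curve_const (fun s => M (polar s a)) t t' Htt).
  intros s Hs; eapply curve_derive_eq.
  - apply (curve_derive_comp M (fun s => s * cos a) (fun s => s * sin a) s (cos a) (sin a) 0).
    + auto_derive; [trivial|ring].
    + auto_derive; [trivial|ring].
    + apply HM, (open_half_ring_polar rho s a); lra.
  - ring. }
assert (Cang : forall t a a', rho < t < 1 -> 0 < a < PI -> 0 < a' < PI -> a <= a' ->
   M (polar t a) = M (polar t a')).
{ intros t a a' Ht Haa Haa' Hle; apply (curve_const (fun s => M (polar t s)) a a' Hle).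
  intros s Hs; eapply curve_derive_eq.
  - apply (curve_derive_comp M (fun s => t * cos s) (fun s => t * sin s) s (t * - sin s) (t * cos s) 0).
    + auto_derive; [trivial|ring].
    + auto_derive; [trivial|ring].
    + apply HM, (open_half_ring_polar rho t s); lra.
  - ring. }
destruct (open_half_ring_polar_form rho w1 ltac:(lra) H1) as (t1 & a1 & T1 & A1 & ->).
destruct (open_half_ring_polar_form rho w2 ltac:(lra) H2) as (t2 & a2 & T2 & A2 & ->).
transitivity (M (polar t1 a2)).
- destruct (Rle_dec a1 a2); [apply Cang; assumption|symmetry; apply Cang; try assumption; lra].
- destruct (Rle_dec t1 t2); [apply Crad; assumption|symmetry; apply Crad; try assumption; lra].
Qed.

(** * The real Poisson densities on the four sides *)

(** The orientation signs are put into the densities, so that the four integrals are simply added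
    and all four densities are bounded below. *)
Definition arc_poisson (r alpha sig : R) (w : C) (tau : R) : R :=
  arc_sign sig * Re (arc_kernel (Rpower r alpha) sig (alpha * tau) w).

Definition seg_poisson (r alpha eps : R) (w : C) (s : R) : R :=
  eps * / s * Im (seg_kernel (Rpower r alpha) (eps * Rpower s alpha) w).

Lemma is_RInt_Reals_ext (f g : R -> R) (a b l : R) :
  a <= b -> (forall s, a <= s <= b -> f s = g s) -> is_RInt f a b l -> is_RInt g a b l.
Proof.
intros Hab E; apply (is_RInt_ext (V := R_NormedModule)).
intros s; rewrite Rmin_left, Rmax_right by exact Hab; intros Hs; apply E; lra.
Qed.

Lemma is_RInt_eq (f : R -> R) (a b l m : R) : is_RInt f a b l -> l = m -> is_RInt f a b m.
Proof. intros H <-; exact H. Qed.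

Lemma arc_int_ex (r alpha sig : R) (g : R -> R) (w : C) :
  0 < r < 1 -> 0 < alpha -> sig = 1 \/ sig = / Rpower r alpha ->
  cont_ext 0 (PI / alpha) g -> open_half_ring (Rpower r alpha) w ->
  ex_CRInt (fun tau => RtoC (g tau) * pair_kernel (Rpower r alpha ^ 2)
    (polar sig (alpha * tau)) (polar sig (- (alpha * tau))) 0 w)%C 0 (PI / alpha).
Proof.
intros Hr Ha Hs Hg Hw.
pose proof (Rpower_in_01 r alpha Hr Ha) as Hrho.
pose proof (theta_pos alpha Ha) as Hth.
pose proof (gap_pos _ w Hw) as Hgap.
apply ex_CRInt_weight; [lra|exact Hg|]; intros tau Ht.
destruct (arc_regular_at _ sig (alpha * tau) w Hrho Hw Hs (arc_sin alpha tau Ha Ht)),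
  (arc_curves_continuous sig alpha tau).
apply (pair_kernel_continuous _ (sep_const (Rpower r alpha) (gap (Rpower r alpha) w / 2)));
  try assumption; [apply sqr_lt_1, Hrho|apply sep_const_pos; lra].
Qed.

Lemma seg_int_ex (r alpha eps : R) (g : R -> R) (w : C) :
  0 < r < 1 -> 0 < alpha -> eps = 1 \/ eps = -1 ->
  cont_ext r 1 g -> open_half_ring (Rpower r alpha) w ->
  ex_CRInt (fun s => RtoC (g s * / s) * pair_kernel (Rpower r alpha ^ 2)
    (RtoC (eps * Rpower s alpha)) (RtoC (/ (eps * Rpower s alpha))) 2 w)%C r 1.
Proof.
intros Hr Ha He Hg Hw.
pose proof (Rpower_in_01 r alpha Hr Ha) as Hrho.
pose proof (gap_pos _ w Hw) as Hgap.
apply (ex_CRInt_weight r 1 (fun s => g s * / s)); [lra| |].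
- apply cont_ext_mult; [exact Hg|apply cont_ext_inv; lra].
- intros s Hs.
  destruct (seg_regular_at _ _ w Hrho Hw (seg_abs r alpha eps s Hr Ha He Hs)),
    (seg_curves_continuous alpha eps s ltac:(lra) He).
  apply (pair_kernel_continuous _ (sep_const (Rpower r alpha) (gap (Rpower r alpha) w / 2)));
    try assumption; [apply sqr_lt_1, Hrho|apply sep_const_pos; lra].
Qed.

Lemma arc_int_real (r alpha sig : R) (g : R -> R) (w : C) :
  0 < r < 1 -> 0 < alpha -> sig = 1 \/ sig = / Rpower r alpha ->
  cont_ext 0 (PI / alpha) g -> open_half_ring (Rpower r alpha) w ->
  is_RInt (fun tau => g tau * arc_poisson r alpha sig w tau) 0 (PI / alpha)
    (arc_sign sig * Re (arc_int r alpha sig g w)).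
Proof.
intros Hr Ha Hs Hg Hw.
pose proof (theta_pos alpha Ha) as Hth.
pose proof (arc_int_ex r alpha sig g w Hr Ha Hs Hg Hw) as Hex.
apply Re_CRInt in Hex.
apply (is_RInt_scal (V := R_NormedModule) _ _ _ (arc_sign sig)) in Hex.
eapply is_RInt_Reals_ext; [lra| |exact Hex].
intros tau Ht; unfold arc_poisson, arc_kernel, pair_kernel.
change scal with Rmult; cbv beta.
rewrite re_scal_l, re_plus, re_RtoC; ring.
Qed.

Lemma seg_int_real (r alpha eps : R) (g : R -> R) (w : C) :
  0 < r < 1 -> 0 < alpha -> eps = 1 \/ eps = -1 ->
  cont_ext r 1 g -> open_half_ring (Rpower r alpha) w ->
  is_RInt (fun s => g s * seg_poisson r alpha eps w s) r 1
    (eps * Im (seg_int r alpha eps g w)).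
Proof.
intros Hr Ha He Hg Hw.
pose proof (seg_int_ex r alpha eps g w Hr Ha He Hg Hw) as Hex.
apply Im_CRInt in Hex.
apply (is_RInt_scal (V := R_NormedModule) _ _ _ eps) in Hex.
eapply is_RInt_Reals_ext; [lra| |exact Hex].
intros s Hs; unfold seg_poisson, seg_kernel, pair_kernel.
change scal with Rmult; cbv beta.
rewrite im_scal_l, im_plus, im_RtoC; ring.
Qed.

Lemma arc_sign_1 : arc_sign 1 = 1.
Proof. unfold arc_sign; destruct (Req_EM_T 1 1); [reflexivity|contradiction]. Qed.

Lemma arc_sign_inv (rho : R) : 0 < rho < 1 -> arc_sign (/ rho) = -1.
Proof.
intros Hr; unfold arc_sign; destruct (Req_EM_T (/ rho) 1) as [E|_]; [|reflexivity].
assert (1 < / rho) by (rewrite <- Rinv_1; apply Rinv_lt_contravar; lra). lra.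
Qed.

Lemma Re_Schwarz_w (r alpha : R) (g : R -> R -> R) (w : C) :
  0 < r < 1 -> 0 < alpha -> data_ok r alpha g -> open_half_ring (Rpower r alpha) w ->
  exists I1 I2 I3 I4,
    is_RInt (fun tau => g 1 tau * arc_poisson r alpha 1 w tau) 0 (PI / alpha) I1 /\
    is_RInt (fun tau => g r tau * arc_poisson r alpha (/ Rpower r alpha) w tau) 0 (PI / alpha) I2 /\
    is_RInt (fun s => g s (PI / alpha) * seg_poisson r alpha (-1) w s) r 1 I3 /\
    is_RInt (fun s => g s 0 * seg_poisson r alpha 1 w s) r 1 I4 /\
    Re (Schwarz_w r alpha g w) = alpha / (2 * PI) * (I1 + I2 + I3 + I4).
Proof.
intros Hr Ha (G1 & G2 & G3 & G4) Hw.
pose proof (arc_int_real r alpha 1 _ w Hr Ha (or_introl eq_refl) G1 Hw) as D1.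
pose proof (arc_int_real r alpha _ _ w Hr Ha (or_intror eq_refl) G2 Hw) as D2.
pose proof (seg_int_real r alpha _ _ w Hr Ha (or_intror eq_refl) G3 Hw) as D3.
pose proof (seg_int_real r alpha _ _ w Hr Ha (or_introl eq_refl) G4 Hw) as D4.
do 4 eexists; repeat split; [exact D1|exact D2|exact D3|exact D4|].
rewrite arc_sign_1, arc_sign_inv by (apply Rpower_in_01; assumption).
unfold Schwarz_w; rewrite re_scal_l; f_equal.
rewrite re_plus, re_minus, (Cmult_comm Ci), re_mult_Ci, im_minus; ring.
Qed.

Lemma is_RInt_bound (f : R -> R) (a b M l : R) :
  a <= b -> (forall s, a <= s <= b -> Rabs (f s) <= M) -> is_RInt f a b l ->
  Rabs l <= M * (b - a).
Proof.
intros Hab Hf H; rewrite Rmult_comm.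
apply (norm_RInt_le (V := R_NormedModule) f (fun _ => M) a b l ((b - a) * M) Hab).
- exact Hf.
- exact H.
- apply (is_RInt_const (V := R_NormedModule)).
Qed.

(** * Evaluation of the mass near the midpoint of a side *)

(** Meant for arguments x w with x >= rho and |w| >= (1 + rho) / 2, which may leave the annulus of
    [off_poles_annulus] but stay at distance at least rho (1 - rho) / 2 from the pole rho^2. *)
Lemma off_poles_disc (rho : R) (u : C) :
  0 < rho < 1 -> rho * ((1 + rho) / 2) <= Cmod u <= 1 ->
  off_poles (rho ^ 2) (rho * (1 - rho) / 4) u.
Proof.
intros Hr Hu n.
pose proof (sqr_lt_1 rho Hr) as Hq.
destruct (pow_S_bounds (rho ^ 2) n Hq) as [[P1 _] P2].
set (p := (rho ^ 2) ^ S n) in *.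
assert (0 < rho * (1 - rho)) by nra.
split.
- pose proof (Cmod_sub_le 1 (p * u)) as E.
  rewrite Cmod_1, Cmod_mult, Cmod_R, Rabs_pos_eq, Cmod_sub_sym in E by lra.
  assert (p * Cmod u <= rho ^ 2 * 1) by (apply Rmult_le_compat; try lra; apply Cmod_ge_0).
  assert (rho * (1 - rho) <= 1 - rho ^ 2) by (simpl; nra).
  lra.
- pose proof (Cmod_sub_le u p) as E.
  rewrite Cmod_sub_sym, Cmod_R, Rabs_pos_eq in E by lra.
  simpl in P2; nra.
Qed.

(** Above the midpoint of [rho, 1] the argument x w stays away from both poles 1 and q, so only the
    term in w / x is singular, and its singular part is the half-plane Poisson kernel. The bound on
    y keeps |w| at most (3 + rho) / 4. *)
Lemma seg_kernel_poisson (rho : R) :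
  0 < rho < 1 -> exists B, 0 <= B /\ forall x y : R,
    rho <= x <= 1 -> 0 < y <= (1 - rho) / 4 ->
    Rabs (Im (seg_kernel rho x ((1 + rho) / 2, y))
      - 2 * x * y * / ((x - (1 + rho) / 2) ^ 2 + y ^ 2)) <= B * y.
Proof.
intros Hr.
pose proof (sqr_lt_1 rho Hr) as Hq.
set (d1 := rho * (1 - rho) / 4).
set (d2 := rho * (1 - rho)).
assert (Hd2 : 0 < d2) by (unfold d2; nra).
assert (Hd1 : 0 < d1) by (unfold d1; fold d2; lra).
pose proof (Kv_L_pos _ _ Hq Hd1) as HL. pose proof (Kv_C_pos _ _ Hq Hd1) as HC.
set (B2 := 4 / (d2 ^ 2 * (1 - rho ^ 2)) + 4 / (d2 ^ 3 * (1 - rho ^ 2)) * (/ rho)).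
assert (HB2 : 0 <= B2).
{ assert (0 < d2 ^ 2 /\ 0 < d2 ^ 3) as [D2 D3] by (split; apply pow_lt, Hd2).
  pose proof (Rinv_0_lt_compat rho ltac:(lra)).
  apply Rplus_le_le_0_compat; [|apply Rmult_le_pos; [|lra]];
    apply Rdiv_le_0_compat; try lra; apply Rmult_lt_0_compat; lra. }
exists (Kv_L (rho ^ 2) d1 + Kv_C (rho ^ 2) d1 * 1 + 2 * (B2 * / rho)); split.
{ pose proof (Rinv_0_lt_compat rho ltac:(lra)).
  assert (0 <= B2 * / rho) by (apply Rmult_le_pos; lra). lra. }
intros x y Hx Hy.
set (t0 := (1 + rho) / 2).
set (w := ((t0, y) : C)).
assert (Hdw : Cmod (w - t0) = y).
{ replace (w - t0)%C with (y * Ci)%C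
    by (apply injective_projections; simpl; ring).
  rewrite Cmod_mult, Cmod_Ci, Cmod_R, Rabs_pos_eq; lra. }
assert (Hmt : Cmod t0 = t0) by (rewrite Cmod_R; apply Rabs_pos_eq; unfold t0; lra).
assert (Hmw : t0 <= Cmod w <= t0 + y).
{ split.
  - pose proof (re_le_Cmod w) as E; simpl in E; pose proof (Rle_abs t0); lra.
  - replace w with (t0 + (w - t0))%C by ring.
    eapply Rle_trans; [apply Cmod_triangle|]; lra. }
assert (Hxi : 1 <= / x <= / rho).
{ split; [rewrite <- Rinv_1|]; apply Rinv_le_contravar; lra. }
assert (Hx0 : x <> 0) by lra.
assert (Hreg : forall v : C, t0 <= Cmod v <= t0 + y -> regular (rho ^ 2) d1 (x * v)).
{ intros v Hv.
  assert (M : rho * t0 <= Cmod (x * v) <= (3 + rho) / 4).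
  { rewrite Cmod_mult, Cmod_R, Rabs_pos_eq by lra. unfold t0 in *; nra. }
  split.
  - pose proof (Cmod_sub_le 1 (x * v)) as E; rewrite Cmod_1, Cmod_sub_sym in E.
    unfold d1; nra.
  - apply off_poles_disc; [exact Hr|]. unfold t0 in M; lra. }
assert (Hoff : forall v : C, t0 <= Cmod v <= t0 + y -> off_poles (rho ^ 2) d2 (RtoC (/ x) * v)).
{ intros v Hv; apply off_poles_annulus; [exact Hr|].
  rewrite Cmod_mult, Cmod_R, Rabs_pos_eq by lra.
  unfold t0 in *; nra. }
assert (Hvt : t0 <= Cmod t0 <= t0 + y) by lra.
assert (Hwx : w <> RtoC x).
{ intros E; apply (f_equal Im) in E; simpl in E; lra. }
unfold seg_kernel; rewrite im_minus, (Im_Kv_div _ x w Hx0 Hwx).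
replace (Cmod (w - x) ^ 2) with ((x - t0) ^ 2 + y ^ 2)
  by (rewrite Cmod_sqr; simpl; ring).
change (Im w) with y.
(* At the real point t0 the regular parts are real by conjugation symmetry, so Lipschitz bounds
   between t0 and w make their imaginary parts of order y. *)
assert (Z1 : Im (Kv (rho ^ 2) (x * t0)) = 0).
{ pose proof (Kv_conj _ _ _ Hd1 (Hreg t0 Hvt)) as E.
  rewrite Cconj_real in E by (simpl; ring).
  apply (f_equal Im) in E; rewrite im_conj in E; lra. }
assert (Z2 : Im (ktail (rho ^ 2) (RtoC (/ x) * t0)) = 0).
{ pose proof (ktail_conj _ _ _ Hd2 (Hoff t0 Hvt)) as E.
  rewrite Cconj_real in E by (simpl; ring).
  apply (f_equal Im) in E; rewrite im_conj in E; lra. }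
assert (E1 : Cmod (x * w - x * t0) <= y).
{ replace (x * w - x * t0)%C with (x * (w - t0))%C by ring.
  rewrite Cmod_mult, Cmod_R, Hdw, Rabs_pos_eq by lra; nra. }
assert (E2 : Cmod (RtoC (/ x) * w - RtoC (/ x) * t0) <= / rho * y).
{ replace (RtoC (/ x) * w - RtoC (/ x) * t0)%C with (RtoC (/ x) * (w - t0))%C by ring.
  rewrite Cmod_mult, Cmod_R, Hdw, Rabs_pos_eq by lra; nra. }
pose proof (Kv_lipschitz _ d1 1 _ _ Hq Hd1 (Hreg t0 Hvt) (Hreg w Hmw) ltac:(lra)) as L1.
assert (E3 : Cmod (RtoC (/ x) * w - RtoC (/ x) * t0) <= / rho) by nra.
pose proof (ktail_lipschitz _ d2 (/ rho) _ _ Hq Hd2 (Hoff t0 Hvt) (Hoff w Hmw) E3) as L2.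
fold B2 in L2.
pose proof (im_le_Cmod (Kv (rho ^ 2) (x * w) - Kv (rho ^ 2) (x * t0))) as I1.
pose proof (im_le_Cmod (ktail (rho ^ 2) (RtoC (/ x) * w) - ktail (rho ^ 2) (RtoC (/ x) * t0))) as I2.
rewrite im_minus, Z1, Rminus_0_r in I1. rewrite im_minus, Z2, Rminus_0_r in I2.
assert (J1 : Rabs (Im (Kv (rho ^ 2) (x * w))) <= (Kv_L (rho ^ 2) d1 + Kv_C (rho ^ 2) d1 * 1) * y).
{ eapply Rle_trans; [exact I1|]. eapply Rle_trans; [exact L1|].
  apply Rmult_le_compat_l; lra. }
assert (J2 : Rabs (Im (ktail (rho ^ 2) (RtoC (/ x) * w))) <= B2 * (/ rho * y)).
{ eapply Rle_trans; [exact I2|]. eapply Rle_trans; [exact L2|].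
  apply Rmult_le_compat_l; lra. }
set (X := Im (Kv (rho ^ 2) (x * w))) in *.
set (Y := Im (ktail (rho ^ 2) (RtoC (/ x) * w))) in *.
set (Z := / ((x - t0) ^ 2 + y ^ 2)).
replace (X - (- (2 * x * y * Z) + 2 * Y) - 2 * x * y * Z) with (X + - (2 * Y)) by ring.
eapply Rle_trans; [apply Rabs_triang|].
rewrite Rabs_Ropp, Rabs_mult, (Rabs_pos_eq 2) by lra.
lra.
Qed.

(** With u = s^alpha one has ds / s = du / (alpha u), which turns the integrand into the Poisson
    kernel of the half-plane, with an arctangent as primitive. *)
Lemma poisson_mass (r alpha t0 y : R) :
  0 < r < 1 -> 0 < alpha -> 0 < y ->
  is_RInt (fun s => / s * (2 * Rpower s alpha * y * / ((Rpower s alpha - t0) ^ 2 + y ^ 2))) r 1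
    (2 / alpha * (atan ((1 - t0) / y) - atan ((Rpower r alpha - t0) / y))).
Proof.
intros Hr Ha Hy.
set (F := fun s => 2 / alpha * atan ((Rpower s alpha - t0) / y)).
assert (HD : forall s, r <= s <= 1 ->
  is_derive F s (/ s * (2 * Rpower s alpha * y * / ((Rpower s alpha - t0) ^ 2 + y ^ 2)))).
{ intros s Hs.
  assert (Hp : 0 < (Rpower s alpha - t0) ^ 2 + y ^ 2).
  { pose proof (pow2_ge_0 (Rpower s alpha - t0)); pose proof (pow_lt y 2 Hy); lra. }
  assert (Hp2 : 0 < 1 + ((Rpower s alpha - t0) / y) ^ 2)
    by (pose proof (pow2_ge_0 ((Rpower s alpha - t0) / y)); lra).
  replace (/ s * (2 * Rpower s alpha * y * / ((Rpower s alpha - t0) ^ 2 + y ^ 2)))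
    with (2 / alpha * ((alpha * Rpower s alpha * / s) * / y * / (1 + ((Rpower s alpha - t0) / y) ^ 2)))
    by (field; repeat split; try lra; try (intros E; nra)).
  apply (is_derive_scal (fun s => atan ((Rpower s alpha - t0) / y))).
  apply (is_derive_comp atan (fun s => (Rpower s alpha - t0) / y)).
  - apply is_derive_Reals.
    apply derivable_pt_lim_atan.
  - apply (is_derive_ext (fun s => / y * (Rpower s alpha - t0))).
    + intros t; exact (Rmult_comm _ _).
    + rewrite (Rmult_comm _ (/ y)).
      apply (is_derive_scal (fun s => Rpower s alpha - t0)).
      replace (alpha * Rpower s alpha * / s) with (minus (alpha * Rpower s alpha * / s) 0)
        by (unfold minus, plus, opp; simpl; ring).
      apply (is_derive_minus (V := R_NormedModule) (fun s => Rpower s alpha) (fun _ => t0)).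
      * apply is_derive_Rpower; lra.
      * apply (is_derive_const (K := R_AbsRing) (V := R_NormedModule)). }
eapply is_RInt_eq.
- apply (is_RInt_derive (V := R_CompleteNormedModule) F
   (fun s => / s * (2 * Rpower s alpha * y * / ((Rpower s alpha - t0) ^ 2 + y ^ 2))));
   intros s; rewrite Rmin_left, Rmax_right by lra; intros Hs; [apply HD, Hs|].
  assert (Hp : 0 < (Rpower s alpha - t0) ^ 2 + y ^ 2).
  { pose proof (pow2_ge_0 (Rpower s alpha - t0)); pose proof (pow_lt y 2 Hy); lra. }
  assert (HcR : continuous (fun s => Rpower s alpha) s).
  { apply (ex_derive_continuous (K := R_AbsRing) (V := R_NormedModule)).
    eexists; apply is_derive_Rpower; lra. }
  apply (continuous_mult (K := R_AbsRing)).
  + apply (ex_derive_continuous (K := R_AbsRing) (V := R_NormedModule)); auto_derive; lra.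
  + apply (continuous_comp (fun s => Rpower s alpha) (fun u => 2 * u * y * / ((u - t0) ^ 2 + y ^ 2)));
      [exact HcR|].
    apply (ex_derive_continuous (K := R_AbsRing) (V := R_NormedModule)); auto_derive; simpl in *; lra.
- unfold F; rewrite Rpower_1_base; unfold minus, plus, opp; simpl; ring.
Qed.

Lemma atan_le_id (x : R) : 0 <= x -> atan x <= x.
Proof.
intros Hx; destruct (Req_dec x 0) as [->|H]; [rewrite atan_0; lra|].
destruct (MVT_gen atan 0 x (fun t => / (1 + t ^ 2))) as (c & Hc & E).
- intros t _; apply is_derive_Reals, derivable_pt_lim_atan.
- intros t _; apply derivable_continuous_pt, derivable_pt_atan.
- rewrite atan_0, !Rminus_0_r in E; rewrite E.
  assert (/ (1 + c ^ 2) <= 1).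
  { rewrite <- Rinv_1; apply Rinv_le_contravar; [lra|]. pose proof (pow2_ge_0 c); lra. }
  nra.
Qed.

Lemma arc_sign_cases (sig : R) : arc_sign sig = 1 \/ arc_sign sig = -1.
Proof. unfold arc_sign; destruct (Req_EM_T sig 1); auto. Qed.

Lemma arc_poisson_far (r alpha sig d tau : R) (w t : C) :
  0 < r < 1 -> 0 < alpha -> sig = 1 \/ sig = / Rpower r alpha -> 0 < d ->
  half_ring (Rpower r alpha) w -> half_ring_bdry (Rpower r alpha) t ->
  0 <= tau <= PI / alpha -> d <= Cmod (w - polar (/ sig) (alpha * tau)) ->
  Cmod (w - t) <= d / 2 ->
  Rabs (arc_poisson r alpha sig w tau) <= far_const (Rpower r alpha) d * Cmod (w - t).
Proof.
intros Hr Ha Hs Hd Hw Ht Htau H Hwt.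
unfold arc_poisson; rewrite Rabs_mult.
replace (Rabs (arc_sign sig)) with 1
  by (destruct (arc_sign_cases sig) as [-> | ->]; [rewrite Rabs_R1|rewrite Rabs_left]; lra).
rewrite Rmult_1_l; apply arc_kernel_far; try assumption.
- apply Rpower_in_01; assumption.
- apply arc_sin; assumption.
Qed.

Lemma seg_poisson_far (r alpha eps d s : R) (w t : C) :
  0 < r < 1 -> 0 < alpha -> eps = 1 \/ eps = -1 -> 0 < d ->
  half_ring (Rpower r alpha) w -> half_ring_bdry (Rpower r alpha) t ->
  r <= s <= 1 -> d <= Cmod (w - RtoC (eps * Rpower s alpha)) ->
  Cmod (w - t) <= d / 2 ->
  Rabs (seg_poisson r alpha eps w s) <= / r * (far_const (Rpower r alpha) d * Cmod (w - t)).
Proof.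
intros Hr Ha He Hd Hw Ht Hs H Hwt.
unfold seg_poisson; rewrite !Rabs_mult, Rabs_inv, (Rabs_pos_eq s) by lra.
replace (Rabs eps) with 1
  by (destruct He as [-> | ->]; [rewrite Rabs_R1|rewrite Rabs_left]; lra).
rewrite Rmult_1_l.
apply Rmult_le_compat; try apply Rabs_pos.
- left; apply Rinv_0_lt_compat; lra.
- apply Rinv_le_contravar; lra.
- apply seg_kernel_far; try assumption; [apply Rpower_in_01|apply seg_abs]; assumption.
Qed.

Lemma tail_const_pos (rho : R) : 0 < rho < 1 -> 0 < tail_const rho.
Proof.
intros Hr; pose proof (sqr_lt_1 rho Hr).
pose proof (Rinv_0_lt_compat rho ltac:(lra)).
unfold tail_const; apply Rdiv_lt_0_compat; [|lra].
apply Rmult_lt_0_compat; [lra|]; apply Rdiv_lt_0_compat; [lra|nra].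
Qed.

(** The factor [/ r] comes from the weight 1 / s on the segments; it is included here in order to
    have one bound for all four sides. *)
Lemma arc_poisson_lower (r alpha sig tau : R) (w : C) :
  0 < r < 1 -> 0 < alpha -> sig = 1 \/ sig = / Rpower r alpha ->
  open_half_ring (Rpower r alpha) w -> 0 <= tau <= PI / alpha ->
  - (/ r * (4 * tail_const (Rpower r alpha))) <= arc_poisson r alpha sig w tau.
Proof.
intros Hr Ha Hs Hw Htau.
pose proof (Rpower_in_01 r alpha Hr Ha) as Hrho.
pose proof (tail_const_pos _ Hrho) as HT.
pose proof (arc_kernel_lower _ (gap (Rpower r alpha) w) sig (alpha * tau) w Hrho
  (gap_pos _ w Hw) (half_ring_open _ w Hw) Hs (arc_sin alpha tau Ha Htau)
  (gap_arc _ sig (alpha * tau) w Hrho Hw Hs)) as E.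
assert (1 < / r) by (rewrite <- Rinv_1; apply Rinv_lt_contravar; lra).
unfold arc_poisson; nra.
Qed.

Lemma seg_poisson_lower (r alpha eps s : R) (w : C) :
  0 < r < 1 -> 0 < alpha -> eps = 1 \/ eps = -1 ->
  open_half_ring (Rpower r alpha) w -> r <= s <= 1 ->
  - (/ r * (4 * tail_const (Rpower r alpha))) <= seg_poisson r alpha eps w s.
Proof.
intros Hr Ha He Hw Hs.
pose proof (Rpower_in_01 r alpha Hr Ha) as Hrho.
pose proof (tail_const_pos _ Hrho) as HT.
pose proof (seg_kernel_lower _ (gap (Rpower r alpha) w) _ w Hrho
  (gap_pos _ w Hw) (half_ring_open _ w Hw) (seg_abs r alpha eps s Hr Ha He Hs)
  (gap_seg _ _ w)) as E.
assert (Hp : 0 < Rpower s alpha) by apply exp_pos.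
replace (sign (eps * Rpower s alpha)) with eps in E
  by (destruct He as [-> | ->]; [rewrite sign_eq_1|rewrite sign_eq_m1]; lra).
assert (Hsi : 0 < / s <= / r).
{ split; [apply Rinv_0_lt_compat|apply Rinv_le_contravar]; lra. }
unfold seg_poisson.
set (X := Im (seg_kernel (Rpower r alpha) (eps * Rpower s alpha) w)) in *.
replace (eps * / s * X) with (/ s * (eps * X)) by ring.
assert (/ s * - (4 * tail_const (Rpower r alpha)) <= / s * (eps * X))
  by (apply Rmult_le_compat_l; lra).
assert (/ s * (4 * tail_const (Rpower r alpha)) <= / r * (4 * tail_const (Rpower r alpha)))
  by (apply Rmult_le_compat_r; lra).
lra.
Qed.

Lemma eq_0_of_linear_bound (c B y0 : R) :
  0 < y0 -> (forall y, 0 < y <= y0 -> Rabs c <= B * y) -> c = 0.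
Proof.
intros Hy0 H.
apply Rabs_eq_0, Rle_antisym; [|apply Rabs_pos].
apply le_epsilon; intros e He; rewrite Rplus_0_l.
set (N := Rabs B + 1).
assert (HN : 0 < N) by (pose proof (Rabs_pos B); unfold N; lra).
assert (Hm : 0 < Rmin y0 (e / N)) by (apply Rmin_glb_lt; [|apply Rdiv_lt_0_compat]; lra).
specialize (H (Rmin y0 (e / N)) (conj Hm (Rmin_l _ _))).
pose proof (Rmin_r y0 (e / N)) as E.
assert (B * Rmin y0 (e / N) <= N * (e / N)).
{ apply Rle_trans with (N * Rmin y0 (e / N)).
  - apply Rmult_le_compat_r; [lra|]. pose proof (Rle_abs B); unfold N; lra.
  - apply Rmult_le_compat_l; lra. }
replace (N * (e / N)) with e in * by (field; lra). lra.
Qed.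

(* The mass is independent of [w]; it is evaluated by letting [w] tend to the
   midpoint of the side [rho, 1], where the kernel is a half-plane Poisson
   kernel up to an error vanishing linearly in [Im w]. *)
Lemma Schwarz_w_one (r alpha : R) (w : C) :
  0 < r < 1 -> 0 < alpha -> open_half_ring (Rpower r alpha) w ->
  Re (Schwarz_w r alpha (fun _ _ => 1) w) = 1.
Proof.
intros Hr Ha Hw.
pose proof (Rpower_in_01 r alpha Hr Ha) as Hrho.
pose proof (theta_pos alpha Ha) as Hth.
set (rho := Rpower r alpha) in *.
(* Half the distance from the midpoint of [rho, 1] to its ends; for y <= d0 / 2 the three other
   sides are farther than d0 from the test point. *)
set (d0 := (1 - rho) / 4).
assert (Hd0 : 0 < d0) by (unfold d0; lra).
pose proof (far_const_pos rho d0 Hrho Hd0) as HF.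
set (F := far_const rho d0) in *.
destruct (seg_kernel_poisson rho Hrho) as (B & HB & HP).
set (t0 := (1 + rho) / 2) in *.
pose proof (Rinv_0_lt_compat r ltac:(lra)) as Hri.
assert (Hk : 0 < (1 - t0)) by (unfold t0; lra).
(* The contributions are, in order, the two arcs, the opposite segment, the deviation from the
   half-plane kernel on [rho, 1], and the defect of the arctangents. *)
set (BB := alpha / (2 * PI) * (2 * (F * (PI / alpha)) + / r * F * (1 - r) + / r * B * (1 - r)
    + 4 / alpha * / (1 - t0))).
apply Rminus_diag_uniq, (eq_0_of_linear_bound _ BB (d0 / 2)); [lra|].
intros y Hy.
set (wy := ((t0, y) : C)).
assert (Hdw : Cmod (wy - t0) = y).
{ replace (wy - t0)%C with (y * Ci)%C by (apply injective_projections; simpl; ring).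
  rewrite Cmod_mult, Cmod_Ci, Cmod_R, Rabs_pos_eq; lra. }
assert (Hmt : Cmod t0 = t0) by (rewrite Cmod_R; apply Rabs_pos_eq; unfold t0; lra).
assert (Hmw : t0 <= Cmod wy <= t0 + y).
{ split.
  - pose proof (re_le_Cmod wy) as E; simpl in E; pose proof (Rle_abs t0); lra.
  - replace wy with (t0 + (wy - t0))%C by ring.
    eapply Rle_trans; [apply Cmod_triangle|]; lra. }
assert (Hwy : open_half_ring rho wy).
{ split; [unfold t0, d0 in *; lra|simpl; lra]. }
assert (Ht : half_ring_bdry rho t0).
{ split; [split; [rewrite Hmt; unfold t0; lra|simpl; lra]|left; reflexivity]. }
rewrite (Schwarz_w_one_const r alpha w wy Hr Ha Hw Hwy).
destruct (Re_Schwarz_w r alpha _ wy Hr Ha (data_ok_one r alpha) Hwy)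
  as (I1 & I2 & I3 & I4 & D1 & D2 & D3 & D4 & E).
rewrite E; fold rho in D2.
assert (Harc : forall sig I, sig = 1 \/ sig = / rho ->
  is_RInt (fun tau => 1 * arc_poisson r alpha sig wy tau) 0 (PI / alpha) I ->
  Rabs I <= F * y * (PI / alpha)).
{ intros sig I Hs D; rewrite <- (Rminus_0_r (PI / alpha)).
  apply (is_RInt_bound _ _ _ (F * y) _ (Rlt_le _ _ Hth)) with (2 := D).
  intros tau Htau; rewrite Rmult_1_l, <- Hdw.
  apply arc_poisson_far; try assumption.
  - apply half_ring_open, Hwy.
  - pose proof (Cmod_sub_le wy (polar (/ sig) (alpha * tau))) as E1.
    pose proof (Cmod_sub_le (polar (/ sig) (alpha * tau)) wy) as E2.
    rewrite (Cmod_sub_sym _ wy) in E2.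
    destruct Hs; subst sig; rewrite ?Rinv_1, ?Rinv_inv in *; rewrite Cmod_polar in * by lra;
      unfold t0, d0 in *; lra.
  - lra. }
pose proof (Harc 1 I1 (or_introl eq_refl) D1) as B1.
pose proof (Harc (/ rho) I2 (or_intror eq_refl) D2) as B2.
assert (B3 : Rabs I3 <= / r * (F * y) * (1 - r)).
{ apply (is_RInt_bound _ _ _ _ _ (Rlt_le _ _ (proj2 Hr))) with (2 := D3).
  intros s Hs; rewrite Rmult_1_l, <- Hdw.
  apply seg_poisson_far; try assumption; [right; reflexivity|apply half_ring_open, Hwy| |lra].
  pose proof (re_le_Cmod (wy - RtoC (-1 * Rpower s alpha))) as E1.
  rewrite re_minus, re_RtoC in E1; simpl Re in E1.
  assert (0 < Rpower s alpha) by apply exp_pos.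
  pose proof (Rle_abs (t0 - -1 * Rpower s alpha)).
  unfold t0, d0 in *; lra. }
pose proof (poisson_mass r alpha t0 y Hr Ha ltac:(lra)) as DP.
fold rho in DP.
pose proof (is_RInt_minus (V := R_NormedModule) _ _ _ _ _ _ D4 DP) as D5.
assert (B4 : Rabs (I4 - 2 / alpha * (atan ((1 - t0) / y) - atan ((rho - t0) / y)))
   <= / r * (B * y) * (1 - r)).
{ apply (is_RInt_bound _ _ _ _ _ (Rlt_le _ _ (proj2 Hr))) with (2 := D5).
  intros s Hs; unfold minus, plus, opp; simpl.
  pose proof (Rpower_bounds r alpha s Hr Ha Hs) as Hx; fold rho in Hx.
  pose proof (HP (Rpower s alpha) y Hx ltac:(unfold d0 in *; lra)) as Hp.
  fold wy in Hp.
  unfold seg_poisson; fold rho; rewrite !Rmult_1_l.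
  match goal with |- Rabs ?X <= _ => replace X with
    (/ s * (Im (seg_kernel rho (Rpower s alpha) wy)
      - 2 * Rpower s alpha * y * / ((Rpower s alpha - t0) ^ 2 + y ^ 2)))
    by (simpl; ring) end.
  rewrite Rabs_mult, Rabs_inv, (Rabs_pos_eq s) by lra.
  apply Rmult_le_compat; try apply Rabs_pos.
  - left; apply Rinv_0_lt_compat; lra.
  - apply Rinv_le_contravar; lra.
  - exact Hp. }
(* As t0 is the midpoint the two arctangents are opposite, and the reflection x -> 1 / x of the
   arctangent shows that their difference is PI up to a term of order y. *)
assert (Hat : (rho - t0) / y = - ((1 - t0) / y)) by (unfold t0; field; lra).
rewrite Hat, atan_opp in B4.
assert (Hky : 0 < (1 - t0) / y) by (apply Rdiv_lt_0_compat; lra).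
pose proof (atan_inv _ Hky) as Hinv.
replace (/ ((1 - t0) / y)) with (y * / (1 - t0)) in Hinv by (field; lra).
pose proof (Rinv_0_lt_compat _ Hk) as Hki.
assert (Hyk : 0 <= y * / (1 - t0)) by (apply Rmult_le_pos; lra).
pose proof (atan_le_id _ Hyk) as A1.
assert (A0 : 0 <= atan (y * / (1 - t0))).
{ destruct (Req_dec (y * / (1 - t0)) 0) as [-> |]; [rewrite atan_0; lra|].
  rewrite <- atan_0; left; apply atan_increasing; lra. }
replace (atan ((1 - t0) / y)) with (PI / 2 - atan (y * / (1 - t0))) in B4 by lra.
set (A := atan (y * / (1 - t0))) in *.
replace (2 / alpha * (PI / 2 - A - - (PI / 2 - A))) with (2 * PI / alpha - 4 / alpha * A) in B4
  by (field; lra).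
pose proof PI_RGT_0 as Hpi.
replace (alpha / (2 * PI) * (I1 + I2 + I3 + I4) - 1)
  with (alpha / (2 * PI) * (I1 + (I2 + (I3 + ((I4 - (2 * PI / alpha - 4 / alpha * A)) + - (4 / alpha * A))))))
  by (field; lra).
assert (Hc : 0 < alpha / (2 * PI)) by (apply Rdiv_lt_0_compat; lra).
rewrite Rabs_mult, (Rabs_pos_eq (alpha / (2 * PI))) by lra.
unfold BB; rewrite (Rmult_assoc (alpha / (2 * PI))).
apply Rmult_le_compat_l; [lra|].
assert (H4 : 0 < 4 / alpha) by (apply Rdiv_lt_0_compat; lra).
assert (B5 : Rabs (- (4 / alpha * A)) <= 4 / alpha * (y * / (1 - t0))).
{ rewrite Rabs_Ropp, Rabs_pos_eq by (apply Rmult_le_pos; lra).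
  apply Rmult_le_compat_l; lra. }
set (X4 := I4 - (2 * PI / alpha - 4 / alpha * A)) in *.
set (X5 := - (4 / alpha * A)) in *.
pose proof (Rabs_triang I1 (I2 + (I3 + (X4 + X5)))).
pose proof (Rabs_triang I2 (I3 + (X4 + X5))).
pose proof (Rabs_triang I3 (X4 + X5)).
pose proof (Rabs_triang X4 X5).
lra.
Qed.

(** * Approximation of unity and boundary values in the half ring *)

(** The kernel may change sign, and |P| <= P + 2 N replaces positivity. The bound is in terms of the
    mass [J] of this one side; only the sum of the four masses is known, so the four estimates have
    to be added before any mass is evaluated. *)
Lemma weighted_mean_bound (P g : R -> R) (a b c e N B F I J : R) :
  a <= b -> 0 <= e -> 0 <= N -> 0 <= B -> 0 <= F ->
  is_RInt (fun s => g s * P s) a b I -> is_RInt (fun s => 1 * P s) a b J ->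
  (forall s, a <= s <= b -> - N <= P s) ->
  (forall s, a <= s <= b ->
     Rabs (g s - c) <= e \/ (Rabs (g s - c) <= B /\ Rabs (P s) <= F)) ->
  Rabs (I - c * J) <= e * (J + 2 * N * (b - a)) + B * F * (b - a).
Proof.
intros Hab He HN HB HF HI HJ HP Hg.
pose proof (is_RInt_minus (V := R_NormedModule) _ _ _ _ _ _ HI
  (is_RInt_scal (V := R_NormedModule) _ _ _ c _ HJ)) as D.
assert (D2 : is_RInt (fun s => e * (1 * P s) + (e * (2 * N) + B * F)) a b
   (e * J + (b - a) * (e * (2 * N) + B * F))).
{ apply (is_RInt_plus (V := R_NormedModule)).
  - apply (is_RInt_scal (V := R_NormedModule) _ _ _ e _ HJ).
  - apply (is_RInt_const (V := R_NormedModule)). }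
pose proof (fun H => norm_RInt_le (V := R_NormedModule) _ _ a b _ _ Hab H D D2) as K.
eapply Rle_trans; [apply K|right; ring].
intros s Hs.
change (Rabs (g s * P s - c * (1 * P s)) <= e * (1 * P s) + (e * (2 * N) + B * F)).
replace (g s * P s - c * (1 * P s)) with ((g s - c) * P s) by ring.
rewrite Rabs_mult.
specialize (HP s Hs).
assert (HPa : Rabs (P s) <= P s + 2 * N) by (apply Rabs_le; lra).
pose proof (Rabs_pos (P s)). pose proof (Rabs_pos (g s - c)).
assert (HBF : 0 <= B * F) by (apply Rmult_le_pos; assumption).
destruct (Hg s Hs) as [G|[G1 G2]].
- assert (Rabs (g s - c) * Rabs (P s) <= e * (P s + 2 * N))
    by (apply Rmult_le_compat; assumption).
  lra.
- assert (Rabs (g s - c) * Rabs (P s) <= B * F) by (apply Rmult_le_compat; assumption).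
  assert (0 <= e * (P s + 2 * N)) by (apply Rmult_le_pos; lra).
  lra.
Qed.

(** The boundary is described by parameters, since for alpha = 1/2 the two segments coincide as sets
    while their parameters, and the images of these under [polar_pow], differ. *)
Definition bdry_param (r alpha s phi : R) : Prop :=
  ((s = 1 \/ s = r) /\ 0 <= phi <= PI / alpha) \/
  (r <= s <= 1 /\ (phi = 0 \/ phi = PI / alpha)).

(** The neighbourhood is centred at w and taken in the half ring, because a point of the slit has
    two images there and only the one near w must be controlled. *)
Definition data_close (r alpha d e B c : R) (w : C) (g : R -> R -> R) : Prop :=
  forall s phi, bdry_param r alpha s phi ->
    Rabs (g s phi - c) <= B /\
    (Cmod (w - polar_pow s phi alpha) < d -> Rabs (g s phi - c) <= e).

(** The order of quantifiers is the point: [M0] depends on r and alpha alone, and [eta] is chosen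
    before the data, which in the application vary with z. *)
Lemma Schwarz_w_boundary (r alpha : R) :
  0 < r < 1 -> 0 < alpha ->
  exists M0, 0 < M0 /\ forall B d, 0 < B -> 0 < d -> forall eps, 0 < eps ->
  exists eta, 0 < eta /\ forall g e c w t,
    0 <= e -> data_ok r alpha g -> open_half_ring (Rpower r alpha) w ->
    half_ring_bdry (Rpower r alpha) t -> Cmod (w - t) <= eta ->
    data_close r alpha d e B c w g ->
    Rabs (Re (Schwarz_w r alpha g w) - c) <= e * M0 + eps.
Proof.
intros Hr Ha.
pose proof (Rpower_in_01 r alpha Hr Ha) as Hrho.
pose proof (theta_pos alpha Ha) as Hth.
pose proof PI_RGT_0 as Hpi.
pose proof (tail_const_pos _ Hrho) as HT.
pose proof (Rinv_0_lt_compat r ltac:(lra)) as Hri.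
assert (Hri1 : 1 < / r) by (rewrite <- Rinv_1; apply Rinv_lt_contravar; lra).
assert (Hc : 0 < alpha / (2 * PI)) by (apply Rdiv_lt_0_compat; lra).
set (N := / r * (4 * tail_const (Rpower r alpha))).
assert (HN : 0 < N) by (unfold N; apply Rmult_lt_0_compat; lra).
set (L := 2 * (PI / alpha) + 2 * (1 - r)).
assert (HL : 0 < L) by (unfold L; lra).
(* A bound for the normalised integral of |P| over the four sides: the mass 1 plus 2 N times the
   total length [L] of the parameter intervals. *)
exists (1 + alpha / (2 * PI) * (2 * N * L)); split.
{ assert (0 < 2 * N * L) by (apply Rmult_lt_0_compat; [lra|exact HL]).
  assert (0 < alpha / (2 * PI) * (2 * N * L)) by (apply Rmult_lt_0_compat; assumption). lra. }
intros B d HB Hd eps Heps.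
pose proof (far_const_pos _ d Hrho Hd) as HF.
set (F := far_const (Rpower r alpha) d) in *.
set (Q := alpha / (2 * PI) * (B * (/ r * F) * L)).
assert (HQ : 0 < Q).
{ unfold Q; apply Rmult_lt_0_compat; [exact Hc|]. apply Rmult_lt_0_compat; [|exact HL].
  apply Rmult_lt_0_compat; [exact HB|]. apply Rmult_lt_0_compat; assumption. }
exists (Rmin (d / 2) (eps / Q)); split.
{ apply Rmin_glb_lt; [lra|apply Rdiv_lt_0_compat; lra]. }
intros g e c w t He Hg Hw Ht Hwt Hcl.
pose proof (Rmin_l (d / 2) (eps / Q)) as M1. pose proof (Rmin_r (d / 2) (eps / Q)) as M2.
set (x := Cmod (w - t)) in *.
assert (Hx : 0 <= x) by apply Cmod_ge_0.
pose proof (half_ring_open _ w Hw) as Hwc.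
destruct (Re_Schwarz_w r alpha g w Hr Ha Hg Hw) as (I1 & I2 & I3 & I4 & D1 & D2 & D3 & D4 & E).
destruct (Re_Schwarz_w r alpha _ w Hr Ha (data_ok_one r alpha) Hw)
  as (J1 & J2 & J3 & J4 & K1 & K2 & K3 & K4 & E1).
rewrite (Schwarz_w_one r alpha w Hr Ha Hw) in E1.
assert (HFx : 0 <= F * x) by (apply Rmult_le_pos; lra).
assert (HFx2 : F * x <= / r * (F * x)) by nra.
assert (HFx3 : 0 <= / r * (F * x)) by lra.
assert (Harc : forall sig s I J, sig = 1 /\ s = 1 \/ sig = / Rpower r alpha /\ s = r ->
  is_RInt (fun tau => g s tau * arc_poisson r alpha sig w tau) 0 (PI / alpha) I ->
  is_RInt (fun tau => 1 * arc_poisson r alpha sig w tau) 0 (PI / alpha) J ->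
  Rabs (I - c * J) <= e * (J + 2 * N * (PI / alpha - 0)) + B * (/ r * (F * x)) * (PI / alpha - 0)).
{ intros sig s I J Hs HI HJ.
  assert (Hsig : sig = 1 \/ sig = / Rpower r alpha) by (destruct Hs as [[]|[]]; auto).
  apply (weighted_mean_bound (arc_poisson r alpha sig w) (g s)); try assumption; try lra.
  - intros tau Htau; apply arc_poisson_lower; assumption.
  - intros tau Htau.
    assert (Hpp : polar (/ sig) (alpha * tau) = polar_pow s tau alpha).
    { unfold polar_pow; destruct Hs as [[-> ->]|[-> ->]];
        [rewrite Rpower_1_base, Rinv_1|rewrite Rinv_inv]; reflexivity. }
    destruct (Hcl s tau) as [C1 C2]; [left; split; [destruct Hs as [[]|[]]; auto|assumption]|].
    destruct (Rlt_dec (Cmod (w - polar_pow s tau alpha)) d) as [Hn|Hn]; [left; auto|right].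
    split; [exact C1|].
    eapply Rle_trans; [|exact HFx2].
    apply arc_poisson_far; try assumption; [rewrite Hpp|fold x]; lra. }
assert (Hseg : forall eps' phi I J, eps' = -1 /\ phi = PI / alpha \/ eps' = 1 /\ phi = 0 ->
  is_RInt (fun s => g s phi * seg_poisson r alpha eps' w s) r 1 I ->
  is_RInt (fun s => 1 * seg_poisson r alpha eps' w s) r 1 J ->
  Rabs (I - c * J) <= e * (J + 2 * N * (1 - r)) + B * (/ r * (F * x)) * (1 - r)).
{ intros eps' phi I J Hs HI HJ.
  assert (Hsig : eps' = 1 \/ eps' = -1) by (destruct Hs as [[]|[]]; auto).
  apply (weighted_mean_bound (seg_poisson r alpha eps' w) (fun s => g s phi)); try assumption; try lra.
  - intros s Hs2; apply seg_poisson_lower; assumption.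
  - intros s Hs2.
    assert (Hpp : RtoC (eps' * Rpower s alpha) = polar_pow s phi alpha).
    { unfold polar_pow; destruct Hs as [[-> ->]|[-> ->]].
      - replace (alpha * (PI / alpha)) with PI by (field; lra).
        rewrite polar_PI; f_equal; ring.
      - rewrite Rmult_0_r, polar_0; f_equal; ring. }
    destruct (Hcl s phi) as [C1 C2]; [right; split; [assumption|destruct Hs as [[]|[]]; auto]|].
    destruct (Rlt_dec (Cmod (w - polar_pow s phi alpha)) d) as [Hn|Hn]; [left; auto|right].
    split; [exact C1|].
    apply seg_poisson_far; try assumption; [rewrite Hpp|fold x]; lra. }
pose proof (Harc 1 1 I1 J1 (or_introl (conj eq_refl eq_refl)) D1 K1) as B1.
pose proof (Harc _ r I2 J2 (or_intror (conj eq_refl eq_refl)) D2 K2) as B2.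
pose proof (Hseg (-1) (PI / alpha) I3 J3 (or_introl (conj eq_refl eq_refl)) D3 K3) as B3.
pose proof (Hseg 1 0 I4 J4 (or_intror (conj eq_refl eq_refl)) D4 K4) as B4.
assert (HJ : J1 + J2 + J3 + J4 = 2 * PI / alpha).
{ apply (Rmult_eq_reg_l (alpha / (2 * PI))); [|lra]. rewrite <- E1; field; lra. }
replace (Re (Schwarz_w r alpha g w) - c)
  with (alpha / (2 * PI) * ((I1 - c * J1) + ((I2 - c * J2) + ((I3 - c * J3) + (I4 - c * J4))))).
2:{ rewrite E; transitivity (alpha / (2 * PI) * (I1 + I2 + I3 + I4)
      - c * (alpha / (2 * PI) * (J1 + J2 + J3 + J4))); [ring|rewrite <- E1; ring]. }
rewrite Rabs_mult, (Rabs_pos_eq (alpha / (2 * PI))) by lra.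
set (X1 := I1 - c * J1) in *. set (X2 := I2 - c * J2) in *.
set (X3 := I3 - c * J3) in *. set (X4 := I4 - c * J4) in *.
pose proof (Rabs_triang X1 (X2 + (X3 + X4))).
pose proof (Rabs_triang X2 (X3 + X4)).
pose proof (Rabs_triang X3 X4).
assert (Hsum : Rabs (X1 + (X2 + (X3 + X4)))
  <= e * (2 * PI / alpha + 2 * N * L) + B * (/ r * (F * x)) * L).
{ rewrite <- HJ; unfold L.
  replace (e * (J1 + J2 + J3 + J4 + 2 * N * (2 * (PI / alpha) + 2 * (1 - r)))
     + B * (/ r * (F * x)) * (2 * (PI / alpha) + 2 * (1 - r)))
   with ((e * (J1 + 2 * N * (PI / alpha - 0)) + B * (/ r * (F * x)) * (PI / alpha - 0))
    + (e * (J2 + 2 * N * (PI / alpha - 0)) + B * (/ r * (F * x)) * (PI / alpha - 0))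
    + (e * (J3 + 2 * N * (1 - r)) + B * (/ r * (F * x)) * (1 - r))
    + (e * (J4 + 2 * N * (1 - r)) + B * (/ r * (F * x)) * (1 - r))) by ring.
  lra. }
apply Rle_trans with (alpha / (2 * PI) * (e * (2 * PI / alpha + 2 * N * L) + B * (/ r * (F * x)) * L)).
{ apply Rmult_le_compat_l; lra. }
replace (alpha / (2 * PI) * (e * (2 * PI / alpha + 2 * N * L) + B * (/ r * (F * x)) * L))
  with (e * (1 + alpha / (2 * PI) * (2 * N * L)) + Q * x) by (unfold Q; field; lra).
apply Rplus_le_compat_l.
replace eps with (Q * (eps / Q)) by (field; lra).
apply Rmult_le_compat_l; lra.
Qed.

(** * The power map on the sector ring *)

Lemma polar_Carg (z : C) : z <> 0%C -> 0 <= Carg z < 2 * PI /\ polar (Cmod z) (Carg z) = z.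
Proof.
intros Hz.
pose proof (proj1 (Cmod_gt_0 z) Hz) as Hm.
pose proof PI_RGT_0 as Hpi.
pose proof (Cmod_sqr z) as E.
assert (Hb : -1 <= Re z / Cmod z <= 1).
{ pose proof (re_le_Cmod z) as H; apply Rabs_le_between in H.
  split; apply (Rmult_le_reg_r (Cmod z)); try exact Hm;
    unfold Rdiv; rewrite Rmult_assoc, Rinv_l, Rmult_1_r; lra. }
assert (Hs : sqrt (1 - (Re z / Cmod z)²) = Rabs (Im z) / Cmod z).
{ replace (1 - (Re z / Cmod z)²) with ((Rabs (Im z) / Cmod z) * (Rabs (Im z) / Cmod z)).
  - apply sqrt_square, Rdiv_le_0_compat; [apply Rabs_pos|exact Hm].
  - unfold Rsqr; apply (Rmult_eq_reg_r (Cmod z ^ 2)); [|apply pow_nonzero; lra].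
    transitivity (Rabs (Im z) ^ 2); [field; lra|].
    rewrite pow2_abs.
    transitivity (Cmod z ^ 2 - Re z ^ 2); [rewrite E; ring|field; lra]. }
pose proof (acos_bound (Re z / Cmod z)) as Ha.
unfold Carg; destruct (Rle_dec 0 (Im z)) as [Hi|Hi].
- split; [lra|].
  unfold polar; rewrite cos_acos, sin_acos, Hs, Rabs_pos_eq by assumption.
  apply injective_projections; simpl; unfold Re, Im; field; lra.
- split.
  + assert (0 < acos (Re z / Cmod z)); [|lra].
    destruct (Req_dec (acos (Re z / Cmod z)) 0) as [E0|]; [|lra].
    exfalso; assert (S : sin (acos (Re z / Cmod z)) = 0) by (rewrite E0; apply sin_0).
    rewrite sin_acos, Hs in S by exact Hb.
    apply Rmult_integral in S; destruct S as [S|S].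
    * revert S; apply Rabs_no_R0; lra.
    * revert S; apply Rinv_neq_0_compat; lra.
  + unfold polar; rewrite cos_minus, sin_minus, cos_2PI, sin_2PI, cos_acos, sin_acos, Hs, Rabs_left by (try exact Hb; lra).
    apply injective_projections; simpl; unfold Re, Im; field; lra.
Qed.

Lemma polar_dist_sqr (s a t b : R) :
  Cmod (polar s a - polar t b) ^ 2 = (s - t) ^ 2 + 4 * s * t * sin ((a - b) / 2) ^ 2.
Proof.
rewrite Cmod_sqr; simpl.
assert (E : cos a * cos b + sin a * sin b = 1 - 2 * (sin ((a - b) / 2) * sin ((a - b) / 2))).
{ rewrite <- cos_minus; replace (a - b) with (2 * ((a - b) / 2)) at 1 by field.
  rewrite cos_2a_sin; ring. }
pose proof (sin2_cos2 a) as A; pose proof (sin2_cos2 b) as B; unfold Rsqr in A, B.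
transitivity (s * s * (sin a * sin a + cos a * cos a) + t * t * (sin b * sin b + cos b * cos b)
  - 2 * s * t * (cos a * cos b + sin a * sin b)); [simpl; ring|].
rewrite A, B, E; ring.
Qed.

(** A crude form of Jordan's inequality: up to PI / 6 the cosine is at least 1/2, and beyond it the
    sine is at least 1/2, which suffices because PI <= 4. *)
Lemma sin_ge_quarter (x : R) : 0 <= x <= PI / 2 -> x / 4 <= sin x.
Proof.
intros Hx; pose proof PI_4 as H4; pose proof PI_RGT_0 as Hpi.
destruct (Rle_dec x (PI / 6)) as [H|H].
- destruct (Req_dec x 0) as [->|H0]; [rewrite sin_0; lra|].
  destruct (MVT_gen sin 0 x cos) as (c & Hc & E).
  + intros t _; apply is_derive_Reals, derivable_pt_lim_sin.
  + intros t _; apply derivable_continuous_pt, derivable_pt_sin.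
  + rewrite sin_0, !Rminus_0_r in E; rewrite E.
    rewrite Rmin_left, Rmax_right in Hc by lra.
    assert (/ 2 <= cos c); [|nra].
    replace (/ 2) with (cos (PI / 3)) by (rewrite cos_PI3; field).
    apply cos_decr_1; lra.
- assert (/ 2 <= sin x); [|lra].
  replace (/ 2) with (sin (PI / 6)) by (rewrite sin_PI6; field).
  apply sin_incr_1; lra.
Qed.

Lemma polar_dist_ge_mod (s a t b : R) : 0 <= s -> 0 <= t ->
  Rabs (s - t) <= Cmod (polar s a - polar t b).
Proof.
intros Hs Ht.
pose proof (Cmod_sub_le (polar s a) (polar t b)) as H1.
pose proof (Cmod_sub_le (polar t b) (polar s a)) as H2.
rewrite Cmod_sub_sym in H2; rewrite !Cmod_polar in * by assumption.
apply Rabs_le; lra.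
Qed.

Lemma polar_dist_ge_sin (m s a t b : R) : 0 <= m -> m <= s -> m <= t ->
  2 * m * Rabs (sin ((a - b) / 2)) <= Cmod (polar s a - polar t b).
Proof.
intros Hm Hs Ht; apply sqr_le_le; [apply Cmod_ge_0|].
rewrite polar_dist_sqr.
rewrite Rpow_mult_distr, pow2_abs.
pose proof (pow2_ge_0 (s - t)). pose proof (pow2_ge_0 (sin ((a - b) / 2))).
assert (m * m <= s * t) by (apply Rmult_le_compat; lra).
nra.
Qed.

Lemma polar_dist_ge_angle (m s a t b : R) : 0 <= m -> m <= s -> m <= t ->
  Rabs (a - b) <= PI -> m / 4 * Rabs (a - b) <= Cmod (polar s a - polar t b).
Proof.
intros Hm Hs Ht Hab.
eapply Rle_trans; [|apply (polar_dist_ge_sin m s a t b); assumption].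
assert (H : Rabs (a - b) / 2 / 4 <= Rabs (sin ((a - b) / 2))).
{ eapply Rle_trans; [apply sin_ge_quarter; pose proof (Rabs_pos (a - b)); lra|].
  unfold Rabs at 1; destruct (Rcase_abs (a - b)).
  - replace (- (a - b) / 2) with (- ((a - b) / 2)) by field.
    rewrite sin_neg, <- Rabs_Ropp; apply Rle_abs.
  - apply Rle_abs. }
nra.
Qed.

Lemma polar_dist_le (s a t b : R) : 0 <= s <= 1 -> 0 <= t <= 1 ->
  Cmod (polar s a - polar t b) <= Rabs (s - t) + Rabs (a - b).
Proof.
intros Hs Ht; apply sqr_le_le.
{ pose proof (Rabs_pos (s - t)); pose proof (Rabs_pos (a - b)); lra. }
rewrite polar_dist_sqr.
assert (S : sin ((a - b) / 2) ^ 2 <= ((a - b) / 2) ^ 2).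
{ rewrite <- (pow2_abs (sin _)), <- (pow2_abs ((a - b) / 2)).
  apply pow_incr; split; [apply Rabs_pos|].
  assert (P : forall x, 0 <= x -> Rabs (sin x) <= x).
  { intros x Hx; destruct (Req_dec x 0) as [->|H0]; [rewrite sin_0, Rabs_R0; lra|].
    destruct (MVT_gen sin 0 x cos) as (c & Hc & E).
    - intros u _; apply is_derive_Reals, derivable_pt_lim_sin.
    - intros u _; apply derivable_continuous_pt, derivable_pt_sin.
    - rewrite sin_0, !Rminus_0_r in E; rewrite E, Rabs_mult, (Rabs_pos_eq x Hx).
      assert (Rabs (cos c) <= 1) by (apply Rabs_le; pose proof (COS_bound c); lra).
      pose proof (Rabs_pos (cos c)); nra. }
  destruct (Rle_dec 0 ((a - b) / 2)) as [H|H].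
  - rewrite (Rabs_pos_eq _ H); apply P, H.
  - rewrite (Rabs_left ((a - b) / 2)) by lra.
    rewrite <- Rabs_Ropp, <- sin_neg; apply P; lra. }
assert (0 <= s * t <= 1) by nra.
assert (E : (Rabs (s - t) + Rabs (a - b)) ^ 2
   = (s - t) ^ 2 + (a - b) ^ 2 + 2 * (Rabs (s - t) * Rabs (a - b))).
{ rewrite <- (pow2_abs (s - t)), <- (pow2_abs (a - b)); ring. }
rewrite E.
assert (0 <= Rabs (s - t) * Rabs (a - b)) by (apply Rmult_le_pos; apply Rabs_pos).
assert (4 * s * t * sin ((a - b) / 2) ^ 2 <= 4 * 1 * ((a - b) / 2) ^ 2).
{ replace (4 * s * t) with (4 * (s * t)) by ring.
  apply Rmult_le_compat; try lra. apply pow2_ge_0. }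
lra.
Qed.

Lemma Omega_neq0 (r alpha : R) (z : C) : 0 < r -> Omega r alpha z -> z <> 0%C.
Proof. intros Hr [Hz _]; apply Cmod_pos_neq0; lra. Qed.

Lemma Omega_Cpower (r alpha : R) (z : C) :
  0 < r < 1 -> 0 < alpha -> Omega r alpha z ->
  open_half_ring (Rpower r alpha) (Cpower z alpha).
Proof.
intros Hr Ha [[H1 H2] [H3 H4]].
apply open_half_ring_polar; [apply exp_pos| |].
- split; [|rewrite <- (Rpower_1_base alpha)]; apply Rlt_Rpower_l; lra.
- split; [apply Rmult_lt_0_compat; assumption|].
  replace PI with (alpha * (PI / alpha)) by (field; lra).
  apply Rmult_lt_compat_l; assumption.
Qed.

Lemma Rpower_lower_lipschitz (r alpha s t : R) :
  0 < r < 1 -> 0 < alpha -> r <= s <= 1 -> r <= t <= 1 ->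
  alpha * Rpower r alpha * Rabs (s - t) <= Rabs (Rpower s alpha - Rpower t alpha).
Proof.
intros Hr Ha Hs Ht.
destruct (Req_dec s t) as [->|Hne].
{ rewrite !Rminus_diag, Rabs_R0; lra. }
destruct (MVT_gen (fun u => Rpower u alpha) t s (fun u => alpha * Rpower u alpha * / u)) as (c & Hc & E).
- intros u Hu; apply is_derive_Rpower.
  assert (r <= Rmin t s) by (apply Rmin_glb; lra). lra.
- intros u Hu.
  assert (r <= Rmin t s) by (apply Rmin_glb; lra).
  apply continuity_pt_filterlim.
  apply (ex_derive_continuous (K := R_AbsRing) (V := R_NormedModule) (fun u => Rpower u alpha)).
  eexists; apply is_derive_Rpower; lra.
- rewrite E, Rabs_mult; apply Rmult_le_compat_r; [apply Rabs_pos|].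
  assert (r <= c <= 1).
  { assert (r <= Rmin t s) by (apply Rmin_glb; lra).
    assert (Rmax t s <= 1) by (apply Rmax_lub; lra). lra. }
  pose proof (Rpower_bounds r alpha c Hr Ha ltac:(lra)) as B.
  assert (1 <= / c) by (rewrite <- Rinv_1; apply Rinv_le_contravar; lra).
  pose proof (exp_pos (alpha * ln r)) as P; fold (Rpower r alpha) in P.
  rewrite Rabs_pos_eq by (repeat apply Rmult_le_pos; lra).
  rewrite (Rmult_assoc alpha (Rpower c alpha)); apply Rmult_le_compat_l; [lra|]. nra.
Qed.

(** Angles in the half ring lie in [0, PI], where chords control them without wrapping round, so the
    distance there controls modulus and argument separately; 5 is 1 for the modulus plus 4 for the
    angle. The converse estimate fails at the slit for alpha = 1/2. *)
Lemma polar_pow_dist (r alpha s phi : R) (z : C) :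
  0 < r < 1 -> 0 < alpha -> Omega r alpha z -> r <= s <= 1 -> 0 <= phi <= PI / alpha ->
  Cmod (polar s phi - z) <= 5 / (alpha * Rpower r alpha) * Cmod (polar_pow s phi alpha - Cpower z alpha).
Proof.
intros Hr Ha Hz Hs Hphi.
destruct (polar_Carg z (Omega_neq0 r alpha z ltac:(lra) Hz)) as [_ E].
destruct Hz as [Hz1 Hz2].
rewrite <- E at 1; unfold Cpower, polar_pow.
set (t := Cmod z) in *. set (psi := Carg z) in *.
pose proof (exp_pos (alpha * ln r)) as P; fold (Rpower r alpha) in P.
pose proof (Rpower_bounds r alpha s Hr Ha Hs) as B1.
pose proof (Rpower_bounds r alpha t Hr Ha ltac:(lra)) as B2.
pose proof (polar_dist_ge_mod (Rpower s alpha) (alpha * phi) (Rpower t alpha) (alpha * psi)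
  ltac:(lra) ltac:(lra)) as D1.
assert (Hang : Rabs (alpha * phi - alpha * psi) = alpha * Rabs (phi - psi)).
{ replace (alpha * phi - alpha * psi) with (alpha * (phi - psi)) by ring.
  rewrite Rabs_mult, Rabs_pos_eq; lra. }
pose proof (polar_dist_ge_angle (Rpower r alpha) (Rpower s alpha) (alpha * phi)
  (Rpower t alpha) (alpha * psi) ltac:(lra) ltac:(lra) ltac:(lra)) as D2.
rewrite Hang in D2.
assert (Hle : alpha * Rabs (phi - psi) <= PI).
{ replace PI with (alpha * (PI / alpha)) by (field; lra).
  apply Rmult_le_compat_l; [lra|]. apply Rabs_le; lra. }
specialize (D2 Hle).
pose proof (Rpower_lower_lipschitz r alpha s t Hr Ha Hs ltac:(lra)) as D3.
pose proof (polar_dist_le s phi t psi ltac:(lra) ltac:(lra)) as D4.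
set (X := Cmod (polar (Rpower s alpha) (alpha * phi) - polar (Rpower t alpha) (alpha * psi))) in *.
assert (Hc : 0 < alpha * Rpower r alpha) by (apply Rmult_lt_0_compat; lra).
apply (Rmult_le_reg_l (alpha * Rpower r alpha)); [exact Hc|].
replace (alpha * Rpower r alpha * (5 / (alpha * Rpower r alpha) * X)) with (5 * X)
  by (field; split; lra).
apply Rle_trans with (alpha * Rpower r alpha * (Rabs (s - t) + Rabs (phi - psi))).
- apply Rmult_le_compat_l; lra.
- nra.
Qed.

Lemma small_sin_half (e x : R) :
  0 <= x < 2 * PI -> sin (x / 2) <= e -> x <= 8 * e \/ 2 * PI - x <= 8 * e.
Proof.
intros Hx He.
destruct (Rle_dec x PI) as [H|H].
- left; pose proof (sin_ge_quarter (x / 2) ltac:(lra)); lra.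
- right; pose proof (sin_ge_quarter (PI - x / 2) ltac:(lra)) as S.
  rewrite sin_PI_x in S; lra.
Qed.

Lemma polar_close_angles (m s a t b : R) :
  0 < m -> m <= s -> m <= t -> Rabs (a - b) < 2 * PI ->
  Rabs (a - b) <= 4 / m * Cmod (polar s a - polar t b) \/
  2 * PI - Rabs (a - b) <= 4 / m * Cmod (polar s a - polar t b).
Proof.
intros Hm Hs Ht Hab.
pose proof (polar_dist_ge_sin m s a t b ltac:(lra) Hs Ht) as D.
set (X := Cmod (polar s a - polar t b)) in *.
replace (4 / m * X) with (8 * (X / (2 * m))) by (field; lra).
apply small_sin_half; [split; [apply Rabs_pos|exact Hab]|].
apply (Rmult_le_reg_l (2 * m)); [lra|].
replace (2 * m * (X / (2 * m))) with X by (field; lra).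
eapply Rle_trans; [|exact D].
apply Rmult_le_compat_l; [lra|].
unfold Rabs at 1; destruct (Rcase_abs (a - b)).
- replace (- (a - b) / 2) with (- ((a - b) / 2)) by field.
  rewrite sin_neg, <- Rabs_Ropp; apply Rle_abs.
- apply Rle_abs.
Qed.

Lemma bdry_half_ring_polar (rho t a : R) :
  0 < rho < 1 -> rho <= t <= 1 -> 0 <= a <= PI -> (t = 1 \/ t = rho \/ a = 0 \/ a = PI) ->
  half_ring_bdry rho (polar t a).
Proof.
intros Hr Ht Ha H; split; [split|].
- rewrite Cmod_polar; lra.
- simpl; apply Rmult_le_pos; [lra|apply sin_ge_0; lra].
- rewrite Cmod_polar by lra.
  destruct H as [H|[H|[H|H]]]; auto; left; subst; simpl; rewrite ?sin_0, ?sin_PI; ring.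
Qed.

Lemma Rpower_cont_at (alpha s : R) : 0 < s -> forall eta, 0 < eta ->
  exists d, 0 < d /\ forall t, Rabs (t - s) < d -> Rabs (Rpower t alpha - Rpower s alpha) < eta.
Proof.
intros Hs eta Heta.
assert (H : continuous (fun t => Rpower t alpha) s).
{ apply (ex_derive_continuous (K := R_AbsRing) (V := R_NormedModule)).
  eexists; apply is_derive_Rpower, Hs. }
destruct (proj1 (filterlim_locally (F := locally s) (fun t => Rpower t alpha) (Rpower s alpha)) H (mkposreal eta Heta)) as [d Hd].
exists d; split; [apply d|exact Hd].
Qed.

(** The boundary point [tau] is allowed to depend on z: at the slit for alpha = 1/2 the same t is
    approached from two sides whose images lie far apart. *)
Lemma Cpower_near_bdry (r alpha : R) (t : C) :
  0 < r < 1 -> 1 / 2 <= alpha -> bdry_Omega r alpha t -> forall eta, 0 < eta ->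
  exists d, 0 < d /\ forall z, Omega r alpha z -> Cmod (z - t) < d ->
    exists tau, half_ring_bdry (Rpower r alpha) tau /\ Cmod (Cpower z alpha - tau) <= eta.
Proof.
intros Hr Ha Ht eta Heta.
assert (Ha0 : 0 < alpha) by lra.
pose proof (Rpower_in_01 r alpha Hr Ha0) as Hrho.
pose proof PI_RGT_0 as Hpi.
assert (Hth : PI / alpha <= 2 * PI).
{ apply (Rmult_le_reg_r alpha); [lra|]. unfold Rdiv; rewrite Rmult_assoc, Rinv_l; nra. }
assert (Hw : forall z, Omega r alpha z ->
   Rpower r alpha <= Rpower (Cmod z) alpha <= 1 /\ 0 <= alpha * Carg z <= PI).
{ intros z [Hz1 Hz2]; split; [apply Rpower_bounds; lra|]. apply arc_angle; lra. }
assert (Harc : forall s phi, s = 1 \/ s = r -> t = polar s phi ->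
  exists d, 0 < d /\ forall z, Omega r alpha z -> Cmod (z - t) < d ->
    exists tau, half_ring_bdry (Rpower r alpha) tau /\ Cmod (Cpower z alpha - tau) <= eta).
{ intros s phi Hs ->.
  destruct (Rpower_cont_at alpha s ltac:(destruct Hs; lra) eta Heta) as (d & Hd & H).
  exists d; split; [exact Hd|]; intros z Hz Hzt.
  destruct (Hw z Hz) as [W1 W2].
  exists (polar (Rpower s alpha) (alpha * Carg z)); split.
  - apply bdry_half_ring_polar; try assumption.
    + destruct Hs; subst s; [rewrite Rpower_1_base|]; lra.
    + destruct Hs; subst s; [rewrite Rpower_1_base|]; auto.
  - unfold Cpower, polar_pow.
    pose proof (polar_dist_sqr (Rpower (Cmod z) alpha) (alpha * Carg z) (Rpower s alpha) (alpha * Carg z)) as E.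
    replace ((alpha * Carg z - alpha * Carg z) / 2) with 0 in E by field.
    rewrite sin_0 in E.
    apply sqr_le_le; [lra|]; rewrite E.
    assert (K : Rabs (Cmod z - s) < d).
    { destruct (polar_Carg z (Omega_neq0 r alpha z ltac:(lra) Hz)) as [_ Ez].
      rewrite <- Ez in Hzt.
      eapply Rle_lt_trans; [|exact Hzt].
      apply polar_dist_ge_mod; [apply Cmod_ge_0|destruct Hs; lra]. }
    specialize (H _ K).
    rewrite <- (pow2_abs (_ - _)).
    pose proof (Rabs_pos (Rpower (Cmod z) alpha - Rpower s alpha)). simpl; nra. }
assert (Hseg : forall s phi, phi = 0 \/ phi = PI / alpha -> r <= s <= 1 -> t = polar s phi ->
  exists d, 0 < d /\ forall z, Omega r alpha z -> Cmod (z - t) < d ->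
    exists tau, half_ring_bdry (Rpower r alpha) tau /\ Cmod (Cpower z alpha - tau) <= eta).
{ intros s phi Hphi Hs ->.
  exists (r * eta / (4 * alpha)); split.
  { apply Rdiv_lt_0_compat; [apply Rmult_lt_0_compat|]; lra. }
  intros z Hz Hzt.
  destruct (Hw z Hz) as [W1 W2].
  destruct (polar_Carg z (Omega_neq0 r alpha z ltac:(lra) Hz)) as [_ Ez].
  destruct Hz as [Hz1 Hz2].
  rewrite <- Ez in Hzt.
  assert (Hab : Rabs (Carg z - phi) < 2 * PI).
  { apply Rabs_lt_between; destruct Hphi; subst phi; lra. }
  assert (Hq : 4 / r * Cmod (polar (Cmod z) (Carg z) - polar s phi) <= eta / alpha).
  { replace (eta / alpha) with (4 / r * (r * eta / (4 * alpha))) by (field; split; lra).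
    apply Rmult_le_compat_l; [left; apply Rdiv_lt_0_compat|]; lra. }
  (* Closeness to t determines the argument modulo 2 PI only. When it wraps round, PI / alpha <= 2
     PI shows that z is near the opposite side. *)
  assert (Hend : Carg z <= eta / alpha \/ PI / alpha - Carg z <= eta / alpha).
  { destruct (polar_close_angles r (Cmod z) (Carg z) s phi ltac:(lra) ltac:(lra) ltac:(lra) Hab) as [D|D];
      assert (D' := Rle_trans _ _ _ D Hq); destruct Hphi; subst phi.
    - left; pose proof (Rle_abs (Carg z - 0)); lra.
    - right; rewrite Rabs_minus_sym in D'; pose proof (Rle_abs (PI / alpha - Carg z)); lra.
    - right; rewrite Rminus_0_r, Rabs_pos_eq in D'; lra.
    - left; rewrite Rabs_minus_sym, Rabs_pos_eq in D'; lra. }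
  assert (Hd : forall b, Cmod (Cpower z alpha - polar (Rpower (Cmod z) alpha) b) <= Rabs (alpha * Carg z - b)).
  { intros b; unfold Cpower, polar_pow.
    eapply Rle_trans; [apply polar_dist_le; lra|].
    rewrite Rminus_diag, Rabs_R0; lra. }
  destruct Hend as [D|D].
  - exists (polar (Rpower (Cmod z) alpha) 0); split.
    + apply bdry_half_ring_polar; try lra; auto.
    + eapply Rle_trans; [apply Hd|]. rewrite Rminus_0_r, Rabs_pos_eq by lra.
      replace eta with (alpha * (eta / alpha)) by (field; lra).
      apply Rmult_le_compat_l; lra.
  - exists (polar (Rpower (Cmod z) alpha) PI); split.
    + apply bdry_half_ring_polar; try lra; auto.
    + eapply Rle_trans; [apply Hd|]. rewrite Rabs_minus_sym, Rabs_pos_eq by lra.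
      replace eta with (alpha * (eta / alpha)) by (field; lra).
      replace PI with (alpha * (PI / alpha)) by (field; lra).
      rewrite <- Rmult_minus_distr_l; apply Rmult_le_compat_l; lra. }
destruct Ht as [(s & Hs & E)|[(phi & Hp & E)|[(s & Hs & E)|(phi & Hp & E)]]].
- apply (Hseg s 0); auto.
- apply (Harc 1 phi); auto.
- apply (Hseg s (PI / alpha)); auto.
- apply (Harc r phi); auto.
Qed.

(** * Complex exponential and logarithm; holomorphy of the power map *)

Definition cexp (l : C) : C := polar (exp (Re l)) (Im l).

Definition clog (z : C) : C := (ln (Cmod z), Carg z).

Lemma cexp_plus (a b : C) : cexp (a + b) = (cexp a * cexp b)%C.
Proof. unfold cexp; rewrite polar_mult, re_plus, im_plus, exp_plus; reflexivity. Qed.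

Lemma cexp_rdiff_0 : rdiff cexp 0 1 0.
Proof.
intros eps Heps.
set (e := Rmin (eps / 10) 1).
assert (He : 0 < e) by (apply Rmin_glb_lt; lra).
assert (He1 : e <= eps / 10) by apply Rmin_l.
assert (He2 : e <= 1) by apply Rmin_r.
destruct (is_derive_lin_approx exp 0 1) with (eps := e) as (d1 & Hd1 & E1); [|exact He|].
{ rewrite <- exp_0; apply is_derive_exp. }
destruct (is_derive_lin_approx sin 0 1) with (eps := e) as (d2 & Hd2 & E2); [|exact He|].
{ rewrite <- cos_0; apply is_derive_sin. }
destruct (is_derive_lin_approx cos 0 0) with (eps := e) as (d3 & Hd3 & E3); [|exact He|].
{ replace 0 with (- sin 0) at 2 by (rewrite sin_0; ring). apply is_derive_cos. }
exists (Rmin (Rmin (e / 2) d1) (Rmin d2 d3)); split; [repeat apply Rmin_glb_lt; lra|].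
intros h Hh.
pose proof (Rmin_l (Rmin (e / 2) d1) (Rmin d2 d3)). pose proof (Rmin_r (Rmin (e / 2) d1) (Rmin d2 d3)).
pose proof (Rmin_l (e / 2) d1). pose proof (Rmin_r (e / 2) d1).
pose proof (Rmin_l d2 d3). pose proof (Rmin_r d2 d3).
pose proof (re_le_Cmod h) as Ha. pose proof (im_le_Cmod h) as Hb.
destruct h as [a b]; simpl Re in *; simpl Im in *.
set (m := Cmod (a, b)) in *.
specialize (E1 a ltac:(lra)). specialize (E2 b ltac:(lra)). specialize (E3 b ltac:(lra)).
rewrite !Rplus_0_l, exp_0 in E1. rewrite !Rplus_0_l, sin_0 in E2. rewrite !Rplus_0_l, cos_0 in E3.
rewrite Rmult_0_l, Rminus_0_r in E3. rewrite Rmult_1_l in E1, E2. rewrite Rminus_0_r in E2.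
pose proof (Rabs_pos a) as Pa. pose proof (Rabs_pos b) as Pb.
assert (F1 : Rabs (exp a - 1) <= 2 * Rabs a).
{ replace (exp a - 1) with ((exp a - 1 - a) + a) by ring.
  eapply Rle_trans; [apply Rabs_triang|]; nra. }
assert (F2 : exp a <= 2).
{ pose proof (Rle_abs (exp a - 1)); lra. }
pose proof (exp_pos a) as Pe.
eapply Rle_trans; [apply Cmod_le_abs_Re_Im|].
replace (Re (cexp (0 + (a, b)) - cexp 0 - (1 * (a, b) + 0 * Cconj (a, b))))
  with ((exp a - 1 - a) + exp a * (cos b - 1))
  by (unfold cexp, polar; simpl; rewrite !Rplus_0_l, exp_0, cos_0; ring).
replace (Im (cexp (0 + (a, b)) - cexp 0 - (1 * (a, b) + 0 * Cconj (a, b))))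
  with (exp a * (sin b - b) + (exp a - 1) * b)
  by (unfold cexp, polar; simpl; rewrite !Rplus_0_l, exp_0, sin_0; ring).
pose proof (Rabs_triang (exp a - 1 - a) (exp a * (cos b - 1))) as T1.
pose proof (Rabs_triang (exp a * (sin b - b)) ((exp a - 1) * b)) as T2.
rewrite !Rabs_mult, (Rabs_pos_eq (exp a)) in T1, T2 by lra.
assert (G1 : exp a * Rabs (cos b - 1) <= 2 * (e * Rabs b)).
{ apply Rmult_le_compat; try lra; apply Rabs_pos. }
assert (G2 : exp a * Rabs (sin b - b) <= 2 * (e * Rabs b)).
{ apply Rmult_le_compat; try lra; apply Rabs_pos. }
assert (G3 : Rabs (exp a - 1) * Rabs b <= e * Rabs b).
{ apply Rmult_le_compat_r; lra. }
assert (e * Rabs a <= e * m) by (apply Rmult_le_compat_l; lra).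
assert (e * Rabs b <= e * m) by (apply Rmult_le_compat_l; lra).
assert (10 * e * m <= eps * m) by (apply Rmult_le_compat_r; lra).
rewrite (Rabs_mult (exp a - 1) b) in T2.
assert (0 <= e * m) by (apply Rmult_le_pos; lra).
lra.
Qed.

Lemma cexp_rdiff (l : C) : rdiff cexp l (cexp l) 0.
Proof.
eapply rdiff_ext; [intros y; symmetry|].
- replace y with (l + (y - l))%C at 1 by ring. apply cexp_plus.
- eapply rdiff_eq; [apply (rdiff_scal (cexp l) (fun y => cexp (y - l)))|apply Cmult_1_r|apply Cmult_0_r].
  intros eps Heps; destruct (cexp_rdiff_0 eps Heps) as (d & Hd & H).
  exists d; split; [exact Hd|]; intros h Hh; specialize (H h Hh).
  replace (l + h - l)%C with (0 + h)%C by ring; replace (l - l)%C with (RtoC 0) by ring.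
  exact H.
Qed.

(* A continuous right inverse of a map with nonzero derivative is
   differentiable. This avoids the case distinction in [Carg]. *)
Lemma rdiff_inverse (f g : C -> C) (z L : C) (d0 : R) :
  0 < d0 -> (forall h, Cmod h < d0 -> f (g (z + h)%C) = (z + h)%C) ->
  (forall eta, 0 < eta -> exists d, 0 < d /\ forall h, Cmod h < d ->
     Cmod (g (z + h)%C - g z) < eta) ->
  L <> 0%C -> rdiff f (g z) L 0 -> rdiff g z (/ L) 0.
Proof.
intros Hd0 Hinv Hc HL Hf eps Heps.
pose proof (proj1 (Cmod_gt_0 L) HL) as HLp.
set (m := Cmod L) in *.
set (e1 := Rmin (m / 2) (eps * m ^ 2 / 2)).
assert (Hm2 : 0 < m ^ 2) by (apply pow_lt, HLp).
assert (He1 : 0 < e1).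
{ apply Rmin_glb_lt; [lra|]. assert (0 < eps * m ^ 2) by (apply Rmult_lt_0_compat; lra). lra. }
destruct (Hf e1 He1) as (d1 & Hd1 & F).
destruct (Hc d1 Hd1) as (d2 & Hd2 & G).
exists (Rmin d0 d2); split; [apply Rmin_glb_lt; assumption|].
intros h Hh.
pose proof (Rlt_le_trans _ _ _ Hh (Rmin_l _ _)) as Hh1.
pose proof (Rlt_le_trans _ _ _ Hh (Rmin_r _ _)) as Hh2.
specialize (G h Hh2).
set (k := (g (z + h) - g z)%C) in *.
specialize (F k G).
replace (g z + k)%C with (g (z + h)%C) in F by (unfold k; ring).
assert (Hz0 : f (g z) = z).
{ pose proof (Hinv 0%C) as E; rewrite Cmod_0, Cplus_0_r in E; exact (E Hd0). }
rewrite (Hinv h Hh1), Hz0 in F.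
replace (z + h - z - (L * k + 0 * Cconj k))%C with (L * (/ L * h - k))%C in F by (field; exact HL).
rewrite Cmod_mult in F; fold m in F.
assert (E : Cmod (/ L * h) = Cmod h / m).
{ rewrite Cmod_mult, Cmod_inv by exact HL; unfold m, Rdiv; ring. }
pose proof (Cmod_ge_0 k) as Pk. pose proof (Cmod_ge_0 h) as Ph.
pose proof (Rmin_l (m / 2) (eps * m ^ 2 / 2)) as M1. pose proof (Rmin_r (m / 2) (eps * m ^ 2 / 2)) as M2.
fold e1 in M1, M2.
pose proof (Cmod_sub_le k (/ L * h)) as T.
rewrite Cmod_sub_sym, E in T.
assert (T2 : Cmod (/ L * h - k) <= Cmod k / 2).
{ apply (Rmult_le_reg_l m); [exact HLp|]. nra. }
assert (Hk : Cmod k <= 2 * (Cmod h / m)) by lra.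
replace (k - (/ L * h + 0 * Cconj h))%C with (- (/ L * h - k))%C by ring.
rewrite Cmod_opp.
apply (Rmult_le_reg_l m); [exact HLp|].
eapply Rle_trans; [exact F|].
apply Rle_trans with (eps * m ^ 2 / 2 * (2 * (Cmod h / m))).
- apply Rmult_le_compat; lra.
- right; field; lra.
Qed.

Lemma cexp_clog (z : C) : z <> 0%C -> cexp (clog z) = z.
Proof.
intros Hz; unfold cexp, clog; simpl.
rewrite exp_ln by (apply Cmod_gt_0, Hz); apply polar_Carg, Hz.
Qed.

Lemma Cpower_cexp (z : C) (b : R) : Cpower z b = cexp (b * clog z).
Proof.
unfold Cpower, polar_pow, cexp, clog, Rpower; rewrite re_scal_l, im_scal_l; reflexivity.
Qed.

Lemma clog_continuous (z : C) :
  z <> 0%C -> 0 < Carg z -> forall eta, 0 < eta -> exists d, 0 < d /\ forall h, Cmod h < d ->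
    Cmod (clog (z + h)%C - clog z) < eta.
Proof.
intros Hz Harg eta Heta.
pose proof (proj1 (Cmod_gt_0 z) Hz) as Hm.
destruct (polar_Carg z Hz) as [Hr Ez].
set (m := Cmod z) in *.
assert (Hln : continuous ln m) by (apply (ex_derive_continuous (K := R_AbsRing) (V := R_NormedModule)); eexists; apply is_derive_ln, Hm).
destruct (proj1 (filterlim_locally (F := locally m) ln (ln m)) Hln (mkposreal (eta / 2) ltac:(lra)))
  as [d1 Hd1].
set (a0 := Carg z) in *.
(* The second entry keeps the argument a0 at distance at least 2 x from 0 and from 2 PI, which rules
   out a jump across the cut. *)
set (x := Rmin (eta / 4) (Rmin a0 (2 * PI - a0) / 2)).
assert (Hx : 0 < x).
{ assert (0 < Rmin a0 (2 * PI - a0)) by (apply Rmin_glb_lt; lra).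
  apply Rmin_glb_lt; lra. }
exists (Rmin (m / 2) (Rmin d1 (x * m / 8))); split.
{ repeat apply Rmin_glb_lt; [lra|apply d1|]. assert (0 < x * m) by (apply Rmult_lt_0_compat; lra). lra. }
intros h Hh.
pose proof (Rlt_le_trans _ _ _ Hh (Rmin_l _ _)) as Hh1.
pose proof (Rlt_le_trans _ _ _ Hh (Rmin_r _ _)) as Hh2.
pose proof (Rlt_le_trans _ _ _ Hh2 (Rmin_l _ _)) as Hh3.
pose proof (Rlt_le_trans _ _ _ Hh2 (Rmin_r _ _)) as Hh4.
pose proof (Cmod_triangle z h) as T1.
pose proof (Cmod_sub_le z (- h)) as T2; rewrite Cmod_opp in T2.
replace (z - - h)%C with (z + h)%C in T2 by ring.
fold m in T1, T2.
assert (Hzh : (z + h <> 0)%C) by (apply Cmod_pos_neq0; lra).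
destruct (polar_Carg _ Hzh) as [Hr2 Ez2].
assert (L1 : Rabs (ln (Cmod (z + h)) - ln m) < eta / 2).
{ apply Hd1; change (Rabs (Cmod (z + h) - m) < d1). apply Rabs_lt_between'; lra. }
assert (D : Cmod (polar (Cmod (z + h)) (Carg (z + h)) - polar m a0) = Cmod h).
{ rewrite Ez, Ez2; f_equal; ring. }
assert (Hab : Rabs (Carg (z + h) - a0) < 2 * PI) by (apply Rabs_lt_between; lra).
assert (Hq : 4 / (m / 2) * Cmod h < x).
{ replace x with (4 / (m / 2) * (x * m / 8)) by (field; lra).
  apply Rmult_lt_compat_l; [apply Rdiv_lt_0_compat|]; lra. }
pose proof (Rmin_l (eta / 4) (Rmin a0 (2 * PI - a0) / 2)) as X1.
pose proof (Rmin_r (eta / 4) (Rmin a0 (2 * PI - a0) / 2)) as X2.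
fold x in X1, X2.
pose proof (Rmin_l a0 (2 * PI - a0)) as X3. pose proof (Rmin_r a0 (2 * PI - a0)) as X4.
assert (L2 : Rabs (Carg (z + h) - a0) < eta / 2).
{ destruct (polar_close_angles (m / 2) (Cmod (z + h)) (Carg (z + h)) m a0
    ltac:(lra) ltac:(lra) ltac:(lra) Hab) as [K|K]; rewrite D in K; [lra|exfalso].
  assert (Rabs (Carg (z + h) - a0) <= 2 * PI - 2 * x) by (apply Rabs_le; lra).
  lra. }
eapply Rle_lt_trans; [apply Cmod_le_abs_Re_Im|].
rewrite re_minus, im_minus; unfold clog; simpl; fold m a0; lra.
Qed.

Lemma Cpower_rdiff (r alpha : R) (z : C) :
  0 < r < 1 -> Omega r alpha z -> exists A, rdiff (fun y => Cpower y alpha) z A 0.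
Proof.
intros Hr Hz.
pose proof (Omega_neq0 r alpha z ltac:(lra) Hz) as Hz0.
pose proof (proj1 (Cmod_gt_0 z) Hz0) as Hm.
assert (Hlog : rdiff clog z (/ z) 0).
{ apply (rdiff_inverse cexp clog z z (Cmod z)); try assumption.
  - intros h Hh; apply cexp_clog, Cmod_pos_neq0.
    pose proof (Cmod_sub_le z (- h)) as T2; rewrite Cmod_opp in T2.
    replace (z - - h)%C with (z + h)%C in T2 by ring; lra.
  - apply clog_continuous; [exact Hz0|apply Hz].
  - rewrite <- (cexp_clog z Hz0) at 2; apply cexp_rdiff. }
exists (cexp (alpha * clog z) * (alpha * / z))%C.
apply (rdiff_ext (fun y => cexp (alpha * clog y))); [intros y; symmetry; apply Cpower_cexp|].
apply (rdiff_comp cexp (fun y => alpha * clog y)%C).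
- eapply rdiff_eq; [apply (rdiff_scal alpha _ _ _ _ Hlog)|reflexivity|ring].
- apply cexp_rdiff.
Qed.

(** * The poly-Schwarz operator *)

Lemma Rpower_q_pow (r alpha : R) (m : nat) :
  0 < r -> Rpower r (2 * alpha * INR m) = (Rpower r alpha ^ 2) ^ m.
Proof.
intros Hr.
rewrite <- pow_mult, <- Rpower_pow by apply exp_pos.
rewrite Rpower_mult, mult_INR; f_equal; simpl; ring.
Qed.

Lemma regular_neqs (q d : R) (u : C) :
  0 < d -> regular q d u ->
  (u - 1 <> 0)%C /\ (1 - u <> 0)%C /\ forall n, (RtoC (q ^ S n) * u - 1 <> 0)%C /\ (RtoC (q ^ S n) - u <> 0)%C.
Proof.
intros Hd [H1 H2].
pose proof (proj1 (Cinv_bound d _ Hd H1)) as N1.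
split; [exact N1|split].
- intros E; apply N1; replace (u - 1)%C with (- (1 - u))%C by ring; rewrite E; ring.
- intros n; destruct (H2 n) as [A B]; split; apply (Cinv_bound d); assumption.
Qed.

(** Every fraction in [H1] is homogeneous of degree 0 in w and zeta, hence a function of w / zeta or
    of w / Cconj zeta, and these pair up into two Villat series. *)
Lemma H1_Kv (r alpha d : R) (w u v zeta : C) :
  0 < r < 1 -> 0 < alpha -> 0 < d -> w <> 0%C -> zeta <> 0%C ->
  w = (u * Cconj zeta)%C -> w = (v * zeta)%C ->
  regular (Rpower r alpha ^ 2) d u -> regular (Rpower r alpha ^ 2) d v ->
  H1 r alpha w zeta = (Kv (Rpower r alpha ^ 2) u - Kv (Rpower r alpha ^ 2) v)%C.
Proof.
intros Hr Ha Hd Hw Hz Hu Hv Ru Rv.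
pose proof (sqr_lt_1 _ (Rpower_in_01 r alpha Hr Ha)) as Hq.
set (q := Rpower r alpha ^ 2) in *.
destruct (regular_neqs q d u Hd Ru) as (U1 & U2 & U3).
destruct (regular_neqs q d v Hd Rv) as (V1 & V2 & V3).
assert (Hzc : Cconj zeta <> 0%C).
{ intros E; apply Hz; rewrite <- (Cconj_conj zeta), E.
  apply injective_projections; simpl; ring. }
unfold H1, Kv.
rewrite (CSeries_ext _ (fun m => kterm (q ^ S m) u - kterm (q ^ S m) v)%C).
- rewrite (CSeries_minus _ _ q _ _ Hq (ktail_dom q d u Hq Hd (proj2 Ru)) (ktail_dom q d v Hq Hd (proj2 Rv))).
  fold (ktail q u) (ktail q v).
  replace ((zeta + w) / (zeta - w))%C with (- ((v + 1) / (v - 1)))%C.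
  + replace ((Cconj zeta + w) / (Cconj zeta - w))%C with (- ((u + 1) / (u - 1)))%C; [ring|].
    rewrite Hu; replace (Cconj zeta - u * Cconj zeta)%C with ((1 - u) * Cconj zeta)%C by ring.
    field; repeat split; assumption.
  + rewrite Hv; replace (zeta - v * zeta)%C with ((1 - v) * zeta)%C by ring.
    field; repeat split; assumption.
- intros m; cbv zeta; rewrite Rpower_q_pow by lra; fold q.
  destruct (U3 m) as [U4 U5], (V3 m) as [V4 V5].
  set (p := RtoC (q ^ S m)) in *.
  unfold kterm; fold p.
  replace (zeta / (p * zeta - w))%C with (1 / (p - v))%C
    by (rewrite Hv; replace (p * zeta - v * zeta)%C with ((p - v) * zeta)%C by ring;
        field; repeat split; assumption).
  replace (w / (p * w - zeta))%C with (v / (p * v - 1))%C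
    by (rewrite Hv; replace (p * (v * zeta) - zeta)%C with ((p * v - 1) * zeta)%C by ring;
        field; repeat split; assumption).
  replace (Cconj zeta / (p * Cconj zeta - w))%C with (1 / (p - u))%C
    by (rewrite Hu; replace (p * Cconj zeta - u * Cconj zeta)%C with ((p - u) * Cconj zeta)%C by ring;
        field; repeat split; assumption).
  replace (w / (p * w - Cconj zeta))%C with (u / (p * u - 1))%C
    by (rewrite Hu; replace (p * (u * Cconj zeta) - Cconj zeta)%C with ((p * u - 1) * Cconj zeta)%C by ring;
        field; repeat split; assumption).
  field; repeat split; assumption.
Qed.

(** After multiplication by x every fraction depends on x w or w / x only. The constant comes from 2
    / (1 - v) = 1 - (v + 1) / (v - 1) and - 2 u / (1 - u) = 1 + (u + 1) / (u - 1). *)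
Lemma H2_Kv (r alpha d x : R) (w u v : C) :
  0 < r < 1 -> 0 < alpha -> 0 < d -> x <> 0 ->
  u = (x * w)%C -> w = (v * x)%C ->
  regular (Rpower r alpha ^ 2) d u -> regular (Rpower r alpha ^ 2) d v ->
  (2 * (x * H2 r alpha w x) = Kv (Rpower r alpha ^ 2) u - Kv (Rpower r alpha ^ 2) v + 2)%C.
Proof.
intros Hr Ha Hd Hx Hu Hv Ru Rv.
pose proof (sqr_lt_1 _ (Rpower_in_01 r alpha Hr Ha)) as Hq.
set (q := Rpower r alpha ^ 2) in *.
destruct (regular_neqs q d u Hd Ru) as (U1 & U2 & U3).
destruct (regular_neqs q d v Hd Rv) as (V1 & V2 & V3).
assert (HxC : RtoC x <> 0%C) by (intros E; apply Hx, RtoC_inj, E).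
assert (Du := ktail_dom q d u Hq Hd (proj2 Ru)).
assert (Dv := ktail_dom q d v Hq Hd (proj2 Rv)).
unfold H2, Kv.
rewrite (CSeries_ext _ (fun m => / x * (kterm (q ^ S m) u + (-1) * kterm (q ^ S m) v))%C).
- rewrite (CSeries_scal _ q _ _ Hq (geom_dom_plus _ _ q _ _ Du (geom_dom_scal _ q (-1) _ Dv))).
  rewrite (CSeries_plus _ _ q _ _ Hq Du (geom_dom_scal _ q (-1) _ Dv)).
  rewrite (CSeries_scal _ q _ _ Hq Dv).
  fold (ktail q u) (ktail q v).
  replace (1 - w * x)%C with (1 - u)%C by (rewrite Hu; ring).
  replace (x - w)%C with ((1 - v) * x)%C by (rewrite Hv; ring).
  replace (x * (1 / ((1 - v) * x) - w / (1 - u)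
      + / x * (ktail q u + -1 * ktail q v)))%C
    with (1 / (1 - v) - u / (1 - u) + (ktail q u - ktail q v))%C
    by (rewrite Hu; rewrite Hu in U2; field; repeat split; assumption).
  field; repeat split; assumption.
- intros m; cbv zeta; rewrite Rpower_q_pow by lra; fold q.
  destruct (U3 m) as [U4 U5], (V3 m) as [V4 V5].
  set (p := RtoC (q ^ S m)) in *.
  unfold kterm; fold p.
  replace (p - w * x)%C with (p - u)%C by (rewrite Hu; ring).
  replace (p * w * x - 1)%C with (p * u - 1)%C by (rewrite Hu; ring).
  replace (p * x - w)%C with ((p - v) * x)%C by (rewrite Hv; ring).
  replace (p * w - x)%C with ((p * v - 1) * x)%C by (rewrite Hv; ring).
  replace (w / (x * ((p * v - 1) * x)))%C with (v / (x * (p * v - 1)))%C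
    by (rewrite Hv; field; repeat split; assumption).
  replace (w / (p * u - 1))%C with (u / (x * (p * u - 1)))%C
    by (rewrite Hu; rewrite Hu in U4; field; repeat split; assumption).
  field; repeat split; assumption.
Qed.

Definition Schwarz_z (r alpha : R) (g : R -> R -> R) (z : C) : C :=
  (RtoC alpha / (2 * PI * Ci) *
     int_arcs r alpha (fun s phi => RtoC (g s phi) *
       H1 r alpha (Cpower z alpha) (polar_pow s phi alpha) / polar s phi)
   + RtoC alpha / (PI * Ci) *
     int_segments r alpha (fun s phi => RtoC (g s phi) *
       H2 r alpha (Cpower z alpha) (polar_pow s phi alpha) * polar_pow s phi (alpha - 1)))%C.

Lemma polar_neq0 (s a : R) : 0 < s -> polar s a <> 0%C.
Proof. intros Hs; apply Cmod_pos_neq0; rewrite Cmod_polar; lra. Qed.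

(** On a circular arc dzeta = i zeta dtau, which cancels the division by zeta. *)
Lemma arc_integrand (r alpha sig s tau c : R) (w : C) :
  0 < r < 1 -> 0 < alpha -> open_half_ring (Rpower r alpha) w ->
  sig = 1 /\ s = 1 \/ sig = / Rpower r alpha /\ s = r -> 0 <= tau <= PI / alpha ->
  (RtoC c * H1 r alpha w (polar_pow s tau alpha) / polar s tau * (Ci * polar s tau)
   = Ci * (RtoC c * pair_kernel (Rpower r alpha ^ 2) (polar sig (alpha * tau))
       (polar sig (- (alpha * tau))) 0 w))%C.
Proof.
intros Hr Ha Hw Hs Ht.
pose proof (Rpower_in_01 r alpha Hr Ha) as Hrho.
assert (Hsig : sig = 1 \/ sig = / Rpower r alpha) by (destruct Hs as [[]|[]]; auto).
assert (Hs0 : 0 < s) by (destruct Hs as [[_ ->]|[_ ->]]; lra).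
assert (Hsp : 0 < sig) by (destruct Hsig; subst sig; [lra|apply Rinv_0_lt_compat; lra]).
assert (Hp : Rpower s alpha = / sig).
{ destruct Hs as [[-> ->]|[-> ->]]; [rewrite Rpower_1_base, Rinv_1|rewrite Rinv_inv]; reflexivity. }
destruct (arc_regular_at _ sig (alpha * tau) w Hrho Hw Hsig (arc_sin alpha tau Ha Ht)) as [R1 R2].
assert (Hsi : sig * / sig = 1) by (field; lra).
rewrite (H1_Kv r alpha (sep_const (Rpower r alpha) (gap (Rpower r alpha) w / 2)) w
  (polar sig (alpha * tau) * w) (polar sig (- (alpha * tau)) * w)); try assumption.
- unfold pair_kernel; pose proof (polar_neq0 s tau Hs0); field; assumption.
- apply sep_const_pos; [exact Hrho|]. pose proof (gap_pos _ w Hw); lra.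
- apply (open_half_ring_neq0 (Rpower r alpha)); [lra|exact Hw].
- apply polar_neq0, exp_pos.
- unfold polar_pow; rewrite Hp, Cconj_polar.
  rewrite (Cmult_comm _ w), <- Cmult_assoc, polar_mult, Hsi, Rplus_opp_r, polar_0; ring.
- unfold polar_pow; rewrite Hp.
  rewrite (Cmult_comm _ w), <- Cmult_assoc, polar_mult, Hsi, Rplus_opp_l, polar_0; ring.
Qed.

(** On both segments alpha phi is 0 or PI, so zeta^(alpha - 1) dzeta equals x ds / s with x real;
    the factor x is the one that [H2_Kv] asks for. *)
Lemma seg_integrand (r alpha eps phi s c : R) (w : C) :
  0 < r < 1 -> 0 < alpha -> open_half_ring (Rpower r alpha) w ->
  eps = -1 /\ phi = PI / alpha \/ eps = 1 /\ phi = 0 -> r <= s <= 1 ->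
  (RtoC c * H2 r alpha w (polar_pow s phi alpha) * polar_pow s phi (alpha - 1) * polar 1 phi
   = / 2 * (RtoC (c * / s) * pair_kernel (Rpower r alpha ^ 2) (RtoC (eps * Rpower s alpha))
       (RtoC (/ (eps * Rpower s alpha))) 2 w))%C.
Proof.
intros Hr Ha Hw He Hs.
pose proof (Rpower_in_01 r alpha Hr Ha) as Hrho.
assert (Hp : 0 < Rpower s alpha) by apply exp_pos.
assert (Heps : eps = 1 \/ eps = -1) by (destruct He as [[]|[]]; auto).
set (x := eps * Rpower s alpha).
assert (Hx0 : x <> 0) by (unfold x; destruct Heps; subst eps; lra).
assert (HxC : RtoC x <> 0%C) by (intros E; apply Hx0, RtoC_inj, E).
assert (Hom : polar_pow s phi alpha = RtoC x).
{ unfold polar_pow, x; destruct He as [[-> ->]|[-> ->]].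
  - replace (alpha * (PI / alpha)) with PI by (field; lra).
    rewrite polar_PI; f_equal; ring.
  - rewrite Rmult_0_r, polar_0; f_equal; ring. }
assert (Hdz : (polar_pow s phi (alpha - 1) * polar 1 phi = RtoC (x * / s))%C).
{ assert (Hs1 : Rpower s (alpha - 1) = Rpower s alpha * / s).
  { unfold Rminus; rewrite Rpower_plus, Rpower_Ropp, Rpower_1 by lra; reflexivity. }
  unfold polar_pow, x; rewrite polar_mult, Hs1; destruct He as [[-> ->]|[-> ->]].
  - replace ((alpha - 1) * (PI / alpha) + PI / alpha) with PI by (field; lra).
    rewrite polar_PI; f_equal; ring.
  - rewrite Rmult_0_r, Rplus_0_l, polar_0; f_equal; ring. }
destruct (seg_regular_at _ x w Hrho Hw (seg_abs r alpha eps s Hr Ha Heps Hs)) as [R1 R2].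
assert (K := H2_Kv r alpha (sep_const (Rpower r alpha) (gap (Rpower r alpha) w / 2)) x w
  (x * w)%C (RtoC (/ x) * w)%C Hr Ha).
rewrite Hom, <- Cmult_assoc, Hdz.
unfold pair_kernel; rewrite <- K; try assumption.
- rewrite !RtoC_mult; field.
- apply sep_const_pos; [exact Hrho|]. pose proof (gap_pos _ w Hw); lra.
- reflexivity.
- rewrite RtoC_inv by exact Hx0; field; exact HxC.
Qed.

(** The minus signs come from the inner arc and the segment of argument PI / alpha, which are run in
    decreasing parameter, and the factor i on the segments from 1 / i = - i. *)
Lemma Schwarz_z_w (r alpha : R) (g : R -> R -> R) (z : C) :
  0 < r < 1 -> 0 < alpha -> data_ok r alpha g -> Omega r alpha z ->
  Schwarz_z r alpha g z = Schwarz_w r alpha g (Cpower z alpha).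
Proof.
intros Hr Ha (G1 & G2 & G3 & G4) Hz.
pose proof (Omega_Cpower r alpha z Hr Ha Hz) as Hw.
pose proof (theta_pos alpha Ha) as Hth.
set (w := Cpower z alpha) in *.
pose proof (arc_int_ex r alpha 1 _ w Hr Ha (or_introl eq_refl) G1 Hw) as X1.
pose proof (arc_int_ex r alpha _ _ w Hr Ha (or_intror eq_refl) G2 Hw) as X2.
pose proof (seg_int_ex r alpha _ _ w Hr Ha (or_intror eq_refl) G3 Hw) as X3.
pose proof (seg_int_ex r alpha _ _ w Hr Ha (or_introl eq_refl) G4 Hw) as X4.
assert (EA : int_arcs r alpha (fun s phi => RtoC (g s phi) *
       H1 r alpha w (polar_pow s phi alpha) / polar s phi)%C
   = (Ci * (arc_int r alpha 1 (g 1%R) w - arc_int r alpha (/ Rpower r alpha) (g r) w))%C).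
{ unfold int_arcs.
  rewrite (CRInt_swap _ 0 (PI / alpha)).
  - rewrite (CRInt_ext _ _ 0 (PI / alpha) (Rlt_le _ _ Hth) (fun tau Ht =>
      arc_integrand r alpha 1 1 tau (g 1 tau) w Hr Ha Hw (or_introl (conj eq_refl eq_refl)) Ht)).
    rewrite (CRInt_ext _ _ 0 (PI / alpha) (Rlt_le _ _ Hth) (fun tau Ht =>
      arc_integrand r alpha _ r tau (g r tau) w Hr Ha Hw (or_intror (conj eq_refl eq_refl)) Ht)).
    rewrite !CRInt_scal by assumption.
    unfold arc_int; ring.
  - apply (ex_CRInt_ext _ _ 0 (PI / alpha) (Rlt_le _ _ Hth) (fun tau Ht => eq_sym
      (arc_integrand r alpha _ r tau (g r tau) w Hr Ha Hw (or_intror (conj eq_refl eq_refl)) Ht))).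
    apply ex_CRInt_scal, X2. }
assert (Hr1 : r <= 1) by lra.
assert (ES : int_segments r alpha (fun s phi => RtoC (g s phi) *
       H2 r alpha w (polar_pow s phi alpha) * polar_pow s phi (alpha - 1))%C
   = (/ 2 * (seg_int r alpha 1 (fun s => g s 0%R) w - seg_int r alpha (-1) (fun s => g s (PI / alpha)%R) w))%C).
{ unfold int_segments.
  rewrite (CRInt_swap _ r 1).
  - rewrite (CRInt_ext _ _ r 1 Hr1 (fun s Hs =>
      seg_integrand r alpha _ _ s (g s (PI / alpha)) w Hr Ha Hw (or_introl (conj eq_refl eq_refl)) Hs)).
    rewrite (CRInt_ext _ _ r 1 Hr1 (fun s Hs =>
      seg_integrand r alpha _ _ s (g s 0) w Hr Ha Hw (or_intror (conj eq_refl eq_refl)) Hs)).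
    rewrite !CRInt_scal by assumption.
    unfold seg_int; ring.
  - apply (ex_CRInt_ext _ _ r 1 Hr1 (fun s Hs => eq_sym
      (seg_integrand r alpha _ _ s (g s (PI / alpha)) w Hr Ha Hw (or_introl (conj eq_refl eq_refl)) Hs))).
    apply ex_CRInt_scal, X3. }
unfold Schwarz_z; fold w; rewrite EA, ES; unfold Schwarz_w.
pose proof PI_RGT_0 as Hpi.
assert (HpC : RtoC PI <> 0%C) by (intros F; apply RtoC_inj in F; lra).
assert (HCi : Ci <> 0%C) by (intros F; apply (f_equal snd) in F; simpl in F; lra).
rewrite RtoC_div, RtoC_mult by lra.
generalize (arc_int r alpha 1 (g 1) w) (arc_int r alpha (/ Rpower r alpha) (g r) w)
  (seg_int r alpha 1 (fun s => g s 0) w) (seg_int r alpha (-1) (fun s => g s (PI / alpha)) w).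
intros a b c d.
assert (HI : (/ Ci = - Ci)%C) by apply Ci_inv.
replace (RtoC alpha / (PI * Ci) * (/ 2 * (c - d)))%C
  with (RtoC alpha / (2 * PI) * (/ Ci * (c - d)))%C.
2:{ field; repeat split; try assumption. }
rewrite HI.
field; repeat split; try assumption.
Qed.

(** * Moments of the Schwarz integral and their conjugate derivatives *)

Lemma data_ok_ext (r alpha : R) (g h : R -> R -> R) :
  (forall s phi, g s phi = h s phi) -> data_ok r alpha g -> data_ok r alpha h.
Proof.
intros E; replace h with g; [auto|].
apply functional_extensionality; intros s; apply functional_extensionality; intros phi; apply E.
Qed.

Lemma data_ok_mult (r alpha : R) (g h : R -> R -> R) :
  data_ok r alpha g -> data_ok r alpha h -> data_ok r alpha (fun s phi => g s phi * h s phi).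
Proof.
intros (G1 & G2 & G3 & G4) (F1 & F2 & F3 & F4).
exact (conj (cont_ext_mult _ _ _ _ G1 F1) (conj (cont_ext_mult _ _ _ _ G2 F2)
  (conj (cont_ext_mult _ _ _ _ G3 F3) (cont_ext_mult _ _ _ _ G4 F4)))).
Qed.

Lemma data_ok_Re (r alpha a b : R) :
  data_ok r alpha (fun s phi => a * Re (polar s phi) + b).
Proof.
unfold polar; simpl.
split; [|split; [|split]]; apply cont_ext_continuous; intros t;
  apply (ex_derive_continuous (K := R_AbsRing) (V := R_NormedModule)); auto_derive; trivial.
Qed.

Lemma data_ok_pow (r alpha : R) (g : R -> R -> R) (m : nat) :
  data_ok r alpha g -> data_ok r alpha (fun s phi => g s phi ^ m).
Proof.
intros Hg; induction m as [|m IH]; [apply data_ok_one|].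
apply (data_ok_mult r alpha g _ Hg IH).
Qed.

Lemma Schwarz_w_lin (r alpha c : R) (g h : R -> R -> R) (w : C) :
  0 < r < 1 -> 0 < alpha -> data_ok r alpha g -> data_ok r alpha h ->
  open_half_ring (Rpower r alpha) w ->
  Schwarz_w r alpha (fun s phi => g s phi - c * h s phi) w
    = (Schwarz_w r alpha g w + (-1) * (RtoC c * Schwarz_w r alpha h w))%C.
Proof.
intros Hr Ha (G1 & G2 & G3 & G4) (F1 & F2 & F3 & F4) Hw.
assert (KA : forall sig f1 f2, sig = 1 \/ sig = / Rpower r alpha ->
  cont_ext 0 (PI / alpha) f1 -> cont_ext 0 (PI / alpha) f2 ->
  arc_int r alpha sig (fun t => f1 t - c * f2 t) w
   = (arc_int r alpha sig f1 w + (- c) * arc_int r alpha sig f2 w)%C).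
{ intros sig f1 f2 Hs X Y.
  pose proof (arc_int_ex r alpha sig f1 w Hr Ha Hs X Hw) as E1.
  pose proof (arc_int_ex r alpha sig f2 w Hr Ha Hs Y Hw) as E2.
  unfold arc_int at 2 3; rewrite <- CRInt_scal by exact E2.
  rewrite <- CRInt_plus by (try exact E1; apply ex_CRInt_scal, E2).
  unfold arc_int; f_equal; apply functional_extensionality; intros t.
  rewrite RtoC_minus, RtoC_mult; ring. }
assert (KS : forall eps f1 f2, eps = 1 \/ eps = -1 ->
  cont_ext r 1 f1 -> cont_ext r 1 f2 ->
  seg_int r alpha eps (fun t => f1 t - c * f2 t) w
   = (seg_int r alpha eps f1 w + (- c) * seg_int r alpha eps f2 w)%C).
{ intros eps f1 f2 Hs X Y.
  pose proof (seg_int_ex r alpha eps f1 w Hr Ha Hs X Hw) as E1.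
  pose proof (seg_int_ex r alpha eps f2 w Hr Ha Hs Y Hw) as E2.
  unfold seg_int at 2 3; rewrite <- CRInt_scal by exact E2.
  rewrite <- CRInt_plus by (try exact E1; apply ex_CRInt_scal, E2).
  unfold seg_int; f_equal; apply functional_extensionality; intros t.
  rewrite !RtoC_mult, RtoC_minus, RtoC_mult; ring. }
unfold Schwarz_w.
rewrite (KA 1 (g 1) (h 1)), (KA _ (g r) (h r)) by auto.
rewrite (KS (-1) (fun s => g s (PI / alpha)) (fun s => h s (PI / alpha))) by auto.
rewrite (KS 1 (fun s => g s 0) (fun s => h s 0)) by auto.
ring.
Qed.

(* The summand of the poly-Schwarz operator of degree [m], without its
   factorial factor. *)
Definition Schwarz_moment (r alpha : R) (g : R -> R -> R) (m : nat) (z : C) : C :=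
  Schwarz_w r alpha (fun s phi => g s phi * (2 * Re (polar s phi) - 2 * Re z) ^ m)
    (Cpower z alpha).

Lemma data_ok_moment (r alpha x : R) (g : R -> R -> R) (m : nat) :
  data_ok r alpha g -> data_ok r alpha (fun s phi => g s phi * (2 * Re (polar s phi) - x) ^ m).
Proof.
intros Hg; apply data_ok_mult; [exact Hg|].
apply (data_ok_pow r alpha (fun s phi => 2 * Re (polar s phi) - x)).
apply (data_ok_Re r alpha 2 (- x)).
Qed.

(** The data of a moment depend on z, so [Schwarz_w_rdiff] does not apply to it directly. Peeling
    off one factor leaves the explicit 2 Re z outside the integral. *)
Lemma Schwarz_moment_S (r alpha : R) (g : R -> R -> R) (m : nat) (z : C) :
  0 < r < 1 -> 0 < alpha -> data_ok r alpha g -> Omega r alpha z ->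
  Schwarz_moment r alpha g (S m) z
   = (Schwarz_moment r alpha (fun s phi => g s phi * (2 * Re (polar s phi)))%R m z
      + (-1) * (RtoC (2 * Re z) * Schwarz_moment r alpha g m z))%C.
Proof.
intros Hr Ha Hg Hz; unfold Schwarz_moment.
rewrite <- Schwarz_w_lin; try assumption.
- f_equal; apply functional_extensionality; intros s; apply functional_extensionality; intros phi.
  simpl; ring.
- apply data_ok_moment, (data_ok_mult r alpha g); [exact Hg|].
  apply (data_ok_ext r alpha (fun s phi => 2 * Re (polar s phi) + 0));
    [intros; ring|apply data_ok_Re].
- apply data_ok_moment, Hg.
- apply Omega_Cpower; assumption.
Qed.

Lemma Omega_open (r alpha : R) (z : C) :
  0 < r < 1 -> Omega r alpha z -> locally z (Omega r alpha).
Proof.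
intros Hr Hz.
pose proof (Omega_neq0 r alpha z ltac:(lra) Hz) as Hz0.
destruct Hz as [[H1 H2] [H3 H4]].
assert (He : 0 < Rmin (Carg z) (PI / alpha - Carg z)) by (apply Rmin_glb_lt; lra).
destruct (clog_continuous z Hz0 H3 _ He) as (d & Hd & H).
apply locally_Cmod.
exists (Rmin d (Rmin (Cmod z - r) (1 - Cmod z))); split; [repeat apply Rmin_glb_lt; lra|].
intros y Hy.
pose proof (Rlt_le_trans _ _ _ Hy (Rmin_l _ _)) as Y1.
pose proof (Rlt_le_trans _ _ _ Hy (Rmin_r _ _)) as Y2.
pose proof (Rlt_le_trans _ _ _ Y2 (Rmin_l _ _)) as Y3.
pose proof (Rlt_le_trans _ _ _ Y2 (Rmin_r _ _)) as Y4.
pose proof (Cmod_sub_le y z). pose proof (Cmod_sub_le z y) as Y5.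
rewrite Cmod_sub_sym in Y5.
split; [lra|].
specialize (H (y - z)%C Y1); replace (z + (y - z))%C with y in H by ring.
pose proof (im_le_Cmod (clog y - clog z)) as K.
rewrite im_minus in K; unfold clog in K; simpl Im in K.
pose proof (Rmin_l (Carg z) (PI / alpha - Carg z)).
pose proof (Rmin_r (Carg z) (PI / alpha - Carg z)).
fold (clog y) (clog z) in K.
apply Rabs_le_between in K; lra.
Qed.

(** The induction is over all data, because the recursion replaces g by 2 Re zeta times g. *)
Lemma Schwarz_moment_rdiff (r alpha : R) (m : nat) : forall (g : R -> R -> R) (z : C),
  0 < r < 1 -> 0 < alpha -> data_ok r alpha g -> Omega r alpha z ->
  exists A, rdiff (Schwarz_moment r alpha g m) z A
    (- RtoC (INR m) * Schwarz_moment r alpha g (pred m) z)%C.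
Proof.
induction m as [|m IH]; intros g z Hr Ha Hg Hz.
- destruct (Cpower_rdiff r alpha z Hr Hz) as [A HA].
  exists (Schwarz_w' r alpha g (Cpower z alpha) * A)%C.
  eapply rdiff_eq; [|reflexivity|].
  + apply (rdiff_ext (fun y => Schwarz_w r alpha g (Cpower y alpha))).
    * intros y; unfold Schwarz_moment; f_equal.
      apply functional_extensionality; intros s; apply functional_extensionality; intros phi.
      simpl; ring.
    * apply (rdiff_comp _ (fun y => Cpower y alpha)); [exact HA|].
      apply Schwarz_w_rdiff; try assumption; apply Omega_Cpower; assumption.
  + simpl INR; ring.
- set (g2 := fun s phi => g s phi * (2 * Re (polar s phi))).
  assert (Hg2 : data_ok r alpha g2).
  { apply (data_ok_mult r alpha g); [exact Hg|].
    apply (data_ok_ext r alpha (fun s phi => 2 * Re (polar s phi) + 0));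
      [intros; ring|apply data_ok_Re]. }
  destruct (IH g2 z Hr Ha Hg2 Hz) as [A1 D1].
  destruct (IH g z Hr Ha Hg Hz) as [A2 D2].
  pose proof (rdiff_plus _ _ _ _ _ _ _ D1 (rdiff_scal (-1) _ _ _ _ (rdiff_mult_2Re _ _ _ _ D2))) as D.
  eexists; eapply rdiff_eq; [eapply rdiff_ext_loc; [|exact D]|reflexivity|].
  + generalize (Omega_open r alpha z Hr Hz); apply filter_imp; intros y Hy.
    symmetry; apply Schwarz_moment_S; assumption.
  + change (pred (S m)) with m; rewrite S_INR, RtoC_plus.
    (* For m = 0 the truncated predecessor would give a meaningless moment of order -1, but its
       coefficient INR 0 is zero; otherwise one more use of the recursion recombines the two moments
       of lower order. *)
    destruct m as [|m].
    * simpl INR; ring.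
    * change (pred (S m)) with m.
      rewrite (Schwarz_moment_S r alpha g m z) by assumption; fold g2; ring.
Qed.

(** * Iterated conjugate derivatives of the poly-Schwarz operator *)

(** A sum over j < N that is empty for N = 0: the n-th conjugate derivative vanishes because it is a
    sum of n - n terms. *)
Fixpoint csum (f : nat -> C) (N : nat) : C :=
  match N with O => 0%C | S N => (csum f N + f N)%C end.

Lemma csum_ext (f g : nat -> C) (N : nat) :
  (forall j, (j < N)%nat -> f j = g j) -> csum f N = csum g N.
Proof.
induction N as [|N IH]; intros H; [reflexivity|]; simpl.
rewrite IH, (H N) by (try lia; intros; apply H; lia); reflexivity.
Qed.

Lemma csum_shift (f : nat -> C) (N : nat) :
  csum f (S N) = (f O + csum (fun j => f (S j)) N)%C.
Proof.
induction N as [|N IH]; [simpl; ring|].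
change (csum f (S (S N))) with (csum f (S N) + f (S N))%C; rewrite IH; simpl; ring.
Qed.

Lemma csum_sum_n_m (f : nat -> C) (N : nat) :
  sum_n_m (G := C_AbelianGroup) f 0 N = csum f (S N).
Proof.
induction N as [|N IH].
- rewrite sum_n_n; simpl; symmetry; apply Cplus_0_l.
- rewrite sum_n_Sm by lia; rewrite IH; reflexivity.
Qed.

Lemma csum_rdiff (f : nat -> C -> C) (B : nat -> C) (z : C) (N : nat) :
  (forall j, (j < N)%nat -> exists A, rdiff (f j) z A (B j)) ->
  exists A, rdiff (fun y => csum (fun j => f j y) N) z A (csum B N).
Proof.
induction N as [|N IH]; intros H.
- exists 0%C; exact (rdiff_const 0 z).
- destruct IH as [A1 D1]; [intros j Hj; apply H; lia|].
  destruct (H N ltac:(lia)) as [A2 D2].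
  exists (A1 + A2)%C; apply (rdiff_plus _ _ _ _ _ _ _ D1 D2).
Qed.

Definition poly_coef (j : nat) : R := (-1) ^ j / INR (fact j).

(* The claimed value of [dbar_n l (poly_Schwarz r alpha n gamma)]. *)
Definition dbar_sum (r alpha : R) (n : nat) (gamma : nat -> C -> R) (l : nat) (z : C) : C :=
  csum (fun j => RtoC (poly_coef j) *
    Schwarz_moment r alpha (fun s phi => gamma (l + j)%nat (polar s phi)) j z)%C (n - l).

Lemma poly_coef_S (j : nat) : poly_coef (S j) * - INR (S j) = poly_coef j.
Proof.
unfold poly_coef; rewrite fact_simpl, mult_INR.
pose proof (INR_fact_lt_0 j). pose proof (lt_0_INR (S j) ltac:(lia)).
simpl pow; field; lra.
Qed.

(** The conjugate derivative kills the term j = 0 and lowers the order of the others by one. The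
    factorial coefficients absorb the factor - j, and renumbering moves the data from index l to l +
    1. *)
Lemma dbar_sum_rdiff (r alpha : R) (n : nat) (gamma : nat -> C -> R) (l : nat) (z : C) :
  0 < r < 1 -> 0 < alpha -> (l < n)%nat ->
  (forall k, (k < n)%nat -> data_ok r alpha (fun s phi => gamma k (polar s phi))) ->
  Omega r alpha z ->
  exists A, rdiff (dbar_sum r alpha n gamma l) z A (dbar_sum r alpha n gamma (S l) z).
Proof.
intros Hr Ha Hl Hg Hz.
set (G := fun k s phi => gamma k (polar s phi)).
destruct (csum_rdiff (fun j y => RtoC (poly_coef j) * Schwarz_moment r alpha (G (l + j)%nat) j y)%C
  (fun j => RtoC (poly_coef j) * (- RtoC (INR j) * Schwarz_moment r alpha (G (l + j)%nat) (pred j) z))%C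
  z (n - l)) as [A D].
- intros j Hj.
  destruct (Schwarz_moment_rdiff r alpha j (G (l + j)%nat) z Hr Ha (Hg (l + j)%nat ltac:(lia)) Hz) as [A D].
  exists (RtoC (poly_coef j) * A)%C; apply rdiff_scal, D.
- exists A; eapply rdiff_eq; [exact D|reflexivity|].
  unfold dbar_sum; replace (n - l)%nat with (S (n - S l)) by lia.
  rewrite csum_shift; simpl INR at 1.
  transitivity (csum (fun j => RtoC (poly_coef (S j)) *
     (- RtoC (INR (S j)) * Schwarz_moment r alpha (G (l + S j)%nat) (pred (S j)) z)) (n - S l))%C;
    [ring|].
  apply csum_ext; intros j _; simpl pred.
  replace (l + S j)%nat with (S l + j)%nat by lia.
  rewrite <- (poly_coef_S j), RtoC_mult, RtoC_opp; unfold G; ring.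
Qed.

Lemma poly_Schwarz_sum (r alpha : R) (n : nat) (gamma : nat -> C -> R) (z : C) :
  0 < r < 1 -> 0 < alpha -> (1 <= n)%nat ->
  (forall k, (k < n)%nat -> data_ok r alpha (fun s phi => gamma k (polar s phi))) ->
  Omega r alpha z ->
  poly_Schwarz r alpha n gamma z = dbar_sum r alpha n gamma 0 z.
Proof.
intros Hr Ha Hn Hg Hz.
unfold poly_Schwarz; rewrite csum_sum_n_m.
unfold dbar_sum; rewrite Nat.sub_0_r, Nat.succ_pred by lia.
apply csum_ext; intros k Hk; simpl Nat.add; f_equal.
unfold Schwarz_moment.
rewrite <- Schwarz_z_w by (try assumption; apply data_ok_moment, Hg, Hk).
assert (E : forall zeta : C, ((zeta - z + Cconj (zeta - z)) ^ k)%C = RtoC ((2 * Re zeta - 2 * Re z) ^ k)).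
{ intros zeta; rewrite RtoC_pow; f_equal.
  apply injective_projections; simpl; unfold Re; ring. }
unfold Schwarz_z; f_equal; f_equal; f_equal;
  apply functional_extensionality; intros s; apply functional_extensionality; intros phi;
  cbv zeta; rewrite E, <- RtoC_mult; reflexivity.
Qed.

Lemma dbar_n_poly_Schwarz (r alpha : R) (n : nat) (gamma : nat -> C -> R) (l : nat) :
  0 < r < 1 -> 0 < alpha -> (1 <= n)%nat -> (l <= n)%nat ->
  (forall k, (k < n)%nat -> data_ok r alpha (fun s phi => gamma k (polar s phi))) ->
  forall z, Omega r alpha z ->
  dbar_n l (poly_Schwarz r alpha n gamma) z = dbar_sum r alpha n gamma l z.
Proof.
intros Hr Ha Hn Hl Hg; induction l as [|l IH]; intros z Hz.
- apply poly_Schwarz_sum; assumption.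
- destruct (dbar_sum_rdiff r alpha n gamma l z Hr Ha ltac:(lia) Hg Hz) as [A D].
  (* The derivative at z involves values near z, while the induction hypothesis holds on the domain
     only; openness of the domain closes the gap. *)
  apply (rdiff_dbar _ z A); eapply rdiff_ext_loc; [|exact D].
  generalize (Omega_open r alpha z Hr Hz); apply filter_imp; intros y Hy.
  symmetry; apply IH; [lia|exact Hy].
Qed.

(** * Boundary data and boundary values on the sector ring *)

(** For a <= b this is the clamp of t to [a, b], with the minimum of b and t written as - Rmax (- b)
    (- t). *)
Lemma clamp_continuous (a b s : R) : continuous (fun t => Rmax a (- Rmax (- b) (- t))) s.
Proof.
apply (continuous_comp (fun t => - Rmax (- b) (- t)) (Rmax a)); [|apply Rmax_continuous].
apply (continuous_opp (V := R_NormedModule) (fun t => Rmax (- b) (- t))).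
apply (continuous_comp (fun t => - t) (Rmax (- b))); [|apply Rmax_continuous].
apply (continuous_opp (V := R_NormedModule) (fun t => t)), continuous_id.
Qed.

(** Clamping the parameter keeps the curve inside D, so continuity relative to D becomes continuity
    on the whole line. *)
Lemma cont_ext_on (D : C -> Prop) (gamma : C -> R) (c : R -> C) (a b : R) :
  a <= b -> continuous_on D gamma -> (forall s, Ccontinuous_at c s) ->
  (forall s, a <= s <= b -> D (c s)) -> cont_ext a b (fun s => gamma (c s)).
Proof.
intros Hab Hg Hc HD.
set (cl := fun t => Rmax a (- Rmax (- b) (- t))).
assert (Hcl : forall t, a <= cl t <= b).
{ intros t; unfold cl; split; [apply Rmax_l|].
  apply Rmax_lub; [exact Hab|]; pose proof (Rmax_l (- b) (- t)); lra. }
exists (fun s => gamma (c (cl s))); split.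
- intros s; unfold continuous.
  apply (filterlim_comp _ _ _ (fun t => c (cl t)) gamma _ (within D (locally (c (cl s))))).
  + intros P HP.
    assert (K : continuous (U := C_UniformSpace) (fun t => c (cl t)) s).
    { apply (continuous_comp cl c); [apply clamp_continuous|apply Hc]. }
    specialize (K _ HP); unfold filtermap in K |- *.
    revert K; apply filter_imp; intros t Ht; apply Ht, HD, Hcl.
  + apply Hg, HD, Hcl.
- intros s Hs; do 2 f_equal; unfold cl.
  rewrite (Rmax_right (- b)), Ropp_involutive, Rmax_right by lra; reflexivity.
Qed.

Lemma data_ok_gamma (r alpha : R) (gamma : C -> R) :
  0 < r < 1 -> 0 < alpha -> continuous_on (bdry_Omega r alpha) gamma ->
  data_ok r alpha (fun s phi => gamma (polar s phi)).
Proof.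
intros Hr Ha Hg.
pose proof (theta_pos alpha Ha) as Hth.
assert (KA : forall s tau, Ccontinuous_at (fun t => polar s t) tau).
{ intros s tau; apply Ccontinuous_pair;
    apply (ex_derive_continuous (K := R_AbsRing) (V := R_NormedModule)); auto_derive; trivial. }
assert (KS : forall phi s, Ccontinuous_at (fun t => polar t phi) s).
{ intros s tau; apply Ccontinuous_pair;
    apply (ex_derive_continuous (K := R_AbsRing) (V := R_NormedModule)); auto_derive; trivial. }
split; [|split; [|split]].
- apply (cont_ext_on _ gamma (fun t => polar 1 t)) with (2 := Hg); [lra|apply KA|].
  intros t Ht; right; left; exists t; auto.
- apply (cont_ext_on _ gamma (fun t => polar r t)) with (2 := Hg); [lra|apply KA|].
  intros t Ht; right; right; right; exists t; auto.
- apply (cont_ext_on _ gamma (fun t => polar t (PI / alpha))) with (2 := Hg); [lra|apply KS|].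
  intros t Ht; right; right; left; exists t; auto.
- apply (cont_ext_on _ gamma (fun t => polar t 0)) with (2 := Hg); [lra|apply KS|].
  intros t Ht; left; exists t; auto.
Qed.

Lemma bdry_param_polar (r alpha s phi : R) :
  0 < r < 1 -> 0 < alpha -> bdry_param r alpha s phi ->
  bdry_Omega r alpha (polar s phi) /\ r <= s <= 1 /\ 0 <= phi <= PI / alpha.
Proof.
intros Hr Ha H; pose proof (theta_pos alpha Ha) as Hth.
destruct H as [[[-> | ->] Hp]|[Hs [-> | ->]]].
- split; [right; left; exists phi; auto|lra].
- split; [right; right; right; exists phi; auto|lra].
- split; [left; exists s; auto|lra].
- split; [right; right; left; exists s; auto|lra].
Qed.

Lemma data_ok_bounded (r alpha : R) (g : R -> R -> R) :
  0 < r < 1 -> 0 < alpha -> data_ok r alpha g ->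
  exists M, 0 < M /\ forall s phi, bdry_param r alpha s phi -> Rabs (g s phi) <= M.
Proof.
intros Hr Ha (G1 & G2 & G3 & G4); pose proof (theta_pos alpha Ha) as Hth.
destruct (cont_ext_bounded _ _ _ (Rlt_le _ _ Hth) G1) as (M1 & P1 & B1).
destruct (cont_ext_bounded _ _ _ (Rlt_le _ _ Hth) G2) as (M2 & P2 & B2).
destruct (cont_ext_bounded _ _ _ (Rlt_le _ _ (proj2 Hr)) G3) as (M3 & P3 & B3).
destruct (cont_ext_bounded _ _ _ (Rlt_le _ _ (proj2 Hr)) G4) as (M4 & P4 & B4).
exists (M1 + M2 + M3 + M4); split; [lra|].
intros s phi [[[-> | ->] Hp]|[Hs [-> | ->]]];
  [specialize (B1 _ Hp)|specialize (B2 _ Hp)|specialize (B4 _ Hs)|specialize (B3 _ Hs)]; lra.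
Qed.

(** The limit gamma t 0^m covers two statements: for m = 0 the data are close to gamma t near the
    pole, and for m > 0 the weight 2 Re zeta - 2 Re z makes them small there. *)
Lemma Schwarz_moment_boundary (r alpha : R) (gamma : C -> R) (m : nat) (t : C) :
  0 < r < 1 -> 1 / 2 <= alpha -> continuous_on (bdry_Omega r alpha) gamma ->
  bdry_Omega r alpha t -> forall eps, 0 < eps -> exists d, 0 < d /\
  forall z, Omega r alpha z -> Cmod (z - t) < d ->
    Rabs (Re (Schwarz_moment r alpha (fun s phi => gamma (polar s phi)) m z)
          - gamma t * 0 ^ m) <= eps.
Proof.
intros Hr Ha12 Hg Ht eps Heps.
assert (Ha : 0 < alpha) by lra.
pose proof (Rpower_in_01 r alpha Hr Ha) as Hrho.
set (g := fun s phi => gamma (polar s phi)).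
pose proof (data_ok_gamma r alpha gamma Hr Ha Hg) as Hok; fold g in Hok.
destruct (data_ok_bounded r alpha g Hr Ha Hok) as (M & HM & HMb).
destruct (Schwarz_w_boundary r alpha Hr Ha) as (M0 & HM0 & Hbd).
set (e := eps / (2 * M0)).
assert (He : 0 < e) by (apply Rdiv_lt_0_compat; lra).
set (c := gamma t * 0 ^ m).
(* Both zeta and z have modulus at most 1, so |2 Re zeta - 2 Re z| <= 4. *)
set (B := M * 4 ^ m + Rabs c).
assert (HB : 0 < B).
{ assert (0 < M * 4 ^ m) by (apply Rmult_lt_0_compat; [|apply pow_lt]; lra).
  pose proof (Rabs_pos c); unfold B; lra. }
assert (Hcont : exists d1, 0 < d1 /\ forall y, bdry_Omega r alpha y -> Cmod (y - t) < d1 ->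
   Rabs (gamma y - gamma t) < e).
{ pose proof (proj1 (filterlim_locally (F := within (bdry_Omega r alpha) (locally t)) gamma (gamma t)) (Hg t Ht) (mkposreal e He)) as K.
  apply locally_Cmod in K; destruct K as (d1 & Hd1 & K).
  exists d1; split; [exact Hd1|]; intros y Hy Hyt; exact (K y Hyt Hy). }
destruct Hcont as (d1 & Hd1 & Hcont).
set (L := 5 / (alpha * Rpower r alpha)).
assert (HL : 0 < L) by (apply Rdiv_lt_0_compat; [|apply Rmult_lt_0_compat]; lra).
(* The first entry gives zeta within d1 of t and serves for m = 0. The others serve for m > 0: the
   second makes |x| <= 1, hence |x|^m <= |x|, and the third makes M |x| <= e, where x = 2 Re zeta -
   2 Re z. *)
set (d := Rmin (d1 / (2 * L)) (Rmin (1 / (2 * L)) (e / (2 * L * M)))).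
assert (Hd : 0 < d).
{ assert (0 < 2 * L * M) by (apply Rmult_lt_0_compat; [lra|exact HM]).
  repeat apply Rmin_glb_lt; apply Rdiv_lt_0_compat; lra. }
destruct (Hbd B d HB Hd (eps / 2) ltac:(lra)) as (eta & Heta & Hmain).
destruct (Cpower_near_bdry r alpha t Hr Ha12 Ht eta Heta) as (d2 & Hd2 & Hnear).
exists (Rmin d2 (d1 / 2)); split; [apply Rmin_glb_lt; lra|].
intros z Hz Hzt.
pose proof (Rlt_le_trans _ _ _ Hzt (Rmin_l _ _)) as Z1.
pose proof (Rlt_le_trans _ _ _ Hzt (Rmin_r _ _)) as Z2.
destruct (Hnear z Hz Z1) as (tau & Htau & Hwt).
replace eps with (e * M0 + eps / 2) by (unfold e; field; lra).
apply (Hmain _ e c _ tau); try assumption.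
- lra.
- apply data_ok_moment, Hok.
- apply Omega_Cpower; assumption.
- intros s phi Hp.
  destruct (bdry_param_polar r alpha s phi Hr Ha Hp) as (P1 & P2 & P3).
  specialize (HMb s phi Hp).
  assert (Hx : Rabs (2 * Re (polar s phi) - 2 * Re z) <= 2 * Cmod (polar s phi - z)).
  { replace (2 * Re (polar s phi) - 2 * Re z) with (2 * Re (polar s phi - z)) by (rewrite re_minus; ring).
    rewrite Rabs_mult, (Rabs_pos_eq 2) by lra.
    apply Rmult_le_compat_l; [lra|apply re_le_Cmod]. }
  set (x := 2 * Re (polar s phi) - 2 * Re z) in *.
  split.
  + assert (H4 : Rabs x <= 4).
    { assert (Cmod (polar s phi - z) <= Cmod (polar s phi) + Cmod z)
        by (unfold Cminus; eapply Rle_trans; [apply Cmod_triangle|rewrite Cmod_opp; lra]).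
      rewrite Cmod_polar in H by lra. destruct Hz; lra. }
    replace (g s phi * x ^ m - c) with (g s phi * x ^ m + - c) by ring.
    eapply Rle_trans; [apply Rabs_triang|]; rewrite Rabs_Ropp, Rabs_mult, <- RPow_abs.
    unfold B; apply Rplus_le_compat_r.
    apply Rmult_le_compat; [apply Rabs_pos|apply pow_le, Rabs_pos|exact HMb|].
    apply pow_incr; split; [apply Rabs_pos|exact H4].
  + intros Hwd.
    pose proof (polar_pow_dist r alpha s phi z Hr Ha Hz P2 P3) as Hdist; fold L in Hdist.
    rewrite (Cmod_sub_sym (polar_pow s phi alpha)) in Hdist.
    pose proof (Rmin_l (d1 / (2 * L)) (Rmin (1 / (2 * L)) (e / (2 * L * M)))) as N1.
    pose proof (Rmin_r (d1 / (2 * L)) (Rmin (1 / (2 * L)) (e / (2 * L * M)))) as N2.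
    pose proof (Rmin_l (1 / (2 * L)) (e / (2 * L * M))) as N3.
    pose proof (Rmin_r (1 / (2 * L)) (e / (2 * L * M))) as N4.
    fold d in N1, N2.
    assert (Hzd : 2 * Cmod (polar s phi - z) <= 2 * (L * d)).
    { apply Rmult_le_compat_l; [lra|]. eapply Rle_trans; [exact Hdist|].
      apply Rmult_le_compat_l; lra. }
    destruct m as [|m].
    * unfold c; rewrite !pow_O, !Rmult_1_r.
      left; apply Hcont; [exact P1|].
      assert (L * d <= d1 / 2).
      { replace (d1 / 2) with (L * (d1 / (2 * L))) by (field; lra).
        apply Rmult_le_compat_l; lra. }
      replace (polar s phi - t)%C with ((polar s phi - z) + (z - t))%C by ring.
      eapply Rle_lt_trans; [apply Cmod_triangle|]; lra.
    * unfold c; replace (g s phi * x ^ S m - gamma t * 0 ^ S m) with (g s phi * x ^ S m) by (simpl; ring).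
      rewrite Rabs_mult, <- RPow_abs.
      assert (X1 : Rabs x <= 1).
      { apply Rle_trans with (2 * (L * (1 / (2 * L)))); [|right; field; lra].
        eapply Rle_trans; [exact Hx|]. eapply Rle_trans; [exact Hzd|].
        apply Rmult_le_compat_l; [lra|]; apply Rmult_le_compat_l; lra. }
      assert (X2 : M * Rabs x <= e).
      { apply Rle_trans with (M * (2 * (L * (e / (2 * L * M))))); [|right; field; lra].
        apply Rmult_le_compat_l; [lra|].
        eapply Rle_trans; [exact Hx|]. eapply Rle_trans; [exact Hzd|].
        apply Rmult_le_compat_l; [lra|]; apply Rmult_le_compat_l; lra. }
      assert (X3 : Rabs x ^ S m <= Rabs x * 1).
      { simpl; apply Rmult_le_compat_l; [apply Rabs_pos|].
        rewrite <- (pow1 m); apply pow_incr; split; [apply Rabs_pos|exact X1]. }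
      rewrite Rmult_1_r in X3.
      eapply Rle_trans; [|exact X2].
      apply Rmult_le_compat; [apply Rabs_pos|apply pow_le, Rabs_pos|exact HMb|exact X3].
Qed.

Lemma csum_boundary (f : nat -> C -> C) (v : nat -> R) (D : C -> Prop) (t : C) (N : nat) :
  (forall j, (j < N)%nat -> forall eps, 0 < eps -> exists d, 0 < d /\
     forall z, D z -> Cmod (z - t) < d -> Rabs (Re (f j z) - v j) <= eps) ->
  forall eps, 0 < eps -> exists d, 0 < d /\
     forall z, D z -> Cmod (z - t) < d ->
       Rabs (Re (csum (fun j => f j z) N) - Re (csum (fun j => RtoC (v j)) N)) <= eps.
Proof.
induction N as [|N IH]; intros H eps Heps.
- exists 1; split; [lra|]; intros z _ _; simpl; rewrite Rminus_diag, Rabs_R0; lra.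
- destruct (IH ltac:(intros j Hj; apply H; lia) (eps / 2) ltac:(lra)) as (d1 & Hd1 & E1).
  destruct (H N ltac:(lia) (eps / 2) ltac:(lra)) as (d2 & Hd2 & E2).
  exists (Rmin d1 d2); split; [apply Rmin_glb_lt; assumption|].
  intros z Hz Hzt.
  specialize (E1 z Hz (Rlt_le_trans _ _ _ Hzt (Rmin_l _ _))).
  specialize (E2 z Hz (Rlt_le_trans _ _ _ Hzt (Rmin_r _ _))).
  simpl csum; rewrite !re_plus, re_RtoC.
  match goal with |- Rabs (?a + ?b - (?a' + ?b')) <= _ =>
    replace (a + b - (a' + b')) with ((a - a') + (b - b')) by ring end.
  eapply Rle_trans; [apply Rabs_triang|]; lra.
Qed.

Theorem lemma3p1 (r alpha : R) (Hr : 0 < r < 1) (Halpha : 1 / 2 <= alpha)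
  (n : nat) (Hn : (1 <= n)%nat) (gamma : nat -> C -> R)
  (Hgamma : forall k : nat, (k < n)%nat ->
     continuous_on (bdry_Omega r alpha) (gamma k)) :
  let S := poly_Schwarz r alpha n gamma in
  (forall k : nat, (k < n)%nat -> forall z : C, Omega r alpha z ->
     R_differentiable (dbar_n k S) z) /\
  (forall z : C, Omega r alpha z -> dbar_n n S z = RtoC 0) /\
  (forall (k : nat) (t : C), (k < n)%nat -> bdry_Omega r alpha t ->
     filterlim (fun z : C => Re (dbar_n k S z))
       (within (Omega r alpha) (locally t)) (locally (gamma k t))).
Proof.
assert (Ha : 0 < alpha) by lra.
assert (Hok : forall k, (k < n)%nat -> data_ok r alpha (fun s phi => gamma k (polar s phi)))
  by (intros k Hk; apply data_ok_gamma; auto).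
intros S.
assert (HS : forall l, (l <= n)%nat -> forall z, Omega r alpha z ->
   dbar_n l S z = dbar_sum r alpha n gamma l z)
  by (intros l Hl; apply dbar_n_poly_Schwarz; assumption).
split; [|split].
- intros k Hk z Hz.
  destruct (dbar_sum_rdiff r alpha n gamma k z Hr Ha Hk Hok Hz) as [A D].
  apply (rdiff_R_differentiable _ z A (dbar_sum r alpha n gamma (Datatypes.S k) z)).
  eapply rdiff_ext_loc; [|exact D].
  generalize (Omega_open r alpha z Hr Hz); apply filter_imp; intros y Hy.
  symmetry; apply HS; [lia|exact Hy].
- intros z Hz; rewrite HS by (try lia; exact Hz).
  unfold dbar_sum; rewrite Nat.sub_diag; reflexivity.
- intros k t Hk Ht.
  apply filterlim_locally; intros eps.
  assert (Heps : 0 < eps / 2) by (pose proof (cond_pos eps); lra).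
  destruct (csum_boundary
    (fun j z => RtoC (poly_coef j) *
      Schwarz_moment r alpha (fun s phi => gamma (k + j)%nat (polar s phi)) j z)%C
    (fun j => poly_coef j * (gamma (k + j)%nat t * 0 ^ j)) (Omega r alpha) t (n - k)) with (eps := eps / 2)
    as (d & Hd & H); [|exact Heps|].
  + intros j Hj e He.
    assert (Hc : 0 < Rabs (poly_coef j) + 1) by (pose proof (Rabs_pos (poly_coef j)); lra).
    destruct (Schwarz_moment_boundary r alpha (gamma (k + j)%nat) j t Hr Halpha
      (Hgamma (k + j)%nat ltac:(lia)) Ht (e / (Rabs (poly_coef j) + 1)) ltac:(apply Rdiv_lt_0_compat; lra))
      as (d & Hd & H).
    exists d; split; [exact Hd|]; intros z Hz Hzt; specialize (H z Hz Hzt).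
    rewrite re_scal_l, <- Rmult_minus_distr_l, Rabs_mult.
    apply Rle_trans with ((Rabs (poly_coef j) + 1) * (e / (Rabs (poly_coef j) + 1))).
    * apply Rmult_le_compat; try apply Rabs_pos; [lra|exact H].
    * right; field; lra.
  + apply locally_Cmod; exists d; split; [exact Hd|]; intros z Hzt Hz.
    specialize (H z Hz Hzt).
    change (Rabs (Re (dbar_n k S z) - gamma k t) < eps).
    rewrite HS by (try lia; exact Hz).
    (* Only j = 0 survives, where the coefficient and 0^0 are both 1; this term exists because k <
       n. *)
    assert (E : Re (csum (fun j => RtoC (poly_coef j * (gamma (k + j)%nat t * 0 ^ j))) (n - k)) = gamma k t).
    { replace (n - k)%nat with (Datatypes.S (n - Datatypes.S k)) by lia.
      rewrite csum_shift, re_plus, re_RtoC, Nat.add_0_r.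
      rewrite (csum_ext _ (fun _ => RtoC 0)).
      - assert (Z : forall N, csum (fun _ => RtoC 0) N = 0%C)
          by (induction N as [|N IH]; simpl; [reflexivity|rewrite IH; apply Cplus_0_l]).
        rewrite Z, re_RtoC; unfold poly_coef; simpl; field.
      - intros j _; f_equal; simpl; ring. }
    rewrite E in H; unfold dbar_sum.
    eapply Rle_lt_trans; [exact H|]; pose proof (cond_pos eps); lra.
Qed.
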